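(* Let $0\le\alpha<1$. (a) If $\nu>-\frac12$, then $r_\alpha^\star(f_\nu)=x_{\nu,\alpha,1}$, where $x_{\nu,\alpha,1}$ is the smallest positive root of $$r\mathbf{\Phi}_\nu'(r)-\alpha(2\nu+1)\mathbf{\Phi}_\nu(r)=0.$$ Moreover, if $\nu\in(-1,-\frac12)$, then $r_\alpha^\star(f_\nu)=x_{\nu,\alpha}$, where $x_{\nu,\alpha}$ is the unique root in $(0,\infty)$ of the equation $$\sqrt{i}\,r\,\mathbf{\Phi}_\nu'(\sqrt{i}\,r)-\alpha(2\nu+1)\mathbf{\Phi}_\nu(\sqrt{i}\,r)=0.$$ (b) If $\nu>-1$, then $r_\alpha^\star(g_\nu)=y_{\nu,\alpha,1}$, where $y_{\nu,\alpha,1}$ is the smallest positive root of $$r\mathbf{\Phi}_\nu'(r)-(\alpha+2\nu)\mathbf{\Phi}_\nu(r)=0.$$ (c) If $\nu>-1$, then $r_\alpha^\star(h_\nu)=z_{\nu,\alpha,1}$, where $z_{\nu,\alpha,1}$ is the smallest positive root of $$r^{1/4}\mathbf{\Phi}_\nu'(r^{1/4})-(4\alpha+2\nu-3)\mathbf{\Phi}_\nu(r^{1/4})=0.$$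
   Context: For $\nu>-1$, with $J_\nu,I_\nu$ the Bessel and modified Bessel functions of the first kind (principal powers), $$\mathbf{\Phi}_\nu(z)=J_\nu(z)I_\nu'(z)-J_\nu'(z)I_\nu(z)=2\sum_{n\ge0}\frac{(-1)^n(z/2)^{2\nu+4n+1}}{n!\,\Gamma(\nu+n+1)\Gamma(\nu+2n+2)}.$$ The normalized functions are $$f_\nu(z)=\left(2^{2\nu}\Gamma(\nu+1)\Gamma(\nu+2)\mathbf{\Phi}_\nu(z)\right)^{\frac{1}{2\nu+1}}\ (\nu\ne-\tfrac12),\quad g_\nu(z)=2^{2\nu}z^{-2\nu}\Gamma(\nu+1)\Gamma(\nu+2)\mathbf{\Phi}_\nu(z),$$ $$h_\nu(z)=2^{2\nu}z^{-\frac{\nu}{2}+\frac34}\Gamma(\nu+1)\Gamma(\nu+2)\mathbf{\Phi}_\nu(\sqrt[4]{z}),$$ with the branches chosen so that they are analytic near $0$ with value $0$ and derivative $1$ at $0$; in particular $zf_\nu'(z)/f_\nu(z)=\frac{1}{2\nu+1}\,z\mathbf{\Phi}_\nu'(z)/\mathbf{\Phi}_\nu(z)$. Here $\sqrt{i}=e^{i\pi/4}$. With $\mathbb{D}_r=\{z\in\mathbb{C}:|z|<r\}$, the radius of starlikeness of order $\alpha$ of a function $f$ is $$r_\alpha^\star(f)=\sup\left\{r>0:\ \operatorname{Re}\left(\frac{zf'(z)}{f(z)}\right)>\alpha\ \text{for all } z\in\mathbb{D}_r\right\}.$$ *)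

(* Defs.v *)
(* Stdlib reals with Coquelicot's complex numbers. *)
From Stdlib Require Import Reals Factorial ClassicalEpsilon.
From Coquelicot Require Import Coquelicot.

Open Scope R_scope.

(* Meaningful for [0 < x] only, where the integral converges. *)
Definition Gamma (x : R) : R :=
  RInt_gen (fun t : R => Rpower t (x - 1) * exp (- t))
           (at_right 0) (Rbar_locally p_infty).

Definition Cexp (z : C) : C := (exp (Re z) * cos (Im z), exp (Re z) * sin (Im z)).

(* Principal argument, with values in (-PI, PI]. *)
Definition Arg (z : C) : R :=
  if Rle_dec 0 (Im z) then acos (Re z / Cmod z) else - acos (Re z / Cmod z).

Definition Clog (z : C) : C := (ln (Cmod z), Arg z).

(* Principal power [z ^ a] with a real exponent; [0 ^ 0 = 1] and [0 ^ a = 0]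
   for every [a <> 0]. *)
Definition Cpower (z : C) (a : R) : C :=
  if Ceq_dec z 0 then (if Req_dec_T a 0 then 1%C else 0%C)
  else Cexp (RtoC a * Clog z)%C.

(* [w] is one of the values of the multivalued power [u ^ a]. *)
Definition is_power_value (u : C) (a : R) (w : C) : Prop :=
  exists l : C, Cexp l = u /\ w = Cexp (RtoC a * l)%C.

Definition CSeries (a : nat -> C) : C :=
  (Series (fun n => Re (a n)), Series (fun n => Im (a n))).

Definition BesselJ (nu : R) (z : C) : C :=
  CSeries (fun n : nat =>
    (RtoC ((-1) ^ n / (INR (fact n) * Gamma (nu + INR n + 1)))
     * Cpower (z / 2) (2 * INR n + nu))%C).

Definition BesselI (nu : R) (z : C) : C :=
  CSeries (fun n : nat =>
    (RtoC (1 / (INR (fact n) * Gamma (nu + INR n + 1)))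
     * Cpower (z / 2) (2 * INR n + nu))%C).

(* [C_derive] is the limit of the difference quotient along the horizontal
   direction.  It agrees with the complex derivative wherever the latter exists;
   on the branch cut (-oo, 0) it is the derivative of the branch Arg = PI.  Hence
   [Phi nu z] is the expected value, with principal powers, at every [z <> 0]. *)
Definition Phi (nu : R) (z : C) : C :=
  (BesselJ nu z * C_derive (BesselI nu) z
   - C_derive (BesselJ nu) z * BesselI nu z)%C.

Definition normalizing_const (nu : R) : R :=
  Rpower 2 (2 * nu) * Gamma (nu + 1) * Gamma (nu + 2).

(* [f] is the branch of [(normalizing_const nu * Phi nu) ^ (1 / (2 nu + 1))] that
   is analytic near 0 with [f 0 = 0] and [f' 0 = 1].  A principal power would not
   do: even on a disc where [Phi nu] has no zero besides 0, the quotient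
   [Phi nu z / z ^ (2 nu + 1)] may wind across the cut.  The conditions determine
   [f] on the largest open disc where [Phi nu] has no zero besides 0, and leave it
   free outside that disc. *)
Definition is_f_branch (nu : R) (f : C -> C) : Prop :=
  f 0%C = 0%C /\
  is_derive (K := C_AbsRing) (V := C_NormedModule) f (RtoC 0) (RtoC 1) /\
  forall z : C, z <> 0%C ->
    (forall w : C, w <> 0%C -> Cmod w <= Cmod z -> Phi nu w <> 0%C) ->
    ex_derive (K := C_AbsRing) (V := C_NormedModule) f z /\
    is_power_value (RtoC (normalizing_const nu) * Phi nu z)%C (1 / (2 * nu + 1)) (f z).

Definition f_ (nu : R) : C -> C :=
  epsilon (inhabits (fun z : C => z)) (is_f_branch nu).

(* In [g_] and [h_] the arguments of the principal powers match exactly, so the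
   principal branches already give the entire functions normalized at 0. *)
Definition g_ (nu : R) (z : C) : C :=
  (RtoC (Rpower 2 (2 * nu)) * Cpower z (- 2 * nu)
   * RtoC (Gamma (nu + 1) * Gamma (nu + 2)) * Phi nu z)%C.

Definition h_ (nu : R) (z : C) : C :=
  (RtoC (Rpower 2 (2 * nu)) * Cpower z (- nu / 2 + 3 / 4)
   * RtoC (Gamma (nu + 1) * Gamma (nu + 2)) * Phi nu (Cpower z (1 / 4)))%C.

(* At [z = 0] the quotient [z f' z / f z] is 0/0; for a function normalized by
   [f 0 = 0], [f' 0 = 1] its limit there is 1, so the inequality only needs to be
   required for [z <> 0]. *)
Definition starlike_on_disc (alpha : R) (f : C -> C) (r : R) : Prop :=
  forall z : C, Cmod z < r ->
    ex_derive (K := C_AbsRing) (V := C_NormedModule) f z /\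
    (z <> 0%C -> f z <> 0%C /\ alpha < Re (z * C_derive f z / f z)%C).

Definition radius_starlikeness (alpha : R) (f : C -> C) : Rbar :=
  Lub_Rbar (fun r : R => 0 < r /\ starlike_on_disc alpha f r).

Definition smallest_positive_root (F : R -> C) (x : R) : Prop :=
  0 < x /\ F x = 0%C /\ forall y : R, 0 < y -> F y = 0%C -> x <= y.

Definition unique_positive_root (F : R -> C) (x : R) : Prop :=
  0 < x /\ F x = 0%C /\ forall y : R, 0 < y -> F y = 0%C -> y = x.

Definition sqrt_i : C := Cexp (Ci * RtoC (PI / 4))%C.

(* Main.v *)
From mathcomp Require all_boot all_order all_algebra ring complex Rstruct.
Require Import Defs.
From Stdlib Require Import Reals Lra Lia List Wf_nat Factorial ClassicalEpsilon FunctionalExtensionality.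
From Coquelicot Require Import Coquelicot.

Open Scope R_scope.

(** Write [W] for the power series with
    [normalizing_const nu * Phi nu z = z ^ (2 nu + 1) * W (z ^ 4)].  For each of
    the three normalized functions, [z f' / f = 1 + k * (w W' / W)] with
    [w = z ^ 4] and [k = 4 / (2 nu + 1)] for [f], [w = z ^ 4] and [k = 4] for
    [g], [w = z] and [k = 1] for [h].  So everything depends on the real part of
    [w W' / W] on circles.

    The series [W] is hypergeometric, with coefficients
    [(-1) ^ n / (64 ^ n n! (nu + 1)_n (nu / 2 + 1)_n ((nu + 3) / 2)_n)]: the
    Bessel equations turn into recurrences for the coefficients of the
    cross-product and of [J I] ([cross_recurrence], [product_recurrence],
    [Phi_eq]).  It is a limit of polynomials all of whose roots are positive.
    Indeed [p -> a p + X p'] with [a > 0] keeps all roots positive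
    ([posprod_euler_operator]), and applying it for [a, a + 1, ..., a + m - 1],
    for each of the three parameters, to [(1 - s X) ^ m] gives, after scaling,
    polynomials converging to [W] ([hyp_coef_approx], [rayleigh_sums]).

    For one positive root [1 / t], the number [t w / (1 - t w)] has its largest
    real part on [|w| = r] at [w = r] and its smallest at [w = - r], provided
    that [t r < 1].  Sums and limits keep this, and so on every circle that lies
    inside the first positive zero of [W] the real part of [w W' / W] is smallest
    on the positive and largest on the negative half-axis
    ([Re_log_derivative_upper], [Re_log_derivative_lower]).  The limit is taken
    in the coefficients of [Q = - W' / W]: they are limits of power sums of
    reciprocal roots, hence nonnegative, and they decay fast enough for [Q] to
    converge up to the first positive zero of [W].  Integrating [Q] gives
    [W = exp L] there ([CPS_exp_log]), hence the absence of zeros and the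
    analytic branch [z exp (L (z ^ 4) / (2 nu + 1))] for [f].

    If [k > 0], the inequality [Re (z f' / f) > alpha] therefore fails first at a
    positive [w], the first root of [beta W + w W'] with
    [beta = (1 - alpha) / k].  Before this root [w ^ beta * W] increases, so [W]
    has no zero up to and including it ([first_euler_root]).  If [k < 0], which
    happens for [f] with [nu < - 1 / 2], it fails first at a negative [w], that
    is for [z] on the ray through [sqrt i]; there the equation is
    [sum (n - beta) c_n x ^ n = 0] with positive [c_n], which has exactly one
    root, and [beta < 1 / 4] keeps this root inside the first positive zero of
    [W] ([negative_euler_root]).

    Any function satisfying [is_f_branch] has the modulus of the explicit branch,
    and the modulus alone determines the logarithmic derivative
    ([modulus_derive]), so no choice of arguments has to be followed. *)

(** * Polynomials with positive roots *)

(** The closure of positive-rootedness under [p -> a p + X p'] is proved over a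
    real closed field [R], whose extension [R[i]] is algebraically closed. *)
Module PositiveRoots.
Import mathcomp.boot.all_boot mathcomp.order.all_order mathcomp.algebra.all_algebra mathcomp.algebra_tactics.ring.
Import mathcomp.real_closed.complex.
Import GRing.Theory Num.Theory Order.TTheory.
Local Open Scope ring_scope.

(** Polynomials with value 1 at 0, listed by the reciprocals of their roots. *)
Definition posprod (K : nzRingType) (ts : seq K) : {poly K} :=
  \prod_(t <- ts) (1 - t *: 'X).

Lemma posprod_eval (K : fieldType) (ts : seq K) z :
  (posprod K ts).[z] = \prod_(t <- ts) (1 - t * z).
Proof.
rewrite /posprod horner_prod; apply: eq_bigr => t _.
by rewrite !hornerE.
Qed.

Lemma posprod_logder (K : fieldType) (ts : seq K) z :
  (posprod K ts).[z] != 0 ->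
  ((posprod K ts)^`()).[z] = - (posprod K ts).[z] * \sum_(t <- ts) t / (1 - t * z).
Proof.
rewrite /posprod; elim: ts => [|t ts IH].
  rewrite !big_nil derivC !hornerE. by [].
rewrite !big_cons derivM !hornerE mulf_eq0 negb_or => /andP [h1 h2].
rewrite (IH h2) !derivE !hornerE /=.
set P := _.[z]; set S := (\sum_(_ <- _) _).
by field.
Qed.

(** At a root [z] of [a p + X p'] with [p z <> 0] the partial fraction expansion
    of [p' / p] reads [a = z A - B], where [A] and [B] are sums of nonnegative
    terms; so [z = (a + B) / A] is a positive number. *)
Lemma euler_operator_root_pos (K : numClosedFieldType) (ts : seq K) (a z : K) :
  0 < a -> all (fun t => 0 < t) ts ->
  root (a *: posprod K ts + 'X * (posprod K ts)^`()) z -> 0 < z.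
Proof.
move=> a0 /allP tpos.
rewrite rootE !hornerE.
have [h|h] := eqVneq (posprod K ts).[z] 0.
  move=> _; move: h; rewrite posprod_eval => /eqP.
  rewrite prodf_seq_eq0 => /hasP [t tin /= /eqP e].
  have t0 := tpos _ tin.
  have -> : z = t^-1.
    apply: (mulfI (lt0r_neq0 t0)); rewrite divff ?lt0r_neq0 //.
    by apply/esym/eqP; rewrite -subr_eq0 e.
  by rewrite invr_gt0.
rewrite posprod_logder //.
set P := _.[z] in h *; set S := (\sum_(_ <- _) _) => e.
have {}e : a = z * S.
  apply/eqP; rewrite -subr_eq0; apply/eqP; apply: (mulIf h).
  by rewrite mul0r -(eqP e); ring.
pose A := \sum_(t <- ts) t / `|1 - t * z| ^+ 2.
pose B := \sum_(t <- ts) t ^+ 2 * `|z| ^+ 2 / `|1 - t * z| ^+ 2.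
have nz t : t \in ts -> 1 - t * z != 0.
  move=> tin; move: h; rewrite /P posprod_eval; apply: contraNneq => e0.
  by rewrite prodf_seq_eq0; apply/hasP; exists t => //=; rewrite e0.
have eS : z * S = z * A - B.
  rewrite /S /A /B !mulr_sumr -sumrB !big_seq; apply: eq_bigr => t tin.
  have t0 := tpos _ tin.
  have tr : Num.conj t = t by apply: conj_Creal; apply: gtr0_real.
  have := nz _ tin => nzt.
  have nzt' : Num.conj (1 - t * z) != 0 by rewrite conjC_eq0.
  rewrite !normCK; move: nzt'; rewrite rmorphB rmorphM rmorph1 /= tr => nzt'.
  by field; rewrite nzt nzt'.
have B0 : 0 <= B.
  rewrite /B big_seq; apply: sumr_ge0 => t tin.
  have t0 := ltW (tpos _ tin).
  by rewrite !(mulr_ge0, invr_ge0, exprn_ge0, normr_ge0).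
have A0 : 0 <= A.
  rewrite /A big_seq; apply: sumr_ge0 => t tin.
  have t0 := ltW (tpos _ tin).
  by rewrite !(mulr_ge0, invr_ge0, exprn_ge0, normr_ge0).
have zA : z * A = a + B by rewrite e eS; ring.
have aB : 0 < a + B by rewrite ltr_wpDr.
have An0 : A != 0 by apply: contraTneq aB => A00; rewrite -zA A00 mulr0 ltxx.
have Ap : 0 < A by rewrite lt_neqAle eq_sym An0.
have -> : z = (a + B) / A by rewrite -zA mulfK.
by rewrite divr_gt0.
Qed.

(** The polynomial on the left splits over [R[i]]; its roots are positive, so
    their reciprocals are the real numbers listed by [ts']. *)
Lemma posprod_euler_operator (R : rcfType) (ts : seq R) (a : R) :
  0 < a -> all (fun t => 0 < t) ts ->
  exists2 ts' : seq R, all (fun t => 0 < t) ts' &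
    a *: posprod R ts + 'X * (posprod R ts)^`() = a *: posprod R ts'.
Proof.
move=> a0 /allP tpos.
set q := a *: posprod R ts + _.
have q0 : q.[0] = a.
  by rewrite /q !hornerE posprod_eval big1_seq ?mulr1 // => t _; rewrite mulr0 subr0.
have [rs Ers] := closed_field_poly_normal (map_poly (real_complex R) q).
set l := lead_coef _ in Ers.
have qC0 : (map_poly (real_complex R) q).[0] = (a%:C)%C.
  by rewrite -q0 -(rmorph0 (real_complex R)) horner_map.
have an0 : (a%:C)%C != 0 :> R[i] by rewrite (fmorph_eq0 (real_complex R)) lt0r_neq0.
have l0 : l != 0.
  by apply: contraNneq an0 => l0; rewrite -qC0 Ers l0 scale0r horner0.
have rpos z : z \in rs -> 0 < z.
  move=> zin; apply: (@euler_operator_root_pos _ (map (real_complex R) ts) (a%:C)%C).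
  - by rewrite ltcR.
  - by apply/allP => _ /mapP [t tin ->]; rewrite ltcR tpos.
  have -> : posprod _ (map (real_complex R) ts) = map_poly (real_complex R) (posprod R ts).
    rewrite /posprod big_map rmorph_prod; apply: eq_bigr => t _.
    by rewrite rmorphB rmorph1 /= map_polyZ map_polyX.
  have -> : (a%:C)%C *: map_poly (real_complex R) (posprod R ts) +
     'X * (map_poly (real_complex R) (posprod R ts))^`() = map_poly (real_complex R) q.
    by rewrite /q rmorphD rmorphM /= map_polyZ map_polyX deriv_map.
  rewrite Ers rootE hornerZ horner_prod; apply/eqP.
  suff -> : \prod_(i <- rs) ('X - i%:P).[z] = 0 by rewrite mulr0.
  apply/eqP; rewrite prodf_seq_eq0; apply/hasP; exists z => //=.
  by rewrite !hornerE subrr.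
exists [seq complex.Re z^-1 | z <- rs].
  apply/allP => _ /mapP [z /rpos zp ->].
  have : 0 < z^-1 by rewrite invr_gt0.
  by case: (z^-1) => x y; rewrite ltcE /= => /andP [].
apply: (map_poly_inj (real_complex R)).
have eqC : map_poly (real_complex R) (posprod R [seq complex.Re z^-1 | z <- rs]) =
  \prod_(z <- rs) (1 - z^-1 *: 'X).
  rewrite /posprod big_map rmorph_prod !big_seq; apply: eq_bigr => z /rpos zp.
  rewrite rmorphB rmorph1 /= map_polyZ map_polyX; congr (_ - _ *: _).
  have : 0 < z^-1 by rewrite invr_gt0.
  by case: (z^-1) => x y; rewrite ltcE /= => /andP [/eqP -> _].
rewrite map_polyZ eqC /= Ers.
have -> : (a%:C)%C = l * \prod_(z <- rs) (- z).
  rewrite -qC0 Ers hornerZ horner_prod; congr (_ * _); apply: eq_bigr => z _.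
  by rewrite !hornerE ?sub0r ?add0r.
rewrite -scalerA -scaler_prod; congr (_ *: _).
rewrite !big_seq; apply: eq_bigr => z /rpos zp.
rewrite scalerBr scalerA mulNr divff ?lt0r_neq0 // scaleN1r opprK.
by rewrite addrC alg_polyC polyCN.
Qed.

Lemma coef_posprod0 (R : nzRingType) (t : R) ts :
  (posprod R (t :: ts))`_0 = (posprod R ts)`_0.
Proof.
by rewrite /posprod big_cons mulrBl mul1r coefB -scalerAl coefZ coefXM mulr0 subr0.
Qed.

Lemma coef_posprodS (R : nzRingType) (t : R) ts n :
  (posprod R (t :: ts))`_n.+1 = (posprod R ts)`_n.+1 - t * (posprod R ts)`_n.
Proof.
by rewrite /posprod big_cons mulrBl mul1r coefB -scalerAl coefZ coefXM.
Qed.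

Lemma coef_euler_operator (R : fieldType) (p : {poly R}) (a : R) n :
  (a *: p + 'X * p^`())`_n = (a + n%:R) * p`_n.
Proof.
rewrite coefD coefZ coefXM coef_deriv.
case: n => [|n] /=; first by rewrite !addr0.
by rewrite mulrDl mulr_natl.
Qed.

End PositiveRoots.

(** The coefficients of [posprod] for real [t], without polynomial types: the
    limits below are taken coefficient by coefficient. *)
Fixpoint prod_coef (ts : list R) (n : nat) : R :=
  match ts, n with
  | nil, O => 1
  | nil, S _ => 0
  | t :: ts', O => prod_coef ts' 0
  | t :: ts', S k => prod_coef ts' (S k) - t * prod_coef ts' k
  end.

Definition positive_list (ts : list R) : Prop := List.Forall (fun t => 0 < t) ts.

Section RealLists.
Import mathcomp.boot.all_boot mathcomp.order.all_order mathcomp.algebra.all_algebra.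
Import mathcomp.reals_stdlib.Rstruct.
Import GRing.Theory Num.Theory Order.TTheory.

Lemma prod_coef_posprod (ts : list R) n :
  prod_coef ts n = nth (GRing.zero) (PositiveRoots.posprod (R : fieldType) ts) n.
Proof.
elim: ts n => [|t ts IH] [|n] /=.
- by rewrite /PositiveRoots.posprod big_nil coef1.
- by rewrite /PositiveRoots.posprod big_nil coef1.
- by rewrite PositiveRoots.coef_posprod0 IH.
- by rewrite PositiveRoots.coef_posprodS !IH.
Qed.

Lemma positive_list_all (ts : list R) :
  positive_list ts <-> all (fun t : R => Order.lt (GRing.zero) t) ts.
Proof.
split.
  by elim=> [|t l h _ k] //=; apply/andP; split => //; exact/RltP.
elim: ts => [|t ts IH] /=; first by constructor.
by move=> /andP [/RltP h /IH k]; constructor.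
Qed.

Lemma prod_coef_euler_operator_aux (ts : list R) (a : R) :
  Rlt 0 a -> positive_list ts ->
  exists2 ts', positive_list ts' &
   forall n, Rmult a (prod_coef ts' n) = Rmult (Rplus a (INR n)) (prod_coef ts n).
Proof.
move=> a0 /positive_list_all h.
have a0' : Order.lt (GRing.zero) (a : R) by apply/RltP.
have [ts' /positive_list_all h' e] := PositiveRoots.posprod_euler_operator _ _ _ a0' h.
exists ts' => // n.
have := congr1 (fun p : {poly R} => nth (GRing.zero) p n) e.
by rewrite PositiveRoots.coef_euler_operator coefZ -!prod_coef_posprod -INRE => /esym.
Qed.
End RealLists.

Lemma prod_coef_euler_operator (ts : list R) (a : R) :
  0 < a -> positive_list ts ->
  exists ts', positive_list ts' /\
   forall n, prod_coef ts' n = (1 + INR n / a) * prod_coef ts n.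
Proof.
  intros a0 h.
  destruct (prod_coef_euler_operator_aux ts a a0 h) as [ts' h' e].
  exists ts'; split; [exact h'|]. intro n.
  apply (Rmult_eq_reg_l a); [|lra].
  rewrite e. field. lra.
Qed.

(** * Power sums of reciprocal roots *)

Fixpoint power_sum (ts : list R) (k : nat) : R :=
  match ts with nil => 0 | t :: ts' => t ^ S k + power_sum ts' k end.

Lemma prod_coef_0 ts : prod_coef ts 0 = 1.
Proof. induction ts as [|t ts IH]; [reflexivity|exact IH]. Qed.

Lemma PS_mult_prod_coef_cons (t : R) ts b k :
  PS_mult (prod_coef (t :: ts)) b (S k) =
  PS_mult (prod_coef ts) b (S k) - t * PS_mult (prod_coef ts) b k.
Proof.
  unfold PS_mult.
  rewrite 2!(decomp_sum _ (S k)) by lia. simpl pred.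
  rewrite (sum_eq (fun i => prod_coef (t :: ts) (S i) * b (S k - S i)%nat)
     (fun i => prod_coef ts (S i) * b (S k - S i)%nat - (prod_coef ts i * b (k - i)%nat) * t)).
  2:{ intros i hi. simpl. ring. }
  rewrite minus_sum, <- scal_sum.
  replace (prod_coef (t :: ts) 0) with (prod_coef ts 0) by (destruct ts; reflexivity).
  ring.
Qed.

Lemma PS_mult_prod_coef_geom (t : R) ts k :
  PS_mult (prod_coef (t :: ts)) (fun k => t ^ S k) k = t * prod_coef ts k.
Proof.
  destruct k as [|k].
  - unfold PS_mult; simpl. destruct ts; ring.
  - rewrite PS_mult_prod_coef_cons.
    unfold PS_mult at 1. rewrite tech5. rewrite Nat.sub_diag.
    rewrite (sum_eq _ (fun i => (prod_coef ts i * t ^ S (k - i)) * t)).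
    2:{ intros i hi. replace (S k - i)%nat with (S (k - i)) by lia. simpl. ring. }
    rewrite <- scal_sum. unfold PS_mult. simpl. ring.
Qed.

(** Newton's identities: the power sums are the coefficients of [- p' / p]. *)
Lemma newton_identity ts k :
  PS_mult (prod_coef ts) (power_sum ts) k = - INR (S k) * prod_coef ts (S k).
Proof.
  revert k; induction ts as [|t ts IH]; intro k.
  - unfold PS_mult. simpl power_sum. simpl prod_coef.
    rewrite (sum_eq _ (fun _ => 0)) by (intros; ring).
    rewrite sum_cte. ring.
  - transitivity (PS_mult (prod_coef (t :: ts)) (fun k => t ^ S k) k
       + PS_mult (prod_coef (t :: ts)) (power_sum ts) k).
    { unfold PS_mult. rewrite <- plus_sum. apply sum_eq. intros i _. change (power_sum (t :: ts) (k - i)) with (t ^ S (k - i) + power_sum ts (k - i)). ring. }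
    rewrite PS_mult_prod_coef_geom.
    destruct k as [|k].
    + unfold PS_mult. simpl sum_f_R0. specialize (IH 0%nat). unfold PS_mult in IH. simpl sum_f_R0 in IH.
      change (prod_coef (t :: ts) 1) with (prod_coef ts 1 - t * prod_coef ts 0).
      replace (prod_coef (t :: ts) 0) with (prod_coef ts 0) by (destruct ts; reflexivity).
      simpl in IH |- *. lra.
    + rewrite PS_mult_prod_coef_cons, 2!IH.
      change (prod_coef (t :: ts) (S (S k))) with (prod_coef ts (S (S k)) - t * prod_coef ts (S k)).
      rewrite !S_INR. ring.
Qed.

Lemma power_sum_pos ts k : positive_list ts -> 0 <= power_sum ts k.
Proof.
  induction 1 as [|t ts ht _ IH]; simpl; [lra|].
  assert (0 <= t ^ S k) by (apply pow_le; lra). simpl in *; lra.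
Qed.

(** When all roots exceed [rho], [(t rho) ^ k <= 1]; this geometric bound does
    not depend on the number of roots. *)
Lemma power_sum_bound ts rho k : positive_list ts -> 0 <= rho ->
  List.Forall (fun t => t * rho < 1) ts -> power_sum ts k * rho ^ k <= power_sum ts 0.
Proof.
  intros h hr. induction h as [|t ts ht _ IH]; intro hb; simpl; [lra|].
  inversion hb as [|? ? h1 h2]; subst. specialize (IH h2).
  assert (h3 : (t * rho) ^ k <= 1).
  { rewrite <- (pow1 k). apply pow_incr. split; [apply Rmult_le_pos; lra|lra]. }
  rewrite Rpow_mult_distr in h3. nra.
Qed.

Lemma prod_coef_repeat (s : R) m n :
  INR (S n) * prod_coef (repeat s m) (S n) = - s * (INR m - INR n) * prod_coef (repeat s m) n.
Proof.
  revert n; induction m as [|m IH]; intro n.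
  - destruct n; simpl; ring.
  - simpl repeat. change (prod_coef (s :: repeat s m) (S n)) with
      (prod_coef (repeat s m) (S n) - s * prod_coef (repeat s m) n).
    rewrite Rmult_minus_distr_l, IH.
    destruct n as [|n].
    + replace (prod_coef (s :: repeat s m) 0) with (prod_coef (repeat s m) 0) by (destruct m; reflexivity).
      rewrite !S_INR; simpl; ring.
    + change (prod_coef (s :: repeat s m) (S n)) with
      (prod_coef (repeat s m) (S n) - s * prod_coef (repeat s m) n).
      specialize (IH n).
      rewrite !S_INR in *.
      replace (- s * (INR m + 1 - (INR n + 1)) * (prod_coef (repeat s m) (S n) - s * prod_coef (repeat s m) n))
       with (- s * (INR m - INR n) * prod_coef (repeat s m) (S n) + (- s) * (- s * (INR m - INR n) * prod_coef (repeat s m) n)) by ring.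
      rewrite <- IH. ring.
Qed.

(** The operators for [a, ..., a + K - 1] multiply the coefficient of index [n]
    by [g n = (a + n)_K / (a)_K]; only the ratio of consecutive [g n] is recorded,
    in which the product telescopes. *)
Lemma prod_coef_rising_factorial (ts : list R) (a : R) (K : nat) :
  0 < a -> positive_list ts ->
  exists ts' g, positive_list ts' /\ g 0%nat = 1 /\
    (forall n, g (S n) * (a + INR n) = g n * (a + INR n + INR K)) /\
    forall n, prod_coef ts' n = g n * prod_coef ts n.
Proof.
  intros ha hts. induction K as [|K (ts' & g & h1 & h2 & h3 & h4)].
  - exists ts, (fun _ => 1). repeat split; auto; intros; simpl; ring.
  - assert (ha' : 0 < a + INR K) by (pose proof (pos_INR K); lra).
    destruct (prod_coef_euler_operator ts' _ ha' h1) as (ts'' & h5 & h6).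
    exists ts'', (fun n => (1 + INR n / (a + INR K)) * g n). repeat split; auto.
    + rewrite h2. simpl. field. lra.
    + intro n. rewrite Rmult_assoc, h3, !S_INR. field. lra.
    + intro n. rewrite h6, h4. ring.
Qed.

(** * A hypergeometric series as a limit of real-rooted polynomials *)

Lemma INR_S_pos n : 0 < INR (S n).
Proof. apply lt_0_INR. lia. Qed.

Lemma Rpower_pos x y : 0 < Rpower x y.
Proof. apply exp_pos. Qed.

Lemma is_lim_seq_scal_0 k (u : nat -> R) : is_lim_seq u 0 -> is_lim_seq (fun n => k * u n) 0.
Proof.
  intro h. replace (Finite 0) with (Rbar_mult k 0) by (simpl; f_equal; ring).
  now apply is_lim_seq_scal_l.
Qed.

Lemma is_lim_seq_inv_S : is_lim_seq (fun n => / INR (S n)) 0.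
Proof.
  apply (is_lim_seq_incr_1 (fun n => / INR n)).
  apply (is_lim_seq_inv _ p_infty); [apply is_lim_seq_INR|discriminate].
Qed.

Lemma Series_nonneg (u : nat -> R) : (forall n, 0 <= u n) -> ex_series u -> 0 <= Series u.
Proof.
  intros h hu.
  replace 0 with (Series (fun n => 0 * u n)) by (rewrite Series_scal_l; ring).
  apply Series_le; [|exact hu]. intro n. specialize (h n). lra.
Qed.

Lemma ex_series_dominated (u M : nat -> R) :
  (forall n, Rabs (u n) <= M n) -> ex_series M -> ex_series u.
Proof. exact (ex_series_le (K := R_AbsRing) (V := R_CompleteNormedModule) u M). Qed.

Lemma ex_series_Rabs_dominated (u M : nat -> R) :
  (forall n, Rabs (u n) <= M n) -> ex_series M -> ex_series (fun n => Rabs (u n)).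
Proof. intro h. apply ex_series_dominated. intro n. now rewrite Rabs_Rabsolu. Qed.

Lemma Series_dominated (u M : nat -> R) :
  (forall n, Rabs (u n) <= M n) -> ex_series M -> Rabs (Series u) <= Series M.
Proof.
  intros h hM. eapply Rle_trans; [apply Series_Rabs, (ex_series_Rabs_dominated u M h hM)|].
  apply Series_le; [|exact hM]. intro n. split; [apply Rabs_pos|apply h].
Qed.

(** Tannery's theorem, in the form of convergence in [l^1]. *)
Lemma tannery (u : nat -> nat -> R) (v M : nat -> R) :
  (forall m n, Rabs (u m n) <= M n) -> (forall n, Rabs (v n) <= M n) ->
  (forall n, is_lim_seq (fun m => u m n) (v n)) -> ex_series M ->
  is_lim_seq (fun m => Series (fun n => Rabs (u m n - v n))) 0.
Proof.
  intros hu hv hl hM.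
  assert (hb : forall m n, 0 <= Rabs (u m n - v n) <= 2 * M n).
  { intros m n. split; [apply Rabs_pos|].
    specialize (hu m n). specialize (hv n).
    replace (u m n - v n) with (u m n + - v n) by ring.
    eapply Rle_trans; [apply Rabs_triang|]. rewrite Rabs_Ropp. lra. }
  assert (hM2 : ex_series (fun n => 2 * M n)) by (apply (ex_series_scal_l 2 M); exact hM).
  assert (hex : forall m, ex_series (fun n => Rabs (u m n - v n))).
  { intro m. apply (ex_series_Rabs_dominated _ (fun n => 2 * M n)); [intro; apply hb|exact hM2]. }
  apply is_lim_seq_spec. intro eps.
  assert (htail : is_lim_seq (fun N => Series (fun n => 2 * M n) - sum_n (fun n => 2 * M n) N) 0).
  { replace (Finite 0) with (Rbar_plus (Series (fun n => 2 * M n)) (Rbar_opp (Series (fun n => 2 * M n))))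
      by (simpl; f_equal; ring).
    apply is_lim_seq_minus'; [apply is_lim_seq_const|].
    apply (Series_correct _ hM2). }
  apply is_lim_seq_spec in htail.
  destruct (htail (pos_div_2 eps)) as [N hN]. specialize (hN N (Nat.le_refl _)).
  assert (hfin : is_lim_seq (fun m => sum_n (fun n => Rabs (u m n - v n)) N) 0).
  { clear hN. induction N as [|N IH].
    - apply is_lim_seq_ext with (fun m => Rabs (u m 0%nat - v 0%nat)).
      { intro m. now rewrite sum_O. }
      replace (Finite 0) with (Rbar_abs (Finite (v 0%nat - v 0%nat))) by (simpl; f_equal; rewrite Rminus_diag, Rabs_R0; reflexivity).
      apply is_lim_seq_abs. apply is_lim_seq_minus'; [apply hl|apply is_lim_seq_const].
    - apply is_lim_seq_ext with (fun m => sum_n (fun n => Rabs (u m n - v n)) N + Rabs (u m (S N) - v (S N))).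
      { intro m. now rewrite sum_Sn. }
      replace 0 with (0 + Rabs (v (S N) - v (S N))) by (rewrite Rminus_diag, Rabs_R0; ring).
      apply is_lim_seq_plus'; [exact IH|].
      apply (is_lim_seq_abs _ (Finite (v (S N) - v (S N)))). apply is_lim_seq_minus'; [apply hl|apply is_lim_seq_const]. }
  apply is_lim_seq_spec in hfin. destruct (hfin (pos_div_2 eps)) as [m0 hm0].
  exists m0. intros m hm. specialize (hm0 m hm).
  rewrite Rminus_0_r in *. simpl in hN, hm0.
  rewrite Rabs_pos_eq by (apply Series_nonneg; [intro; apply hb|apply hex]).
  rewrite (Series_incr_n _ (S N)) by (try lia; apply hex).
  simpl pred. 
  assert (Series (fun k => Rabs (u m (S N + k)%nat - v (S N + k)%nat)) <=
          Series (fun k => 2 * M (S N + k)%nat)).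
  { apply Series_le; [intro; apply hb|]. apply (ex_series_incr_n (fun n => 2 * M n)); exact hM2. }
  rewrite (Series_incr_n (fun n => 2 * M n) (S N)) in hN by (try lia; exact hM2).
  rewrite <- !sum_n_Reals in *. simpl pred in hN.
  apply Rabs_lt_between in hN. apply Rabs_lt_between in hm0. lra.
Qed.

Section Hypergeometric.
Variables a b c : R.
Hypotheses (ha : 0 < a) (hb : 0 < b) (hc : 0 < c).

Definition hyp_ratio (n : nat) : R :=
  / (64 * INR (S n) * (a + INR n) * (b + INR n) * (c + INR n)).

Fixpoint hyp_coef (n : nat) : R :=
  match n with O => 1 | S k => - hyp_coef k * hyp_ratio k end.

Definition approx_factor (m n : nat) : R :=
  (INR m - INR n) / INR m * ((a + INR n + INR m) / INR m)
  * ((b + INR n + INR m) / INR m) * ((c + INR n + INR m) / INR m).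

Lemma hyp_ratio_pos n : 0 < hyp_ratio n.
Proof.
  pose proof (pos_INR n). apply Rinv_0_lt_compat.
  rewrite S_INR. repeat apply Rmult_lt_0_compat; lra.
Qed.

Lemma hyp_coef_neq0 n : hyp_coef n <> 0.
Proof.
  induction n as [|n IH]; simpl; [lra|].
  pose proof (hyp_ratio_pos n). apply Rmult_integral_contrapositive. split; lra.
Qed.

(** Start from [(1 - s X) ^ m] with [s = 1 / (64 m ^ 4)] and apply the operators for
    each of the three parameters; consecutive coefficients then have the
    hypergeometric ratio up to the factor [approx_factor m n], which tends to 1. *)
Lemma hyp_coef_approx m : (1 <= m)%nat -> exists ts, positive_list ts /\
  forall n, prod_coef ts (S n) = - prod_coef ts n * (approx_factor m n * hyp_ratio n).
Proof.
  intro hm.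
  assert (hm' : 0 < INR m) by (apply lt_0_INR; lia).
  set (s := / (64 * INR m ^ 4)).
  assert (hs : 0 < s) by (apply Rinv_0_lt_compat; pose proof (pow_lt _ 4 hm'); lra).
  assert (h0 : positive_list (repeat s m)).
  { clearbody s. clear hm hm'. induction m; simpl; constructor; auto. }
  destruct (prod_coef_rising_factorial _ a m ha h0) as (t1 & g1 & p1 & z1 & r1 & e1).
  destruct (prod_coef_rising_factorial _ b m hb p1) as (t2 & g2 & p2 & z2 & r2 & e2).
  destruct (prod_coef_rising_factorial _ c m hc p2) as (t3 & g3 & p3 & z3 & r3 & e3).
  exists t3. split; [exact p3|].
  - intro n. rewrite !e3, !e2, !e1.
    pose proof (pos_INR n).
    pose proof (prod_coef_repeat s m n) as h.
    assert (hS := INR_S_pos n).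
    assert (E0 : prod_coef (repeat s m) (S n) = - s * (INR m - INR n) * prod_coef (repeat s m) n / INR (S n)).
    { rewrite <- h. field. lra. }
    assert (E1 : g1 (S n) = g1 n * (a + INR n + INR m) / (a + INR n)) by (rewrite <- r1; field; lra).
    assert (E2 : g2 (S n) = g2 n * (b + INR n + INR m) / (b + INR n)) by (rewrite <- r2; field; lra).
    assert (E3 : g3 (S n) = g3 n * (c + INR n + INR m) / (c + INR n)) by (rewrite <- r3; field; lra).
    rewrite E0, E1, E2, E3. unfold s, approx_factor, hyp_ratio. field. repeat split; lra.
Qed.

Lemma approx_factor_lim n : is_lim_seq (fun m => approx_factor m n) 1.
Proof.
  assert (hi : is_lim_seq (fun m => / INR m) 0).
  { apply (is_lim_seq_inv _ p_infty); [apply is_lim_seq_INR|discriminate]. }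
  assert (hx : forall x, is_lim_seq (fun m => (x + INR m) / INR m) 1).
  { intro x. apply is_lim_seq_ext_loc with (fun m => x * / INR m + 1).
    - exists 1%nat. intros m hm. assert (0 < INR m) by (apply lt_0_INR; lia). field. lra.
    - replace (Finite 1) with (Finite (x * 0 + 1)) by (f_equal; ring).
      apply is_lim_seq_plus'; [|apply is_lim_seq_const].
      apply (is_lim_seq_scal_l _ x (Finite 0)); exact hi. }
  unfold approx_factor.
  replace (Finite 1) with (Finite (1 * 1 * 1 * 1)) by (f_equal; ring).
  repeat apply is_lim_seq_mult'; try apply hx.
  apply is_lim_seq_ext with (fun m => (- INR n + INR m) / INR m); [|apply hx].
  intro m. f_equal. ring.
Qed.

Definition approx_bound : R := (a + 2) * (b + 2) * (c + 2).

(** Majorant, common to all [m], of the coefficients in [hyp_coef_approx]. *)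
Fixpoint majorant (n : nat) : R :=
  match n with O => 1 | S k => majorant k * (approx_bound * hyp_ratio k) end.

Lemma approx_bound_ge1 : 1 <= approx_bound.
Proof. unfold approx_bound. assert (4 <= (a+2)*(b+2)) by nra. nra. Qed.

Lemma majorant_pos n : 0 < majorant n.
Proof.
  induction n as [|n IH]; simpl; [lra|].
  pose proof (hyp_ratio_pos n). pose proof approx_bound_ge1. repeat apply Rmult_lt_0_compat; lra.
Qed.

Lemma hyp_coef_major n : Rabs (hyp_coef n) <= majorant n.
Proof.
  induction n as [|n IH]; simpl; [rewrite Rabs_R1; lra|].
  rewrite Rabs_mult, Rabs_Ropp. pose proof (hyp_ratio_pos n). pose proof approx_bound_ge1.
  rewrite (Rabs_pos_eq (hyp_ratio n)) by lra.
  apply Rmult_le_compat; try lra; [apply Rabs_pos|]. nra.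
Qed.

Lemma approx_factor_bound m n : (1 <= m)%nat -> (n <= m)%nat -> 0 <= approx_factor m n <= approx_bound.
Proof.
  intros h1 h2. apply le_INR in h2. apply le_INR in h1. simpl in h1.
  pose proof (pos_INR n).
  assert (hf : forall x, 0 < x -> 0 <= (x + INR n + INR m) / INR m <= x + 2).
  { intros x hx. split.
    - apply Rcomplements.Rdiv_le_0_compat; lra.
    - apply Rcomplements.Rle_div_l; nra. }
  assert (h0 : 0 <= (INR m - INR n) / INR m <= 1).
  { split; [apply Rcomplements.Rdiv_le_0_compat; lra | apply Rcomplements.Rle_div_l; lra]. }
  unfold approx_factor, approx_bound.
  destruct (hf a ha), (hf b hb), (hf c hc), h0.
  set (u := (INR m - INR n) / INR m) in *. set (x := (a + INR n + INR m) / INR m) in *.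
  set (y := (b + INR n + INR m) / INR m) in *. set (z := (c + INR n + INR m) / INR m) in *.
  assert (0 <= u * x <= 1 * (a + 2)).
  { split; [apply Rmult_le_pos|apply Rmult_le_compat]; assumption. }
  assert (0 <= u * x * y <= 1 * (a + 2) * (b + 2)).
  { split; [apply Rmult_le_pos|apply Rmult_le_compat]; tauto. }
  rewrite Rmult_1_l in *.
  split; [apply Rmult_le_pos|apply Rmult_le_compat]; tauto.
Qed.

(** Bounding [approx_factor m n] by [approx_bound] needs [n <= m]; beyond that the coefficients
    vanish, because [approx_factor m m = 0]. *)
Lemma approx_majorant m ts : (1 <= m)%nat ->
  (forall n, prod_coef ts (S n) = - prod_coef ts n * (approx_factor m n * hyp_ratio n)) ->
  forall n, Rabs (prod_coef ts n) <= majorant n.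
Proof.
  intros hm hr.
  assert (hz : forall n, (m < n)%nat -> prod_coef ts n = 0).
  { induction 1 as [|n h IH].
    - rewrite hr. unfold approx_factor. rewrite Rminus_diag. unfold Rdiv. ring.
    - rewrite hr, IH. ring. }
  intro n. induction n as [|n IH].
  - rewrite prod_coef_0, Rabs_R1. simpl; lra.
  - destruct (Nat.le_gt_cases n m) as [h|h].
    + rewrite hr, Rabs_mult, Rabs_Ropp. simpl.
      pose proof (hyp_ratio_pos n). destruct (approx_factor_bound m n hm h).
      rewrite (Rabs_pos_eq (approx_factor m n * hyp_ratio n)) by (apply Rmult_le_pos; lra).
      apply Rmult_le_compat; try lra; [apply Rabs_pos|apply Rmult_le_pos; lra|].
      apply Rmult_le_compat_r; lra.
    + rewrite hz by lia. rewrite Rabs_R0. left; apply majorant_pos.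
Qed.

Lemma hyp_ratio_lim0 : is_lim_seq hyp_ratio 0.
Proof.
  apply is_lim_seq_le_le with (fun _ => 0) (fun n => / (64 * a * b * c) * / INR (S n)).
  - intro n. split; [left; apply hyp_ratio_pos|].
    unfold hyp_ratio. rewrite <- Rinv_mult. pose proof (pos_INR n).
    pose proof (INR_S_pos n).
    apply Rinv_le_contravar; [repeat apply Rmult_lt_0_compat; lra|].
    replace (64 * a * b * c * INR (S n)) with (64 * INR (S n) * a * b * c) by ring.
    apply Rmult_le_compat; try lra; [left; repeat apply Rmult_lt_0_compat; lra|].
    apply Rmult_le_compat; try lra; [left; repeat apply Rmult_lt_0_compat; lra|].
    apply Rmult_le_compat; lra.
  - apply is_lim_seq_const.
  - apply is_lim_seq_scal_0, is_lim_seq_inv_S.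
Qed.

Lemma majorant_radius : CV_radius majorant = p_infty.
Proof.
  apply CV_radius_infinite_DAlembert.
  - intro n. apply Rgt_not_eq, majorant_pos.
  - apply is_lim_seq_ext with (fun n => approx_bound * hyp_ratio n).
    + intro n. simpl. pose proof (majorant_pos n). pose proof (hyp_ratio_pos n). pose proof approx_bound_ge1.
      replace (majorant n * (approx_bound * hyp_ratio n) / majorant n) with (approx_bound * hyp_ratio n) by (field; lra).
      rewrite Rabs_pos_eq; [reflexivity|apply Rmult_le_pos; lra].
    + apply is_lim_seq_scal_0, hyp_ratio_lim0.
Qed.

Lemma hyp_coef_radius : CV_radius hyp_coef = p_infty.
Proof.
  apply CV_radius_infinite_DAlembert; [apply hyp_coef_neq0|].
  apply is_lim_seq_ext with hyp_ratio; [|apply hyp_ratio_lim0].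
  intro n. simpl. pose proof (hyp_coef_neq0 n). pose proof (hyp_ratio_pos n).
  replace (- hyp_coef n * hyp_ratio n / hyp_coef n) with (- hyp_ratio n) by (field; lra).
  rewrite Rabs_Ropp, Rabs_pos_eq; lra.
Qed.

End Hypergeometric.

Lemma is_pseries_prod_coef ts x :
  is_pseries (prod_coef ts) x (fold_right (fun t p => (1 - t * x) * p) 1 ts).
Proof.
  induction ts as [|t ts IH]; simpl fold_right.
  - apply is_pseries_R. change (is_lim_seq (sum_n (fun n => prod_coef nil n * x ^ n)) 1).
    apply is_lim_seq_ext with (fun _ => 1); [|apply is_lim_seq_const].
    intro n. induction n as [|n IHn]; [rewrite sum_O; simpl; ring|].
    rewrite sum_Sn, <- IHn. unfold plus; simpl. ring.
  - set (p := fold_right _ _ _) in *.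
    replace ((1 - t * x) * p) with (plus p (opp (scal t (scal x p))))
      by (unfold plus, opp, scal; simpl; unfold mult; simpl; ring).
    apply (is_pseries_ext (PS_minus (prod_coef ts) (PS_scal t (PS_incr_1 (prod_coef ts))))).
    + intros [|n]; unfold PS_minus, PS_plus, PS_opp, PS_scal, PS_incr_1; simpl;
      unfold plus, opp, scal, zero; simpl; unfold mult; simpl.
      * destruct ts; simpl; ring.
      * ring.
    + refine (@is_pseries_minus R_AbsRing R_NormedModule (prod_coef ts) (PS_scal t (PS_incr_1 (prod_coef ts))) x p (scal t (scal x p)) IH _).
      refine (@is_pseries_scal R_AbsRing R_NormedModule t _ x _ (Rmult_comm x t) _).
      exact (@is_pseries_incr_1 R_AbsRing R_NormedModule _ x p IH).
Qed.

Lemma PSeries_prod_coef_root ts t : t <> 0 -> List.In t ts -> PSeries (prod_coef ts) (/ t) = 0.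
Proof.
  intros ht hin. rewrite (is_pseries_unique _ _ _ (is_pseries_prod_coef ts (/ t))).
  induction ts as [|s ts IH]; simpl; [destruct hin|].
  destruct hin as [->|h]; [field; exact ht|]. rewrite IH; [ring|exact h].
Qed.

Lemma is_lim_seq_sum_f_R0 (u : nat -> nat -> R) (v : nat -> R) n :
  (forall i, (i <= n)%nat -> is_lim_seq (fun m => u m i) (v i)) ->
  is_lim_seq (fun m => sum_f_R0 (u m) n) (sum_f_R0 v n).
Proof.
  induction n as [|n IH]; intro h; simpl.
  - apply h; lia.
  - apply is_lim_seq_plus'; [apply IH; intros; apply h; lia|apply h; lia].
Qed.

Definition positive_upto (c : nat -> R) (rho : R) : Prop :=
  forall x, 0 <= x <= rho -> 0 < PSeries c x.

(** [q] are the coefficients of [- c' / c] as formal series, and they are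
    approximated by power sums of reciprocals of positive numbers.  On an interval
    [[0, rho]] where [c] is positive these numbers can be taken beyond [rho]. *)
Definition limit_of_roots (c q : nat -> R) : Prop :=
  (forall k, PS_mult c q k = - INR (S k) * c (S k)) /\
  forall rho, 0 <= rho -> positive_upto c rho -> forall N eps, 0 < eps ->
  exists ts, positive_list ts /\ List.Forall (fun t => t * rho < 1) ts /\
    forall k, (k <= N)%nat -> Rabs (power_sum ts k - q k) < eps.

(** Newton's identities express the power sums through the coefficients, so they
    converge with them.  The roots of the approximants leave [[0, rho]] because
    the approximants converge uniformly there to a function with a positive
    minimum. *)
Lemma rayleigh_sums (a b c : R) : 0 < a -> 0 < b -> 0 < c ->
  exists q, limit_of_roots (hyp_coef a b c) q.
Proof.
  intros ha hb hc.
  set (w := hyp_coef a b c).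
  set (good := fun m ts => positive_list ts /\
    forall n, prod_coef ts (S n) = - prod_coef ts n * (approx_factor a b c (S m) n * hyp_ratio a b c n)).
  set (ts := fun m => epsilon (inhabits nil) (good m)).
  assert (hts : forall m, good m (ts m)).
  { intro m. apply epsilon_spec. apply hyp_coef_approx; auto. lia. }
  assert (hL : forall n, is_lim_seq (fun m => prod_coef (ts m) n) (w n)).
  { induction n as [|n IH].
    - apply is_lim_seq_ext with (fun _ => 1); [intro; now rewrite prod_coef_0|apply is_lim_seq_const].
    - apply is_lim_seq_ext with (fun m => - prod_coef (ts m) n * (approx_factor a b c (S m) n * hyp_ratio a b c n)).
      { intro m. symmetry. apply hts. }
      replace (Finite (w (S n))) with (Finite (- w n * (1 * hyp_ratio a b c n)))
        by (f_equal; unfold w; simpl; ring).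
      apply is_lim_seq_mult'.
      + apply (is_lim_seq_opp _ (Finite (w n))). exact IH.
      + apply is_lim_seq_mult'; [|apply is_lim_seq_const].
        apply (is_lim_seq_incr_1 (fun m => approx_factor a b c m n)). apply approx_factor_lim; auto. }
  set (q := fun k => real (Lim_seq (fun m => power_sum (ts m) k))).
  assert (hrec : forall k m, power_sum (ts m) (S k) = - INR (S (S k)) * prod_coef (ts m) (S (S k))
    - sum_f_R0 (fun j => prod_coef (ts m) (S j) * power_sum (ts m) (k - j)) k).
  { intros k m. rewrite <- newton_identity. unfold PS_mult.
    rewrite (decomp_sum _ (S k)) by lia. rewrite prod_coef_0. simpl pred.
    replace (S k - 0)%nat with (S k) by lia.
    rewrite (sum_eq (fun i => prod_coef (ts m) (S i) * power_sum (ts m) (S k - S i))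
      (fun j => prod_coef (ts m) (S j) * power_sum (ts m) (k - j))) by reflexivity.
    ring. }
  assert (hq : forall k, is_lim_seq (fun m => power_sum (ts m) k) (q k)).
  { intro k. induction k as [k IH] using (well_founded_induction lt_wf).
    assert (ex : ex_finite_lim_seq (fun m => power_sum (ts m) k)).
    { destruct k as [|k].
      - exists (- w 1%nat). apply is_lim_seq_ext with (fun m => - prod_coef (ts m) 1).
        + intro m. pose proof (newton_identity (ts m) 0) as h.
          unfold PS_mult in h. simpl in h. rewrite prod_coef_0 in h. lra.
        + apply (is_lim_seq_opp _ (Finite (w 1%nat))). apply hL.
      - eexists. apply is_lim_seq_ext with (1 := fun m => eq_sym (hrec k m)).
        apply is_lim_seq_minus'.
        + apply is_lim_seq_mult'; [apply is_lim_seq_const|apply hL].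
        + apply (is_lim_seq_sum_f_R0 (fun m j => prod_coef (ts m) (S j) * power_sum (ts m) (k - j))
            (fun j => w (S j) * q (k - j)%nat)).
          intros i hi. apply is_lim_seq_mult'; [apply hL|apply IH; lia]. }
    apply Lim_seq_correct'. exact ex. }
  exists q. split.
  - intro k.
    assert (h1 : is_lim_seq (fun m => PS_mult (prod_coef (ts m)) (power_sum (ts m)) k) (PS_mult w q k)).
    { unfold PS_mult. apply (is_lim_seq_sum_f_R0 (fun m j => prod_coef (ts m) j * power_sum (ts m) (k - j)) (fun j => w j * q (k - j)%nat)).
      intros i hi. apply is_lim_seq_mult'; [apply hL|apply hq]. }
    assert (h2 : is_lim_seq (fun m => PS_mult (prod_coef (ts m)) (power_sum (ts m)) k) (- INR (S k) * w (S k))).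
    { apply is_lim_seq_ext with (1 := fun m => eq_sym (newton_identity (ts m) k)).
      apply is_lim_seq_mult'; [apply is_lim_seq_const|apply hL]. }
    apply is_lim_seq_unique in h1. apply is_lim_seq_unique in h2. rewrite h1 in h2.
    now injection h2.
  - intros rho hrho hpos N eps heps.
    assert (hcv : forall x, Rbar_lt (Rabs x) (CV_radius w)).
    { intro x. unfold w. rewrite hyp_coef_radius by assumption. exact I. }
    destruct (continuity_ab_min (PSeries w) 0 rho hrho) as [x0 [hx0 hx0']].
    { intros x _. apply PSeries_continuity. apply hcv. }
    specialize (hpos x0 hx0'). fold w in hpos. set (delta := PSeries w x0) in *.
    assert (hM : ex_series (fun n => majorant a b c n * rho ^ n)).
    { assert (ex_pseries (majorant a b c) rho) as hh.
      { apply CV_radius_inside. rewrite majorant_radius by assumption. exact I. }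
      destruct hh as [l hl]. exists l. apply is_pseries_R. exact hl. }
    assert (hLm : forall m n, Rabs (prod_coef (ts m) n) <= majorant a b c n).
    { intros m n. apply (approx_majorant a b c ha hb hc (S m)); [lia|]. apply hts. }
    assert (hrn : forall n, 0 <= rho ^ n) by (intro; now apply pow_le).
    assert (hT : is_lim_seq (fun m => Series (fun n => Rabs (prod_coef (ts m) n * rho ^ n - w n * rho ^ n))) 0).
    { apply (tannery (fun m n => prod_coef (ts m) n * rho ^ n) (fun n => w n * rho ^ n) (fun n => majorant a b c n * rho ^ n)).
      - intros m n. rewrite Rabs_mult, (Rabs_pos_eq (rho ^ n)) by apply hrn.
        apply Rmult_le_compat_r; [apply hrn|apply hLm].
      - intro n. rewrite Rabs_mult, (Rabs_pos_eq (rho ^ n)) by apply hrn.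
        apply Rmult_le_compat_r; [apply hrn|apply hyp_coef_major; assumption].
      - intro n. apply is_lim_seq_mult'; [apply hL|apply is_lim_seq_const].
      - exact hM. }
    apply is_lim_seq_spec in hT. destruct (hT (mkposreal _ hpos)) as [m1 hm1]. simpl in hm1.
    assert (hall : exists m2, forall m, (m2 <= m)%nat -> forall k, (k <= N)%nat -> Rabs (power_sum (ts m) k - q k) < eps).
    { clear - hq heps. induction N as [|N [m2 IH]].
      - pose proof (hq 0%nat) as h. apply is_lim_seq_spec in h. destruct (h (mkposreal _ heps)) as [m2 h2].
        exists m2. intros m hm k hk. replace k with 0%nat by lia. now apply h2.
      - pose proof (hq (S N)) as h. apply is_lim_seq_spec in h. destruct (h (mkposreal _ heps)) as [m3 h3].
        exists (max m2 m3). intros m hm k hk.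
        destruct (Nat.eq_dec k (S N)) as [->|hne]; [apply h3; lia|apply IH; lia]. }
    destruct hall as [m2 hm2].
    set (m := max m1 m2). exists (ts m).
    split; [apply hts|]. split; [|intros k hk; apply hm2; [lia|exact hk]].
    apply Forall_forall. intros t hin.
    assert (ht : 0 < t).
    { destruct (hts m) as [hp _]. unfold positive_list in hp. rewrite Forall_forall in hp. now apply hp. }
    destruct (Rlt_le_dec (t * rho) 1) as [|hge]; [assumption|exfalso].
    specialize (hm1 m ltac:(lia)).
    (* otherwise 1 / t is a root of the approximant in [0, rho], where W is at least delta *)
    assert (hroot := PSeries_prod_coef_root (ts m) t ltac:(lra) hin).
    assert (hx : 0 <= / t <= rho).
    { split; [left; now apply Rinv_0_lt_compat|].
      apply (Rmult_le_reg_l t); [exact ht|]. rewrite Rinv_r; lra. }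
    specialize (hx0 (/ t) hx). fold delta in hx0.
    assert (e1 : ex_series (fun n => w n * (/ t) ^ n)).
    { destruct (CV_radius_inside w (/ t) (hcv _)) as [l hl]. exists l. now apply is_pseries_R. }
    assert (e2 : ex_series (fun n => prod_coef (ts m) n * (/ t) ^ n)).
    { eexists. apply is_pseries_R. apply is_pseries_prod_coef. }
    assert (hd : Rabs (PSeries (prod_coef (ts m)) (/ t) - PSeries w (/ t)) <= Series (fun n => Rabs (prod_coef (ts m) n * rho ^ n - w n * rho ^ n))).
    { unfold PSeries. rewrite <- Series_minus by assumption. apply Series_dominated.
      - intro n. rewrite <- !Rmult_minus_distr_r, !Rabs_mult.
        apply Rmult_le_compat_l; [apply Rabs_pos|].
        rewrite !Rabs_pos_eq; [|apply hrn|apply pow_le; tauto].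
        now apply pow_incr.
      - apply (ex_series_Rabs_dominated _ (fun n => 2 * (majorant a b c n * rho ^ n))).
        + intro n. rewrite <- Rmult_minus_distr_r, Rabs_mult, (Rabs_pos_eq (rho ^ n)) by apply hrn.
          rewrite <- Rmult_assoc. apply Rmult_le_compat_r; [apply hrn|].
          pose proof (hLm m n) as b1. pose proof (hyp_coef_major a b c ha hb hc n) as b2. fold w in b2.
          eapply Rle_trans; [apply Rabs_triang|]. rewrite Rabs_Ropp. lra.
        + apply (ex_series_scal_l 2 (fun n => majorant a b c n * rho ^ n)). exact hM. }
    rewrite hroot, Rminus_0_l, Rabs_Ropp in hd.
    rewrite Rminus_0_r in hm1. apply Rabs_lt_between in hm1. 
    pose proof (Rle_abs (PSeries w (/ t))). lra.
Qed.

(** * Complex power series with real coefficients *)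

Definition is_Cseries (u : nat -> C) (l : C) : Prop :=
  is_series (fun n => Re (u n)) (Re l) /\ is_series (fun n => Im (u n)) (Im l).

Lemma is_Cseries_unique u l : is_Cseries u l -> CSeries u = l.
Proof.
  intros [h1 h2]. unfold CSeries.
  rewrite (is_series_unique _ _ h1), (is_series_unique _ _ h2). now destruct l.
Qed.

Lemma im_le_Cmod (z : C) : Rabs (Im z) <= Cmod z.
Proof. eapply Rle_trans; [apply Rmax_r|apply Rmax_Cmod]. Qed.

Lemma Cmod_le_re_im (z : C) : Cmod z <= Rabs (Re z) + Rabs (Im z).
Proof.
  unfold Cmod.
  rewrite <- (sqrt_pow2 (Rabs (Re z) + Rabs (Im z))) by (pose proof (Rabs_pos (Re z)); pose proof (Rabs_pos (Im z)); lra).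
  apply sqrt_le_1_alt. unfold Re, Im.
  rewrite <- (pow2_abs (fst z)), <- (pow2_abs (snd z)).
  pose proof (Rabs_pos (fst z)). pose proof (Rabs_pos (snd z)). nra.
Qed.

Lemma ex_Cseries_abs (u : nat -> C) (M : nat -> R) :
  (forall n, Cmod (u n) <= M n) -> ex_series M ->
  ex_series (fun n => Rabs (Re (u n))) /\ ex_series (fun n => Rabs (Im (u n))).
Proof.
  intros h hM. split; apply (ex_series_Rabs_dominated _ M); auto; intro n.
  - eapply Rle_trans; [apply re_le_Cmod|apply h].
  - eapply Rle_trans; [apply im_le_Cmod|apply h].
Qed.

Lemma CSeries_correct (u : nat -> C) (M : nat -> R) :
  (forall n, Cmod (u n) <= M n) -> ex_series M -> is_Cseries u (CSeries u).
Proof.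
  intros h hM. destruct (ex_Cseries_abs u M h hM) as [h1 h2].
  split; apply Series_correct; apply ex_series_Rabs; assumption.
Qed.

Lemma is_Cseries_Cmod (u : nat -> C) (l : C) (M : nat -> R) :
  is_Cseries u l -> (forall n, Cmod (u n) <= M n) -> ex_series M ->
  Cmod l <= 2 * Series M.
Proof.
  intros [l1 l2] h hM. eapply Rle_trans; [apply Cmod_le_re_im|].
  rewrite <- (is_series_unique _ _ l1), <- (is_series_unique _ _ l2).
  assert (Rabs (Series (fun n => Re (u n))) <= Series M).
  { apply Series_dominated; [|exact hM]. intro n. eapply Rle_trans; [apply re_le_Cmod|apply h]. }
  assert (Rabs (Series (fun n => Im (u n))) <= Series M).
  { apply Series_dominated; [|exact hM]. intro n. eapply Rle_trans; [apply im_le_Cmod|apply h]. }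
  lra.
Qed.

Lemma is_Cseries_ext u v l : (forall n, u n = v n) -> is_Cseries u l -> is_Cseries v l.
Proof.
  intros h [h1 h2]. split; eapply is_series_ext; eauto; intro n; simpl; now rewrite h.
Qed.

Lemma is_Cseries_plus u v l m : is_Cseries u l -> is_Cseries v m ->
  is_Cseries (fun n => u n + v n)%C (l + m)%C.
Proof.
  intros [h1 h2] [h3 h4]. split.
  - exact (is_series_plus _ _ _ _ h1 h3).
  - exact (is_series_plus _ _ _ _ h2 h4).
Qed.

Lemma is_Cseries_scal k u l : is_Cseries u l ->
  is_Cseries (fun n => k * u n)%C (k * l)%C.
Proof.
  intros [h1 h2]. split; simpl.
  - exact (is_series_minus _ _ _ _ (is_series_scal_l (Re k) _ _ h1) (is_series_scal_l (Im k) _ _ h2)).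
  - exact (is_series_plus _ _ _ _ (is_series_scal_l (Re k) _ _ h2) (is_series_scal_l (Im k) _ _ h1)).
Qed.

Lemma is_Cseries_shift (u : nat -> C) (l : C) : u 0%nat = 0%C ->
  is_Cseries (fun n => u (S n)) l <-> is_Cseries u l.
Proof.
  intro h0. unfold is_Cseries.
  assert (h : forall (v : nat -> R) (x : R), v 0%nat = 0 -> is_series (fun n => v (S n)) x <-> is_series v x).
  { intros v x hv. split; intro h.
    - apply is_series_decr_1. rewrite hv. unfold plus, opp; simpl.
      now replace (x + - 0) with x by ring.
    - apply (is_series_incr_1 v). rewrite hv. unfold plus; simpl.
      now replace (x + 0) with x by ring. }
  rewrite (h (fun n => Re (u n))), (h (fun n => Im (u n))); [reflexivity| |]; now rewrite h0.
Qed.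

Definition abs_conv (a : nat -> R) (r : R) : Prop := ex_series (fun n => Rabs (a n) * r ^ n).

Definition CPS (a : nat -> R) (w : C) : C := CSeries (fun n => (RtoC (a n) * w ^ n)%C).

Lemma Cmod_term a w r n : Cmod w <= r -> Cmod (RtoC (a n) * w ^ n)%C <= Rabs (a n) * r ^ n.
Proof.
  intro h. rewrite Cmod_mult, Cmod_R, Cmod_pow.
  apply Rmult_le_compat_l; [apply Rabs_pos|]. apply pow_incr. split; [apply Cmod_ge_0|exact h].
Qed.

Lemma CPS_correct a w r : abs_conv a r -> Cmod w <= r ->
  is_Cseries (fun n => RtoC (a n) * w ^ n)%C (CPS a w).
Proof.
  intros h hw. apply (CSeries_correct _ (fun n => Rabs (a n) * r ^ n)); [|exact h].
  intro n. now apply Cmod_term.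
Qed.

Lemma CPS_ext a b w : (forall n, a n = b n) -> CPS a w = CPS b w.
Proof.
  intro h. unfold CPS, CSeries. f_equal; apply Series_ext; intro n; now rewrite h.
Qed.

Lemma abs_conv_radius a r : 0 <= r -> Rbar_lt r (CV_radius a) -> abs_conv a r.
Proof.
  intros hr h.
  destruct (Lub_Rbar_correct (CV_disk a)) as [hu hl].
  assert (hx : exists x, CV_disk a x /\ r < x).
  { apply Classical_Prop.NNPP. intro hn. apply (Rbar_lt_not_le _ _ h).
    apply hl. intros x hx. apply Rbar_not_lt_le. intro hlt. apply hn. now exists x. }
  destruct hx as [x [hx hrx]].
  assert (hd : CV_disk a r) by (apply (CV_disk_le a r x); [rewrite !Rabs_pos_eq; lra|exact hx]).
  revert hd. apply ex_series_ext. intro n. 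
  now rewrite Rabs_mult, (Rabs_pos_eq (r ^ n)) by now apply pow_le.
Qed.

Lemma radius_abs_conv a r : 0 <= r -> abs_conv a r -> Rbar_le r (CV_radius a).
Proof.
  intros hr h. apply (proj1 (Lub_Rbar_correct (CV_disk a))). 
  revert h. apply ex_series_ext. intro n.
  now rewrite Rabs_mult, (Rabs_pos_eq (r ^ n)) by now apply pow_le.
Qed.

Lemma abs_conv_derive a r s : 0 <= s < r -> abs_conv a r -> abs_conv (PS_derive a) s.
Proof.
  intros hs h. apply abs_conv_radius; [lra|]. rewrite CV_radius_derive.
  apply Rbar_lt_le_trans with r; [simpl; lra|]. apply radius_abs_conv; [lra|exact h].
Qed.

Lemma CPS_RtoC a x : CPS a (RtoC x) = RtoC (PSeries a x).
Proof.
  assert (h : forall n, (RtoC (a n) * RtoC x ^ n)%C = RtoC (a n * x ^ n)).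
  { intro n. now rewrite <- RtoC_pow, <- RtoC_mult. }
  unfold CPS, CSeries, PSeries. apply injective_projections.
  - change (Series (fun n => Re (RtoC (a n) * RtoC x ^ n)%C) = Series (fun n => a n * x ^ n)).
    apply Series_ext. intro n. rewrite h. reflexivity.
  - change (Series (fun n => Im (RtoC (a n) * RtoC x ^ n)%C) = 0).
    replace 0 with (Series (fun n => 0 * (a n * x ^ n))) by (rewrite Series_scal_l; ring).
    apply Series_ext. intro n. rewrite h. simpl. ring.
Qed.

Lemma CPS_scal a k w r : abs_conv a r -> Cmod w <= r ->
  CPS (fun n => k * a n) w = (RtoC k * CPS a w)%C.
Proof.
  intros ha hw. apply is_Cseries_unique.
  eapply is_Cseries_ext; [|apply is_Cseries_scal; eapply CPS_correct; eassumption].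
  intro n. simpl. rewrite RtoC_mult. ring.
Qed.

Lemma Re_term a w n : Re (RtoC (a n) * w ^ n)%C = a n * Re (w ^ n)%C.
Proof. generalize (w ^ n)%C; intro z; unfold Re, Im; simpl; ring. Qed.
Lemma Im_term a w n : Im (RtoC (a n) * w ^ n)%C = a n * Im (w ^ n)%C.
Proof. generalize (w ^ n)%C; intro z; unfold Re, Im; simpl; ring. Qed.

(** The real and imaginary parts are combinations of four real Cauchy products. *)
Lemma CPS_mult_correct a b w r : abs_conv a r -> abs_conv b r -> Cmod w <= r ->
  is_Cseries (fun n => RtoC (PS_mult a b n) * w ^ n)%C (CPS a w * CPS b w)%C.
Proof.
  intros ha hb hw.
  pose proof (CPS_correct a w r ha hw) as [a1 a2].
  pose proof (CPS_correct b w r hb hw) as [b1 b2].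
  destruct (ex_Cseries_abs (fun n => RtoC (a n) * w ^ n)%C _ (fun n => Cmod_term a w r n hw) ha) as [a3 a4].
  destruct (ex_Cseries_abs (fun n => RtoC (b n) * w ^ n)%C _ (fun n => Cmod_term b w r n hw) hb) as [b3 b4].
  pose proof (is_series_mult _ _ _ _ a1 b1 a3 b3) as c1.
  pose proof (is_series_mult _ _ _ _ a2 b2 a4 b4) as c2.
  pose proof (is_series_mult _ _ _ _ a1 b2 a3 b4) as c3.
  pose proof (is_series_mult _ _ _ _ a2 b1 a4 b3) as c4.
  assert (hre : forall n k, (k <= n)%nat -> Re (w ^ n)%C = Re (w ^ k)%C * Re (w ^ (n - k))%C - Im (w ^ k)%C * Im (w ^ (n - k))%C).
  { intros n k hk. replace n with (k + (n - k))%nat at 1 by lia. rewrite Cpow_add_r. reflexivity. }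
  assert (him : forall n k, (k <= n)%nat -> Im (w ^ n)%C = Re (w ^ k)%C * Im (w ^ (n - k))%C + Im (w ^ k)%C * Re (w ^ (n - k))%C).
  { intros n k hk. replace n with (k + (n - k))%nat at 1 by lia. rewrite Cpow_add_r. reflexivity. }
  split.
  - eapply is_series_ext; [|exact (is_series_minus _ _ _ _ c1 c2)].
    intro n.
    change (sum_f_R0 (fun k => Re (RtoC (a k) * w ^ k)%C * Re (RtoC (b (n - k)%nat) * w ^ (n - k))%C) n
      - sum_f_R0 (fun k => Im (RtoC (a k) * w ^ k)%C * Im (RtoC (b (n - k)%nat) * w ^ (n - k))%C) n
      = Re (RtoC (PS_mult a b n) * w ^ n)%C).
    rewrite Re_term. unfold PS_mult.
    rewrite <- minus_sum, (Rmult_comm _ (Re _)), scal_sum. apply sum_eq. intros k hk.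
    rewrite (hre n k hk), !Re_term, !Im_term. ring.
  - eapply is_series_ext; [|exact (is_series_plus _ _ _ _ c3 c4)].
    intro n.
    change (sum_f_R0 (fun k => Re (RtoC (a k) * w ^ k)%C * Im (RtoC (b (n - k)%nat) * w ^ (n - k))%C) n
      + sum_f_R0 (fun k => Im (RtoC (a k) * w ^ k)%C * Re (RtoC (b (n - k)%nat) * w ^ (n - k))%C) n
      = Im (RtoC (PS_mult a b n) * w ^ n)%C).
    rewrite Im_term. unfold PS_mult.
    rewrite <- plus_sum, (Rmult_comm _ (Im _)), scal_sum. apply sum_eq. intros k hk.
    rewrite (him n k hk), !Re_term, !Im_term. ring.
Qed.

Lemma CPS_mult a b w r : abs_conv a r -> abs_conv b r -> Cmod w <= r ->
  CPS (PS_mult a b) w = (CPS a w * CPS b w)%C.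
Proof. intros. apply is_Cseries_unique. eapply CPS_mult_correct; eassumption. Qed.

Lemma CPS_incr_1 a w r : abs_conv a r -> Cmod w <= r ->
  CPS (PS_incr_1 a) w = (w * CPS a w)%C.
Proof.
  intros ha hw. apply is_Cseries_unique.
  apply (is_Cseries_shift (fun n => RtoC (PS_incr_1 a n) * w ^ n)%C).
  { simpl. unfold zero; simpl. ring. }
  eapply is_Cseries_ext; [|apply (is_Cseries_scal w _ _ (CPS_correct a w r ha hw))].
  intro n. change (PS_incr_1 a (S n)) with (a n). rewrite Cpow_S. ring.
Qed.

Notation Cis_derive f z l := (is_derive (K := C_AbsRing) (V := C_NormedModule) f z l).
Notation Cex_derive f z := (ex_derive (K := C_AbsRing) (V := C_NormedModule) f z).

Lemma Cis_derive_quadratic (f : C -> C) (z l : C) (M d : R) : 0 < d ->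
  (forall h, Cmod h < d -> Cmod (f (z + h) - f z - h * l)%C <= M * Cmod h ^ 2) ->
  Cis_derive f z l.
Proof.
  intros hd hM. split.
  - apply is_linear_scal_l.
  - intros x hx.
    apply (is_filter_lim_locally_unique (V := AbsRing_NormedModule C_AbsRing)) in hx. subst x.
    intros eps.
    set (d' := Rmin d (eps / (Rabs M + 1))).
    assert (hM1 : 0 < Rabs M + 1) by (pose proof (Rabs_pos M); lra).
    assert (hd' : 0 < d').
    { apply Rmin_pos; [exact hd|]. apply Rdiv_lt_0_compat; [apply cond_pos|exact hM1]. }
    exists (mkposreal _ hd'). intros y hy. change C in (type of y).
    change (Cmod (y - z)%C < d') in hy.
    change (Cmod ((f y - f z) - (y - z) * l)%C <= eps * Cmod (y - z)%C).
    specialize (hM (y - z)%C). replace (z + (y - z))%C with y in hM by ring.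
    assert (h1 : Cmod (y - z)%C < d) by (eapply Rlt_le_trans; [exact hy|apply Rmin_l]).
    assert (h2 : Cmod (y - z)%C < eps / (Rabs M + 1)) by (eapply Rlt_le_trans; [exact hy|apply Rmin_r]).
    specialize (hM h1). eapply Rle_trans; [exact hM|].
    pose proof (Cmod_ge_0 (y - z)%C). pose proof (Rle_abs M).
    apply Rcomplements.Rlt_div_r in h2; [|exact hM1].
    replace (M * Cmod (y - z)%C ^ 2) with (M * Cmod (y - z)%C * Cmod (y - z)%C) by ring.
    apply Rmult_le_compat_r; [assumption|]. nra.
Qed.

Lemma Cpow_second_order (w h : C) r n : Cmod w <= r -> Cmod (w + h)%C <= r ->
  Cmod ((w + h) ^ (S n) - w ^ (S n) - RtoC (INR (S n)) * h * w ^ n)%C * r <=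
    INR n * INR (S n) * r ^ n * Cmod h ^ 2.
Proof.
  intros hw hwh. assert (hr : 0 <= r) by (pose proof (Cmod_ge_0 w); lra).
  induction n as [|n IH].
  - replace ((w + h) ^ 1 - w ^ 1 - RtoC (INR 1) * h * w ^ 0)%C with (RtoC 0) by (simpl; ring).
    rewrite Cmod_0. simpl. lra.
  - replace ((w + h) ^ (S (S n)) - w ^ (S (S n)) - RtoC (INR (S (S n))) * h * w ^ (S n))%C
      with ((w + h) * ((w + h) ^ (S n) - w ^ (S n) - RtoC (INR (S n)) * h * w ^ n)
        + RtoC (INR (S n)) * (h * h) * w ^ n)%C.
    2:{ rewrite !Cpow_S. rewrite (S_INR (S n)), RtoC_plus. ring. }
    set (D := ((w + h) ^ (S n) - w ^ (S n) - RtoC (INR (S n)) * h * w ^ n)%C) in *.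
    apply Rle_trans with ((r * Cmod D + INR (S n) * (Cmod h ^ 2) * r ^ n) * r).
    + apply Rmult_le_compat_r; [exact hr|].
      eapply Rle_trans; [apply Cmod_triangle|].
      rewrite !Cmod_mult, Cmod_R, Cmod_pow, (Rabs_pos_eq (INR _)) by apply pos_INR.
      apply Rplus_le_compat.
      * apply Rmult_le_compat_r; [apply Cmod_ge_0|exact hwh].
      * replace (Cmod h * Cmod h) with (Cmod h ^ 2) by ring.
        apply Rmult_le_compat_l; [apply Rmult_le_pos; [apply pos_INR|apply pow2_ge_0]|].
        apply pow_incr; split; [apply Cmod_ge_0|exact hw].
    + replace ((r * Cmod D + INR (S n) * Cmod h ^ 2 * r ^ n) * r) with
        (r * (Cmod D * r) + INR (S n) * Cmod h ^ 2 * r ^ S n) by (simpl; ring).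
      apply Rle_trans with (r * (INR n * INR (S n) * r ^ n * Cmod h ^ 2) + INR (S n) * Cmod h ^ 2 * r ^ S n).
      { apply Rplus_le_compat_r. apply Rmult_le_compat_l; assumption. }
      rewrite (S_INR (S n)).
      assert (0 <= INR (S n) * (r ^ S n * Cmod h ^ 2)).
      { apply Rmult_le_pos; [apply pos_INR|]. apply Rmult_le_pos; [now apply pow_le|apply pow2_ge_0]. }
      rewrite S_INR in *. simpl in *. nra.
Qed.

(** The second-order remainders of the powers are dominated by the terms of the
    twice differentiated series at a slightly larger radius. *)
Lemma Cis_derive_CPS a w r : abs_conv a r -> Cmod w < r ->
  Cis_derive (CPS a) w (CPS (PS_derive a) w).
Proof.
  intros ha hw.
  pose proof (Cmod_ge_0 w) as hw0.
  set (s := (Cmod w + 2 * r) / 3). set (d := (r - Cmod w) / 3).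
  assert (hs : abs_conv (PS_derive (PS_derive a)) s).
  { apply abs_conv_derive with ((s + r) / 2); [unfold s; lra|].
    apply abs_conv_derive with r; [unfold s; lra|exact ha]. }
  assert (hs1 : abs_conv (PS_derive a) s) by (apply abs_conv_derive with r; [unfold s; lra|exact ha]).
  assert (hs0 : 0 < s) by (unfold s; lra).
  apply Cis_derive_quadratic with (M := 2 * Series (fun n => Rabs (PS_derive (PS_derive a) n) * s ^ n)) (d := d); [unfold d; lra|].
  intros h hh.
  assert (hwh : Cmod (w + h)%C <= s).
  { eapply Rle_trans; [apply Cmod_triangle|]. unfold s, d in *. lra. }
  assert (hws : Cmod w <= s) by (unfold s; lra).
  set (T := fun n => (RtoC (a n) * (w + h) ^ n - RtoC (a n) * w ^ n)%C).
  assert (hT : is_Cseries T (CPS a (w + h) - CPS a w)%C).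
  { eapply is_Cseries_ext; [|replace (CPS a (w + h) - CPS a w)%C with (CPS a (w + h) + RtoC (-1) * CPS a w)%C by ring;
      apply is_Cseries_plus; [|apply is_Cseries_scal]; apply CPS_correct with r; try assumption; unfold s in *; lra].
    intro n. unfold T. simpl. ring. }
  apply (is_Cseries_shift T) in hT; [|unfold T; simpl; ring].
  assert (hD : is_Cseries (fun n => T (S n) - h * (RtoC (PS_derive a n) * w ^ n))%C
     (CPS a (w + h) - CPS a w - h * CPS (PS_derive a) w)%C).
  { eapply is_Cseries_ext; [|replace (CPS a (w + h) - CPS a w - h * CPS (PS_derive a) w)%C with
      ((CPS a (w + h) - CPS a w) + (- h) * CPS (PS_derive a) w)%C by ring;
      apply is_Cseries_plus; [exact hT|apply is_Cseries_scal; apply CPS_correct with s; assumption]].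
    intro n. simpl. ring. }
  apply (is_Cseries_shift (fun n => T (S n) - h * (RtoC (PS_derive a n) * w ^ n))%C) in hD.
  2:{ unfold T, PS_derive. simpl INR. rewrite Rmult_1_l. simpl. ring. }
  replace (2 * Series (fun n => Rabs (PS_derive (PS_derive a) n) * s ^ n) * Cmod h ^ 2)
    with (2 * Series (fun n => Cmod h ^ 2 * (Rabs (PS_derive (PS_derive a) n) * s ^ n)))
    by (rewrite Series_scal_l; ring).
  apply (is_Cseries_Cmod _ _ _ hD).
  2:{ apply (ex_series_scal_l (Cmod h ^ 2) (fun n => Rabs (PS_derive (PS_derive a) n) * s ^ n)). exact hs. }
  intro n.
  replace (T (S (S n)) - h * (RtoC (PS_derive a (S n)) * w ^ S n))%C with
    (RtoC (a (S (S n))) * ((w + h) ^ S (S n) - w ^ S (S n) - RtoC (INR (S (S n))) * h * w ^ S n))%C.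
  2:{ unfold T, PS_derive. rewrite RtoC_mult, !Cpow_S. ring. }
  rewrite Cmod_mult, Cmod_R. unfold PS_derive.
  rewrite !Rabs_mult, !(Rabs_pos_eq (INR _)) by apply pos_INR.
  pose proof (Cpow_second_order w h s (S n) hws hwh) as hp.
  simpl pow in hp.
  set (D := Cmod ((w + h) ^ S (S n) - w ^ S (S n) - RtoC (INR (S (S n))) * h * w ^ S n)%C) in *.
  assert (hD2 : D <= INR (S n) * INR (S (S n)) * s ^ n * Cmod h ^ 2).
  { apply Rmult_le_reg_r with s; [exact hs0|]. eapply Rle_trans; [exact hp|]. right. simpl. ring. }
  replace (Cmod h ^ 2 * (INR (S n) * (INR (S (S n)) * Rabs (a (S (S n)))) * s ^ n)) with
    (Rabs (a (S (S n))) * (INR (S n) * INR (S (S n)) * s ^ n * Cmod h ^ 2)) by ring.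
  apply Rmult_le_compat_l; [apply Rabs_pos|exact hD2].
Qed.

(** * Complex exponential, logarithm and powers *)

Lemma Cexp_plus z w : Cexp (z + w) = (Cexp z * Cexp w)%C.
Proof.
  unfold Cexp. rewrite re_plus, im_plus, exp_plus, cos_plus, sin_plus.
  apply injective_projections; simpl; ring.
Qed.

Lemma Cexp_0 : Cexp 0 = 1%C.
Proof. unfold Cexp; simpl. rewrite exp_0, cos_0, sin_0. apply injective_projections; simpl; ring. Qed.

Lemma Cmod_Cexp z : Cmod (Cexp z) = exp (Re z).
Proof.
  unfold Cmod, Cexp; simpl fst; simpl snd.
  replace ((exp (Re z) * cos (Im z)) ^ 2 + (exp (Re z) * sin (Im z)) ^ 2) with (exp (Re z) ^ 2).
  - apply sqrt_pow2. left. apply exp_pos.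
  - pose proof (sin2_cos2 (Im z)) as h. unfold Rsqr in h.
    transitivity (exp (Re z) ^ 2 * (sin (Im z) * sin (Im z) + cos (Im z) * cos (Im z))); [rewrite h|]; ring.
Qed.

Lemma Cexp_nz z : Cexp z <> 0%C.
Proof.
  intro h. pose proof (Cmod_Cexp z) as e. rewrite h, Cmod_0 in e.
  pose proof (exp_pos (Re z)). lra.
Qed.

Lemma Cexp_INR n z : Cexp (RtoC (INR n) * z) = (Cexp z ^ n)%C.
Proof.
  induction n as [|n IH].
  - simpl. replace (RtoC 0 * z)%C with (RtoC 0) by ring. apply Cexp_0.
  - rewrite S_INR, RtoC_plus, Cpow_S, <- IH, <- Cexp_plus. f_equal. ring.
Qed.

Lemma Cexp_RtoC x : Cexp (RtoC x) = RtoC (exp x).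
Proof. unfold Cexp; simpl. rewrite cos_0, sin_0. apply injective_projections; simpl; ring. Qed.

Lemma MVT_abs_0 (f f' : R -> R) x : (forall c, derivable_pt_lim f c (f' c)) ->
  exists c, Rabs c <= Rabs x /\ Rabs (f x - f 0) = Rabs (f' c) * Rabs x.
Proof.
  intro hf. destruct (MVT_abs f f' 0 x) as [c [h hc]]; [intros; apply hf|].
  rewrite Rminus_0_r in h. exists c. split; [|exact h].
  unfold Rmin, Rmax in hc. destruct (Rle_dec 0 x);
  [rewrite !Rabs_pos_eq|rewrite !Rabs_left1]; lra.
Qed.

Lemma Rabs_sin_le x : Rabs (sin x) <= Rabs x.
Proof.
  destruct (MVT_abs_0 sin cos x derivable_pt_lim_sin) as [c [_ h]].
  rewrite sin_0, Rminus_0_r in h. rewrite h.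
  pose proof (COS_bound c). pose proof (Rabs_pos x).
  assert (Rabs (cos c) <= 1) by (apply Rabs_le; lra). nra.
Qed.

Lemma Rabs_cos_minus_1_le x : Rabs (cos x - 1) <= x ^ 2.
Proof.
  destruct (MVT_abs_0 cos (fun t => - sin t) x derivable_pt_lim_cos) as [c [hc h]].
  rewrite cos_0 in h. rewrite h, Rabs_Ropp, <- (pow2_abs x).
  pose proof (Rabs_sin_le c). pose proof (Rabs_pos x). nra.
Qed.

Lemma Rabs_sin_minus_id_le x : Rabs x <= 1 -> Rabs (sin x - x) <= x ^ 2.
Proof.
  intro hx. destruct (MVT_abs_0 (fun t => sin t - t) (fun t => cos t - 1) x) as [c [hc h]].
  { intro c. apply derivable_pt_lim_minus; [apply derivable_pt_lim_sin|apply derivable_pt_lim_id]. }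
  rewrite sin_0, !Rminus_0_r in h. rewrite h, <- (pow2_abs x).
  pose proof (Rabs_cos_minus_1_le c) as hb. rewrite <- (pow2_abs c) in hb.
  pose proof (Rabs_pos x). pose proof (Rabs_pos c).
  assert (Rabs c ^ 2 <= Rabs x) by nra. nra.
Qed.

Lemma exp_second_order x : Rabs x <= 1 / 2 -> Rabs (exp x - 1 - x) <= 2 * x ^ 2.
Proof.
  intro hx. apply Rabs_le_between in hx.
  assert (h1 : 1 + x <= exp x).
  { destruct (Req_dec x 0) as [->|h]; [rewrite exp_0; lra|left; now apply exp_ineq1]. }
  assert (h2 : 1 - x <= exp (- x)).
  { destruct (Req_dec x 0) as [->|h]; [rewrite Ropp_0, exp_0; lra|].
    left. replace (1 - x) with (1 + - x) by ring. apply exp_ineq1. lra. }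
  assert (h3 : exp x * exp (- x) = 1) by (rewrite <- exp_plus, Rplus_opp_r; apply exp_0).
  pose proof (exp_pos x). 
  assert (exp x * (1 - x) <= 1) by nra.
  rewrite Rabs_pos_eq by lra.
  assert (1 <= (1 + x + 2 * x ^ 2) * (1 - x)) by nra.
  assert (exp x * (1 - x) <= (1 + x + 2 * x ^ 2) * (1 - x)) by lra.
  assert (exp x <= 1 + x + 2 * x ^ 2) by (apply Rmult_le_reg_r with (1 - x); lra).
  lra.
Qed.

Lemma Cexp_second_order h : Cmod h < 1 / 2 -> Cmod (Cexp h - 1 - h)%C <= 10 * Cmod h ^ 2.
Proof.
  intro hh. destruct h as [x y].
  pose proof (re_le_Cmod (x, y)) as hx. pose proof (im_le_Cmod (x, y)) as hy.
  unfold Re, Im in hx, hy; simpl in hx, hy.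
  set (r := Cmod (x, y)) in *.
  pose proof (exp_second_order x ltac:(lra)) as e1.
  pose proof (Rabs_cos_minus_1_le y) as e2.
  pose proof (Rabs_sin_minus_id_le y ltac:(lra)) as e3.
  assert (hx2 : x ^ 2 <= r ^ 2) by (rewrite <- (pow2_abs x); apply pow_incr; split; [apply Rabs_pos|lra]).
  assert (hy2 : y ^ 2 <= r ^ 2) by (rewrite <- (pow2_abs y); apply pow_incr; split; [apply Rabs_pos|lra]).
  assert (hE : 0 < exp x <= 2).
  { split; [apply exp_pos|]. apply Rabs_le_between in e1. apply Rabs_le_between in hx. nra. }
  eapply Rle_trans; [apply Cmod_le_re_im|].
  unfold Re, Im, Cexp; simpl.
  replace (exp x * cos y + - (1) + - x) with ((exp x - 1 - x) + exp x * (cos y - 1)) by ring.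
  replace (exp x * sin y + - 0 + - y) with (exp x * (sin y - y) + ((exp x - 1 - x) + x) * y) by ring.
  assert (Rabs ((exp x - 1 - x) + exp x * (cos y - 1)) <= 2 * x ^ 2 + 2 * y ^ 2).
  { eapply Rle_trans; [apply Rabs_triang|]. rewrite Rabs_mult, (Rabs_pos_eq (exp x)) by lra.
    pose proof (Rabs_pos (cos y - 1)). nra. }
  assert (Rabs (exp x * (sin y - y) + ((exp x - 1 - x) + x) * y) <= 2 * y ^ 2 + (2 * x ^ 2 + Rabs x) * Rabs y).
  { eapply Rle_trans; [apply Rabs_triang|]. rewrite !Rabs_mult, (Rabs_pos_eq (exp x)) by lra.
    apply Rplus_le_compat.
    - pose proof (Rabs_pos (sin y - y)). nra.
    - apply Rmult_le_compat_r; [apply Rabs_pos|]. eapply Rle_trans; [apply Rabs_triang|]. lra. }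
  pose proof (Rabs_pos x). pose proof (Rabs_pos y).
  assert (Rabs x * Rabs y <= r * r) by (apply Rmult_le_compat; lra).
  assert (x ^ 2 * Rabs y <= r ^ 2 * 1) by (apply Rmult_le_compat; try lra; apply pow2_ge_0).
  change (r * (r * 1)) with (r ^ 2). nra.
Qed.

Lemma Cis_derive_Cexp z : Cis_derive Cexp z (Cexp z).
Proof.
  apply Cis_derive_quadratic with (M := Cmod (Cexp z) * 10) (d := 1 / 2); [lra|].
  intros h hh. rewrite Cexp_plus.
  replace (Cexp z * Cexp h - Cexp z - h * Cexp z)%C with (Cexp z * (Cexp h - 1 - h))%C by ring.
  rewrite Cmod_mult, Rmult_assoc. apply Rmult_le_compat_l; [apply Cmod_ge_0|].
  now apply Cexp_second_order.
Qed.

Lemma Cmod_sq (z : C) : Cmod z ^ 2 = Re z ^ 2 + Im z ^ 2.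
Proof. apply Cmod2_alt. Qed.

Lemma Re_div_Cmod (z : C) : z <> 0%C -> -1 <= Re z / Cmod z <= 1.
Proof.
  intro hz. apply Cmod_gt_0 in hz. pose proof (re_le_Cmod z) as h. apply Rabs_le_between in h.
  split; [apply Rcomplements.Rle_div_r|apply Rcomplements.Rle_div_l]; lra.
Qed.

Lemma sqrt_one_minus_sq (z : C) : z <> 0%C -> sqrt (1 - (Re z / Cmod z)²) = Rabs (Im z) / Cmod z.
Proof.
  intro hz. apply Cmod_gt_0 in hz.
  replace (1 - (Re z / Cmod z)²) with ((Rabs (Im z) / Cmod z) ^ 2).
  - apply sqrt_pow2. apply Rcomplements.Rdiv_le_0_compat; [apply Rabs_pos|exact hz].
  - unfold Rdiv. rewrite Rpow_mult_distr, pow2_abs. unfold Rsqr.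
    pose proof (Cmod_sq z) as h.
    replace (Im z ^ 2) with (Cmod z ^ 2 - Re z ^ 2) by lra. field. lra.
Qed.

Lemma cos_Arg (z : C) : z <> 0%C -> cos (Arg z) = Re z / Cmod z.
Proof.
  intro hz. pose proof (Re_div_Cmod z hz). unfold Arg. destruct (Rle_dec 0 (Im z)).
  - apply cos_acos. assumption.
  - rewrite cos_neg. apply cos_acos. assumption.
Qed.

Lemma sin_Arg (z : C) : z <> 0%C -> sin (Arg z) = Im z / Cmod z.
Proof.
  intro hz. pose proof (Re_div_Cmod z hz). unfold Arg. destruct (Rle_dec 0 (Im z)) as [h|h].
  - rewrite sin_acos, sqrt_one_minus_sq, Rabs_pos_eq; auto.
  - rewrite sin_neg, sin_acos, sqrt_one_minus_sq, Rabs_left; auto; [field|lra].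
    apply Cmod_gt_0 in hz. lra.
Qed.

Lemma Arg_bound (z : C) : z <> 0%C -> - PI < Arg z <= PI.
Proof.
  intro hz. pose proof (acos_bound (Re z / Cmod z)) as hb. pose proof PI_RGT_0.
  unfold Arg. destruct (Rle_dec 0 (Im z)) as [h|h]; [lra|].
  split; [|lra].
  destruct (Rle_lt_or_eq_dec _ _ (proj2 hb)) as [h1|h1]; [lra|exfalso].
  pose proof (sin_acos _ (Re_div_Cmod z hz)) as h2. rewrite h1, sin_PI, sqrt_one_minus_sq in h2 by exact hz.
  apply Cmod_gt_0 in hz.
  assert (0 < Rabs (Im z) / Cmod z); [|lra].
  apply Rdiv_lt_0_compat; [|exact hz]. apply Rabs_pos_lt. lra.
Qed.

Lemma Cexp_Clog (z : C) : z <> 0%C -> Cexp (Clog z) = z.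
Proof.
  intro hz. unfold Clog, Cexp; simpl. pose proof (proj1 (Cmod_gt_0 z) hz).
  rewrite exp_ln, cos_Arg, sin_Arg by assumption.
  destruct z as [x y]. apply injective_projections; simpl; field; lra.
Qed.

Lemma Clog_Cexp l : - PI < Im l <= PI -> Clog (Cexp l) = l.
Proof.
  intro h. unfold Clog. rewrite Cmod_Cexp, ln_exp.
  destruct l as [x y]; simpl in h. f_equal. unfold Arg. rewrite Cmod_Cexp.
  unfold Re, Im, Cexp; simpl. pose proof (exp_pos x).
  replace (exp x * cos y / exp x) with (cos y) by (field; lra).
  destruct (Rle_dec 0 (exp x * sin y)) as [h1|h1].
  - apply acos_cos. split; [|lra].
    destruct (Rle_lt_dec 0 y) as [|h2]; [assumption|exfalso].
    assert (sin y < 0); [|nra].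
    rewrite <- (Ropp_involutive y), sin_neg. assert (0 < sin (- y)) by (apply sin_gt_0; lra). lra.
  - rewrite <- cos_neg, acos_cos; [ring|]. split; [|lra].
    destruct (Rle_lt_dec 0 y) as [h2|]; [exfalso|lra].
    assert (0 <= sin y) by (apply sin_ge_0; lra). nra.
Qed.

Lemma RtoC_neq0 x : x <> 0 -> RtoC x <> 0%C.
Proof. intros h e. apply h. now injection e. Qed.

Lemma Clog_scal s (z : C) : 0 < s -> z <> 0%C -> Clog (RtoC s * z) = (RtoC (ln s) + Clog z)%C.
Proof.
  intros hs hz.
  rewrite <- (Cexp_Clog z) at 1 by exact hz.
  replace (RtoC s) with (Cexp (RtoC (ln s))) by (rewrite Cexp_RtoC, exp_ln; auto).
  rewrite <- Cexp_plus. apply Clog_Cexp. simpl. pose proof (Arg_bound z hz). lra.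
Qed.

Lemma Cpower_nz (z : C) a : z <> 0%C -> Cpower z a = Cexp (RtoC a * Clog z)%C.
Proof. intro h. unfold Cpower. now destruct (Ceq_dec z 0). Qed.

Lemma Cpower_neq0 (z : C) a : z <> 0%C -> Cpower z a <> 0%C.
Proof. intro h. rewrite Cpower_nz by exact h. apply Cexp_nz. Qed.

Lemma Cpower_plus (z : C) a b : z <> 0%C -> Cpower z (a + b) = (Cpower z a * Cpower z b)%C.
Proof. intro h. rewrite !Cpower_nz, <- Cexp_plus, RtoC_plus by exact h. f_equal. ring. Qed.

Lemma Cpower_INR (z : C) n : z <> 0%C -> Cpower z (INR n) = (z ^ n)%C.
Proof. intro h. rewrite Cpower_nz, Cexp_INR, Cexp_Clog by exact h. reflexivity. Qed.

Lemma Cpower_half (z : C) a : z <> 0%C -> Cpower (z / 2) a = (Cpower z a * RtoC (Rpower 2 (- a)))%C.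
Proof.
  intro h.
  assert (e : (z / 2)%C = (RtoC (/ 2) * z)%C).
  { rewrite RtoC_inv by lra. field. }
  assert (h2 : (z / 2)%C <> 0%C).
  { rewrite e. intro e0. apply h. replace z with (RtoC 2 * (RtoC (/2) * z))%C.
    - rewrite e0. ring.
    - rewrite RtoC_inv by lra. field. }
  rewrite !Cpower_nz by assumption. rewrite e, Clog_scal, ln_Rinv by (auto; lra).
  unfold Rpower. rewrite <- Cexp_RtoC, <- Cexp_plus. f_equal.
  rewrite RtoC_mult, !RtoC_opp. ring.
Qed.

(** A quarter of a principal argument is again principal, so no multiple of
    [2 PI] appears. *)
Lemma Clog_quarter (z : C) : z <> 0%C -> Clog (Cpower z (1 / 4)) = (RtoC (1 / 4) * Clog z)%C.
Proof.
  intro h. rewrite Cpower_nz by exact h. apply Clog_Cexp. simpl.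
  pose proof (Arg_bound z h). pose proof PI_RGT_0. lra.
Qed.

(** * Horizontal derivatives *)

(** [C_derive] looks at horizontal difference quotients only, and the principal
    powers are not complex differentiable on the cut.  This relation is the
    derivative in the sense of [C_derive]; it holds for complex differentiable
    functions and also for the principal logarithm on the cut. *)
Definition hderiv (f : C -> C) (z l : C) : Prop :=
  is_derive (fun x : R => Re (f (x, Im z))) (Re z) (Re l) /\
  is_derive (fun x : R => Im (f (x, Im z))) (Re z) (Im l).

Lemma is_derive_is_lim (g : R -> R) (x l : R) : is_derive g x l ->
  is_lim (fun y => (g y - g x) / (y - x)) x l.
Proof.
  intro h. apply is_derive_Reals in h. apply is_lim_spec. intros eps.
  destruct (h eps (cond_pos eps)) as [d hd].
  exists d. intros y hy hne. change R in (type of y).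
  specialize (hd (y - x) ltac:(lra) hy).
  now replace (x + (y - x)) with y in hd by ring.
Qed.

Lemma hderiv_unique f z l : hderiv f z l -> C_derive f z = l.
Proof.
  intros [h1 h2]. destruct z as [x y]. simpl in h1, h2.
  apply is_derive_is_lim in h1. apply is_derive_is_lim in h2.
  unfold C_derive, C_lim. simpl fst; simpl snd.
  apply injective_projections; simpl fst; simpl snd.
  - rewrite (is_lim_unique _ _ (Re l)); [reflexivity|].
    eapply is_lim_ext_loc; [|exact h1].
    exists (mkposreal 1 Rlt_0_1). intros t _ ht.
    change R in (type of t). assert (t - x <> 0) by (intro; apply ht; lra).
    unfold Re, Im. simpl. field. repeat split; try assumption; nra.
  - rewrite (is_lim_unique _ _ (Im l)); [reflexivity|].
    eapply is_lim_ext_loc; [|exact h2].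
    exists (mkposreal 1 Rlt_0_1). intros t _ ht.
    change R in (type of t). assert (t - x <> 0) by (intro; apply ht; lra).
    unfold Re, Im. simpl. field. repeat split; try assumption; nra.
Qed.

Lemma Cis_derive_bound (f : C -> C) (z l : C) : Cis_derive f z l -> forall eps : posreal,
  exists d : posreal, forall y, Cmod (y - z)%C < d ->
    Cmod (f y - f z - (y - z) * l)%C <= eps * Cmod (y - z)%C.
Proof.
  intros [_ h] eps.
  specialize (h z). destruct (h (fun P H => H) eps) as [d hd].
  exists d. intros y hy. exact (hd y hy).
Qed.

Lemma hderiv_eq f (z l m : C) : hderiv f z l -> l = m -> hderiv f z m.
Proof. now intros h <-. Qed.

Lemma hderiv_of_Cis_derive (f : C -> C) (z l : C) : Cis_derive f z l -> hderiv f z l.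
Proof.
  intro h. pose proof (Cis_derive_bound f z l h) as hb.
  assert (hz : (Re z, Im z) = z) by (now destruct z).
  assert (key : forall eps : posreal, exists d : posreal, forall x : R, Rabs (x - Re z) < d ->
    Cmod (f (x, Im z) - f z - RtoC (x - Re z) * l)%C <= eps * Rabs (x - Re z)).
  { intro eps. destruct (hb eps) as [d hd]. exists d. intros x hx.
    assert (e : ((x, Im z) - z)%C = RtoC (x - Re z)).
    { destruct z as [a b]. apply injective_projections; simpl; ring. }
    specialize (hd (x, Im z)). rewrite e, Cmod_R in hd. now apply hd. }
  split; (split; [apply is_linear_scal_l|]); intros x0 hx0;
  apply (is_filter_lim_locally_unique (V := R_NormedModule)) in hx0; subst x0;
  intro eps; destruct (key eps) as [d hd]; exists d; intros x hx; specialize (hd x hx);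
  (eapply Rle_trans; [|exact hd]).
  - change (Rabs (Re (f (x, Im z)) - Re (f (Re z, Im z)) - (x - Re z) * Re l) <=
      Cmod (f (x, Im z) - f z - RtoC (x - Re z) * l)%C).
    rewrite hz. eapply Rle_trans; [|apply re_le_Cmod]. right. f_equal. unfold Re; simpl. ring.
  - change (Rabs (Im (f (x, Im z)) - Im (f (Re z, Im z)) - (x - Re z) * Im l) <=
      Cmod (f (x, Im z) - f z - RtoC (x - Re z) * l)%C).
    rewrite hz. eapply Rle_trans; [|apply im_le_Cmod]. right. f_equal. unfold Im; simpl. ring.
Qed.

Lemma hderiv_mult (f g : C -> C) (z lf lg : C) : hderiv f z lf -> hderiv g z lg ->
  hderiv (fun w => f w * g w)%C z (lf * g z + f z * lg)%C.
Proof.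
  intros [f1 f2] [g1 g2].
  assert (hz : (Re z, Im z) = z) by (now destruct z).
  split.
  - evar_last.
    + exact (is_derive_minus _ _ _ _ _
        (is_derive_mult _ _ _ _ _ f1 g1 Rmult_comm) (is_derive_mult _ _ _ _ _ f2 g2 Rmult_comm)).
    + cbv beta. rewrite hz. unfold Re, Im, minus, plus, opp, mult; simpl. ring.
  - evar_last.
    + exact (is_derive_plus _ _ _ _ _
        (is_derive_mult _ _ _ _ _ f1 g2 Rmult_comm) (is_derive_mult _ _ _ _ _ f2 g1 Rmult_comm)).
    + cbv beta. rewrite hz. unfold Re, Im, minus, plus, opp, mult; simpl. ring.
Qed.

Lemma hderiv_const (c z : C) : hderiv (fun _ => c) z 0%C.
Proof. split; simpl; apply (is_derive_const (K := R_AbsRing) (V := R_NormedModule)). Qed.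

Lemma hderiv_scal (c : C) (f : C -> C) (z l : C) : hderiv f z l -> hderiv (fun w => c * f w)%C z (c * l)%C.
Proof.
  intro h. eapply hderiv_eq; [exact (hderiv_mult _ _ _ _ _ (hderiv_const c z) h)|]. cbv beta. ring.
Qed.

Lemma hderiv_id z : hderiv (fun w => w) z 1%C.
Proof.
  split; simpl.
  - apply (is_derive_id (K := R_AbsRing)).
  - apply (is_derive_const (K := R_AbsRing) (V := R_NormedModule)).
Qed.

(** Near a nonzero [z] the horizontal line through [z] avoids 0. *)
Lemma hderiv_ext_nz (f g : C -> C) (z l : C) : z <> 0%C ->
  (forall w : C, w <> 0%C -> f w = g w) -> hderiv f z l -> hderiv g z l.
Proof.
  intros hz hfg [h1 h2].
  assert (hl : locally (Re z) (fun x : R => ((x, Im z) : C) <> 0%C)).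
  { destruct (Req_dec (Im z) 0) as [h0|h0].
    - assert (hre : Re z <> 0).
      { intro e. apply hz. destruct z as [a b]. simpl in *. now subst. }
      exists (mkposreal _ (Rabs_pos_lt _ hre)). intros x hx e. 
      change (Rabs (x - Re z) < Rabs (Re z)) in hx.
      assert (ex : x = 0) by now injection e. rewrite ex, Rminus_0_l, Rabs_Ropp in hx. lra.
    - exists (mkposreal 1 Rlt_0_1). intros x _ e. apply h0. now injection e. }
  split.
  - eapply is_derive_ext_loc; [|exact h1]. revert hl. apply filter_imp. intros x hx. now rewrite hfg.
  - eapply is_derive_ext_loc; [|exact h2]. revert hl. apply filter_imp. intros x hx. now rewrite hfg.
Qed.

Lemma hderiv_Cexp (f : C -> C) (z l : C) :
  hderiv f z l -> hderiv (fun w => Cexp (f w)) z (Cexp (f z) * l)%C.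
Proof.
  destruct z as [x y]. intros [h1 h2]. simpl in h1, h2.
  set (u := fun t : R => Re (f (t, y))) in *. set (v := fun t : R => Im (f (t, y))) in *.
  assert (he : is_derive (fun t => exp (u t)) x (Re l * exp (u x)))
    by exact (is_derive_comp exp u x _ _ (is_derive_exp _) h1).
  assert (hc : is_derive (fun t => cos (v t)) x (Im l * - sin (v x)))
    by exact (is_derive_comp cos v x _ _ (is_derive_cos _) h2).
  assert (hs : is_derive (fun t => sin (v t)) x (Im l * cos (v x)))
    by exact (is_derive_comp sin v x _ _ (is_derive_sin _) h2).
  split.
  - evar_last; [exact (is_derive_mult _ _ _ _ _ he hc Rmult_comm)|].
    unfold u, v, Cexp, Re, Im, plus, mult; simpl. ring.
  - evar_last; [exact (is_derive_mult _ _ _ _ _ he hs Rmult_comm)|].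
    unfold u, v, Cexp, Re, Im, plus, mult; simpl. ring.
Qed.

Lemma is_derive_acos u : -1 < u < 1 -> is_derive acos u (- / sqrt (1 - u²)).
Proof.
  intro h. apply is_derive_Reals. pose proof (derive_pt_acos u h) as e.
  replace (- / sqrt (1 - u²)) with (-1 / sqrt (1 - u²)) by (unfold Rdiv; ring).
  rewrite <- e. apply derive_pt_eq_1 with (derivable_pt_acos u h). reflexivity.
Qed.

Lemma hderiv_Clog (z : C) : z <> 0%C -> hderiv Clog z (/ z)%C.
Proof.
  intro hz. pose proof (proj1 (Cmod_gt_0 z) hz) as hr.
  destruct z as [x y]. set (r := Cmod (x, y)) in *.
  assert (hr2 : r * r = x * x + y * y).
  { pose proof (Cmod_sq (x, y)) as e. unfold Re, Im in e; simpl in e. fold r in e. lra. }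
  assert (hxy : 0 < x ^ 2 + y ^ 2) by (simpl; nra).
  assert (hsq : sqrt (x ^ 2 + y ^ 2) = r) by reflexivity.
  split; simpl.
  - unfold Cmod; simpl fst; simpl snd.
    auto_derive.
    + replace (x * (x * 1) + y * (y * 1)) with (x ^ 2 + y ^ 2) by ring. rewrite hsq. tauto.
    + replace (x * (x * 1) + y * (y * 1)) with (x ^ 2 + y ^ 2) by ring. rewrite hsq.
      replace (x ^ 2 + y ^ 2) with (r * r) by (rewrite hr2; ring). field. lra.
  - destruct (Req_dec y 0) as [->|hy].
    (* the line is the real axis, on either side of 0 the argument is constant *)
    + assert (hx : x <> 0) by (intros ->; lra).
      replace (- 0 / _) with 0 by (unfold Rdiv; ring).
      apply (is_derive_ext_loc (fun _ => acos (x / Rabs x))); [|apply (is_derive_const (K := R_AbsRing) (V := R_NormedModule))].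
      exists (mkposreal _ (Rabs_pos_lt _ hx)). intros t ht. change R in (type of t). change (Rabs (t - x) < Rabs x) in ht.
      unfold Arg; simpl. destruct (Rle_dec 0 0) as [_|n]; [|lra].
      change (t, 0) with (RtoC t). rewrite Cmod_R. f_equal.
      destruct (Rle_lt_dec 0 x) as [h|h].
      * rewrite (Rabs_pos_eq x) in * by lra. apply Rabs_lt_between in ht.
        rewrite Rabs_pos_eq by lra. field. lra.
      * rewrite (Rabs_left x) in * by lra. apply Rabs_lt_between in ht.
        rewrite Rabs_left by lra. field. lra.
    + assert (hu : -1 < x / r < 1).
      { assert (Rabs x < r).
        { apply Rcomplements.Rabs_lt_between. split; nra. }
        apply Rabs_lt_between in H. split; [apply Rcomplements.Rlt_div_r|apply Rcomplements.Rlt_div_l]; lra. }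
      assert (hs : sqrt (1 - (x / r)²) = Rabs y / r) by (apply (sqrt_one_minus_sq (x, y) hz)).
      assert (hd : is_derive (fun t => acos (t / Cmod (t, y))) x (- Rabs y / (r * r))).
      { evar_last.
        - apply (is_derive_comp acos (fun t => t / Cmod (t, y))).
          + apply is_derive_acos. exact hu.
          + unfold Cmod; simpl fst; simpl snd. auto_derive; [|reflexivity].
            replace (x * (x * 1) + y * (y * 1)) with (x ^ 2 + y ^ 2) by ring. rewrite hsq. split; [tauto|]. split; [lra|exact I].
        - change (Cmod (x, y)) with r. rewrite hs. unfold scal; simpl; unfold mult; simpl.
          replace (x * (x * 1) + y * (y * 1)) with (x ^ 2 + y ^ 2) by ring. rewrite hsq.
          assert (hay : 0 < Rabs y) by now apply Rabs_pos_lt.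
          assert (hy2 : Rabs y * Rabs y = r * r - x * x).
          { rewrite <- Rabs_mult, Rabs_pos_eq by nra. lra. }
          replace (1 * / r + x * (- (1 * ((1 + 1) * (x * 1)) * / (2 * r)) * / (r * r)))
            with (Rabs y * Rabs y / (r * r * r)) by (rewrite hy2; field; lra).
          field. split; lra. }
      unfold Arg; simpl.
      destruct (Rle_dec 0 y) as [h|h].
      * evar_last; [exact hd|]. rewrite Rabs_pos_eq by lra.
        replace (x * (x * 1) + y * (y * 1)) with (r * r) by (rewrite hr2; ring). reflexivity.
      * evar_last; [apply (is_derive_opp _ _ _ hd)|]. rewrite Rabs_left by lra.
        replace (x * (x * 1) + y * (y * 1)) with (r * r) by (rewrite hr2; ring).
        unfold opp; simpl. field. lra.
Qed.

Lemma hderiv_Cpower (z : C) a : z <> 0%C ->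
  hderiv (fun w => Cpower w a) z (RtoC a * Cpower z a / z)%C.
Proof.
  intro hz. apply hderiv_ext_nz with (fun w => Cexp (RtoC a * Clog w)%C); [exact hz| |].
  - intros w hw. now rewrite Cpower_nz.
  - eapply hderiv_eq; [exact (hderiv_Cexp _ _ _ (hderiv_scal (RtoC a) _ _ _ (hderiv_Clog z hz)))|].
    cbv beta. rewrite <- (Cpower_nz z a hz). unfold Cdiv. ring.
Qed.

(** * Rules for the complex derivative *)

(** [C] carries two normed module structures over itself, with the same norm; the
    product and chain rules are available for one, [C_derive] for the other. *)
Lemma Cis_derive_absring (f : C -> C) (z l : C) :
  Cis_derive f z l <-> is_derive (K := C_AbsRing) (V := AbsRing_NormedModule C_AbsRing) f z l.
Proof.
  split; intros [_ h]; (split; [apply is_linear_scal_l|]); intros x hx eps; destruct (h x hx eps) as [d hd];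
  exists d; intros y hy; exact (hd y hy).
Qed.

Lemma Cis_derive_mult (f g : C -> C) (z lf lg : C) :
  Cis_derive f z lf -> Cis_derive g z lg ->
  Cis_derive (fun w => f w * g w)%C z (lf * g z + f z * lg)%C.
Proof.
  rewrite !Cis_derive_absring. intros hf hg.
  exact (is_derive_mult (K := C_AbsRing) f g z lf lg hf hg Cmult_comm).
Qed.

Lemma Cis_derive_comp (f g : C -> C) (z lf lg : C) :
  Cis_derive f (g z) lf -> Cis_derive g z lg ->
  Cis_derive (fun w => f (g w)) z (lg * lf)%C.
Proof.
  rewrite !Cis_derive_absring. intros hf hg.
  exact (is_derive_comp (K := C_AbsRing) (V := AbsRing_NormedModule C_AbsRing) f g z lf lg hf hg).
Qed.

Lemma Cis_derive_id (z : C) : Cis_derive (fun w => w) z (RtoC 1).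
Proof. apply Cis_derive_absring. exact (is_derive_id (K := C_AbsRing) z). Qed.

Lemma Cis_derive_const (c z : C) : Cis_derive (fun _ => c) z (RtoC 0).
Proof. exact (is_derive_const (K := C_AbsRing) (V := C_NormedModule) c z). Qed.

Lemma Cis_derive_eq (f : C -> C) (z l m : C) : Cis_derive f z l -> l = m -> Cis_derive f z m.
Proof. now intros h <-. Qed.

Lemma Cis_derive_scal (c : C) (f : C -> C) (z l : C) :
  Cis_derive f z l -> Cis_derive (fun w => c * f w)%C z (c * l)%C.
Proof.
  intro h. eapply Cis_derive_eq; [exact (Cis_derive_mult _ _ _ _ _ (Cis_derive_const c z) h)|]. cbv beta. ring.
Qed.

Lemma Cis_derive_pow (n : nat) (z : C) :
  Cis_derive (fun w => w ^ S n)%C z (RtoC (INR (S n)) * z ^ n)%C.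
Proof.
  induction n as [|n IH].
  - eapply Cis_derive_eq; [exact (Cis_derive_mult _ _ _ _ _ (Cis_derive_id z) (Cis_derive_const (RtoC 1) z))|].
    cbv beta. simpl. ring.
  - eapply Cis_derive_eq; [exact (Cis_derive_mult _ _ _ _ _ (Cis_derive_id z) IH)|].
    cbv beta. rewrite (S_INR (S n)), RtoC_plus. rewrite !Cpow_S. ring.
Qed.

(** * The Gamma function *)

Definition gamma_integrand (x t : R) : R := Rpower t (x - 1) * exp (- t).

Lemma gamma_integrand_pos x t : 0 < gamma_integrand x t.
Proof. apply Rmult_lt_0_compat; [unfold Rpower|]; apply exp_pos. Qed.

Lemma gamma_integrand_continuous x t : 0 < t -> continuous (gamma_integrand x) t.
Proof.
  intro h. apply (ex_derive_continuous (K := R_AbsRing) (V := R_NormedModule)).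
  unfold gamma_integrand, Rpower. auto_derive. exact h.
Qed.

Lemma ln_tangent c t : 0 < c -> 0 < t -> c * ln t <= t - c + c * ln c.
Proof.
  intros hc ht.
  assert (h : ln (t / c) <= t / c - 1).
  { pose proof (Rdiv_lt_0_compat t c ht hc).
    destruct (Req_dec (t / c) 1) as [e|e]; [rewrite e, ln_1; lra|].
    rewrite <- (ln_exp (t / c - 1)). left. apply ln_increasing; [assumption|].
    replace (t / c) with (1 + (t / c - 1)) at 1 by ring. apply exp_ineq1. lra. }
  rewrite ln_div in h by assumption.
  apply (Rmult_le_compat_l c) in h; [|lra].
  replace (c * (t / c - 1)) with (t - c) in h by (field; lra). lra.
Qed.

(** The maximum of [(1 + t) ^ (x + 1) * exp (- t)] is attained at [t = x]. *)
Lemma Rpower_exp_bound x t : 0 < x -> 0 < t ->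
  Rpower (1 + t) (x + 1) * exp (- t) <= exp ((x + 1) * ln (x + 1) - x).
Proof.
  intros hx ht. unfold Rpower. rewrite <- exp_plus.
  pose proof (ln_tangent (x + 1) (1 + t) ltac:(lra) ltac:(lra)).
  destruct (Req_dec ((x + 1) * ln (1 + t) + - t) ((x + 1) * ln (x + 1) - x)) as [->|h]; [lra|].
  left. apply exp_increasing. lra.
Qed.

(** The integrand is at most a constant times the derivative of the bounded
    function [(t / (1 + t)) ^ x]; this one bound covers both ends of the half-line. *)
Lemma gamma_integral_bound x a b : 0 < x -> 0 < a <= b ->
  RInt (gamma_integrand x) a b <= exp ((x + 1) * ln (x + 1) - x) / x.
Proof.
  intros hx [ha hab].
  set (M := exp ((x + 1) * ln (x + 1) - x)).
  set (H := fun t => M / x * Rpower (t / (1 + t)) x).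
  set (H' := fun t => M * (Rpower t (x - 1) / Rpower (1 + t) (x + 1))).
  assert (hM : 0 < M) by apply exp_pos.
  assert (hd : forall t, a <= t <= b -> is_derive H t (H' t)).
  { intros t ht. unfold H, H'. unfold Rpower at 1. auto_derive.
    - split; [lra|]. split; [apply Rdiv_lt_0_compat; lra|exact I].
    - change (t * / (1 + t)) with (t / (1 + t)). rewrite ln_div by lra.
      replace (exp (x * (ln t - ln (1 + t)))) with (Rpower t (x - 1) * t / (Rpower (1 + t) (x + 1) / (1 + t))).
      + pose proof (Rpower_pos (1 + t) (x + 1)).
        field. repeat split; lra.
      + replace (x * (ln t - ln (1 + t))) with (x * ln t + - (x * ln (1 + t))) by ring.
        rewrite exp_plus, exp_Ropp.
        rewrite (Rpower_plus x 1 (1 + t)), (Rpower_1 (1 + t)) by lra.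
        unfold Rminus. rewrite Rpower_plus, Rpower_Ropp, Rpower_1 by lra.
        change (exp (x * ln t)) with (Rpower t x). change (exp (x * ln (1 + t))) with (Rpower (1 + t) x).
        pose proof (Rpower_pos (1 + t) x).
        field. repeat split; lra. }
  assert (hc : forall t, a <= t <= b -> continuous H' t).
  { intros t ht. apply (ex_derive_continuous (K := R_AbsRing) (V := R_NormedModule)).
    unfold H', Rpower. auto_derive. repeat split; try lra. apply Rgt_not_eq, exp_pos. }
  assert (hI : is_RInt H' a b (H b - H a)).
  { apply (is_RInt_derive H H'); rewrite Rmin_left, Rmax_right by lra; assumption. }
  apply Rle_trans with (RInt H' a b).
  - apply RInt_le; [exact hab| |eexists; exact hI|].
    + apply (ex_RInt_continuous (V := R_CompleteNormedModule)). intros t ht.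
      rewrite Rmin_left, Rmax_right in ht by lra. apply gamma_integrand_continuous. lra.
    + intros t ht. unfold gamma_integrand, H'.
      pose proof (Rpower_exp_bound x t hx ltac:(lra)) as hb. fold M in hb.
      pose proof (Rpower_pos t (x - 1)).
      pose proof (Rpower_pos (1 + t) (x + 1)) as h0.
      replace (M * (Rpower t (x - 1) / Rpower (1 + t) (x + 1))) with (Rpower t (x - 1) * (M / Rpower (1 + t) (x + 1))) by (field; lra).
      apply Rmult_le_compat_l; [lra|]. apply Rcomplements.Rle_div_r; [exact h0|]. lra.
  - rewrite (is_RInt_unique _ _ _ _ hI). unfold H.
    pose proof (Rpower_pos (a / (1 + a)) x).
    assert (Rpower (b / (1 + b)) x <= 1).
    { assert (ln (b / (1 + b)) < 0).
      { rewrite <- ln_1. apply ln_increasing; [apply Rdiv_lt_0_compat; lra|].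
        apply Rcomplements.Rlt_div_l; lra. }
      apply Rle_trans with (exp 0); [|rewrite exp_0; lra].
      left. apply exp_increasing. nra. }
    assert (0 < M / x) by (apply Rdiv_lt_0_compat; assumption).
    nra.
Qed.

(** The integrand is positive, so the integral is the supremum over compact
    intervals. *)
Lemma Gamma_integral x : 0 < x -> exists l, 0 < l /\
  is_RInt_gen (gamma_integrand x) (at_right 0) (Rbar_locally p_infty) l.
Proof.
  intro hx.
  set (E := fun v => exists a b, 0 < a <= b /\ v = RInt (gamma_integrand x) a b).
  assert (hint : forall a b, 0 < a -> 0 < b -> ex_RInt (gamma_integrand x) a b).
  { intros a b h1 h2. apply (ex_RInt_continuous (V := R_CompleteNormedModule)). intros t ht.
    apply gamma_integrand_continuous. 
    eapply Rlt_le_trans; [|apply ht]. now apply Rmin_pos. }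
  destruct (completeness E) as [l [hu hl]].
  { eexists. intros v (a & b & h & ->). now apply gamma_integral_bound. }
  { exists (RInt (gamma_integrand x) 1 2), 1, 2. split; [lra|reflexivity]. }
  exists l. split.
  - apply Rlt_le_trans with (RInt (gamma_integrand x) 1 2).
    + apply RInt_gt_0; [lra|intros; apply gamma_integrand_pos|].
      intros t ht. apply gamma_integrand_continuous. lra.
    + apply hu. exists 1, 2. split; [lra|reflexivity].
  - assert (hmono : forall a0 b0 a b, 0 < a <= a0 -> a0 <= b0 <= b ->
      RInt (gamma_integrand x) a0 b0 <= RInt (gamma_integrand x) a b).
    { intros a0 b0 a b h1 h2.
      rewrite <- (RInt_Chasles (gamma_integrand x) a a0 b) by (apply hint; lra).
      rewrite <- (RInt_Chasles (gamma_integrand x) a0 b0 b) by (apply hint; lra).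
      assert (forall u v, 0 < u <= v -> 0 <= RInt (gamma_integrand x) u v).
      { intros u v h. apply RInt_ge_0; [lra|apply hint; lra|]. intros; left; apply gamma_integrand_pos. }
      pose proof (H a a0 ltac:(lra)). pose proof (H b0 b ltac:(lra)).
      unfold plus; simpl. lra. }
    intros P [eps hP].
    assert (hne : exists a0 b0, 0 < a0 <= b0 /\ l - eps < RInt (gamma_integrand x) a0 b0).
    { apply Classical_Prop.NNPP. intro hn.
      assert (l <= l - eps); [|pose proof (cond_pos eps); lra].
      apply hl. intros v (a & b & h & ->). apply Rnot_lt_le. intro. apply hn. now exists a, b. }
    destruct hne as (a0 & b0 & h & hgt).
    exists (fun a => 0 < a < a0) (fun b => b0 < b).
    + exists (mkposreal a0 (proj1 h)). intros t ht h0. 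
      change (Rabs (t - 0) < a0) in ht. rewrite Rminus_0_r in ht. apply Rabs_lt_between in ht.
      split; [exact h0|apply ht].
    + exists b0. tauto.
    + intros a b ha hb. exists (RInt (gamma_integrand x) a b). simpl. split.
      * apply (RInt_correct (V := R_CompleteNormedModule)). apply hint; lra.
      * apply hP. change (Rabs (RInt (gamma_integrand x) a b - l) < eps).
        pose proof (hmono a0 b0 a b ltac:(lra) ltac:(lra)).
        assert (RInt (gamma_integrand x) a b <= l) by (apply hu; exists a, b; split; [lra|reflexivity]).
        apply Rabs_lt_between. pose proof (cond_pos eps). lra.
Qed.

Lemma Gamma_correct x : 0 < x ->
  is_RInt_gen (gamma_integrand x) (at_right 0) (Rbar_locally p_infty) (Gamma x).
Proof.
  intro hx. destruct (Gamma_integral x hx) as [l [_ h]].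
  replace (Gamma x) with l; [exact h|]. symmetry.
  exact (is_RInt_gen_unique (V := R_CompleteNormedModule) (gamma_integrand x) l h).
Qed.

Lemma Gamma_pos x : 0 < x -> 0 < Gamma x.
Proof.
  intro hx. destruct (Gamma_integral x hx) as [l [h0 h]].
  replace (Gamma x) with l; [exact h0|]. symmetry.
  exact (is_RInt_gen_unique (V := R_CompleteNormedModule) (gamma_integrand x) l h).
Qed.

(** Integration by parts: [- t ^ x * exp (- t)] vanishes at both ends. *)
Lemma Gamma_succ x : 0 < x -> Gamma (x + 1) = x * Gamma x.
Proof.
  intro hx.
  set (g := fun t => - (Rpower t x * exp (- t))).
  assert (hd : forall t, 0 < t -> is_derive g t (gamma_integrand (x + 1) t - x * gamma_integrand x t)).
  { intros t ht. unfold g, gamma_integrand. unfold Rpower at 1. auto_derive; [exact ht|].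
    replace (x + 1 - 1) with x by ring.
    replace (Rpower t (x - 1)) with (Rpower t x * / t).
    - unfold Rpower. field. lra.
    - unfold Rminus. rewrite Rpower_plus, Rpower_Ropp, Rpower_1 by exact ht. reflexivity. }
  assert (hpos : filter_prod (at_right 0) (Rbar_locally p_infty) (fun ab : R * R => forall t, Rmin (fst ab) (snd ab) <= t <= Rmax (fst ab) (snd ab) -> 0 < t)).
  { exists (fun a => 0 < a) (fun b => 0 < b).
    - exists (mkposreal 1 Rlt_0_1). intros t _ h. exact h.
    - exists 0. tauto.
    - intros a b ha hb t ht. simpl in ht. eapply Rlt_le_trans; [|apply ht]. now apply Rmin_pos. }
  assert (h1 : is_RInt_gen (Derive g) (at_right 0) (Rbar_locally p_infty) (0 - 0)).
  { apply is_RInt_gen_Derive.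
    - revert hpos. apply filter_imp. intros ab h t ht. eexists. apply hd. now apply h.
    - revert hpos. apply filter_imp. intros ab h t ht. specialize (h t ht).
      apply (continuous_ext_loc _ (fun t => minus (gamma_integrand (x + 1) t) (scal x (gamma_integrand x t)))).
      + exists (mkposreal t h). intros s hs. change (Rabs (s - t) < t) in hs. apply Rabs_lt_between in hs.
        symmetry. apply is_derive_unique. apply hd. lra.
      + apply (continuous_minus (K := R_AbsRing) (V := R_NormedModule)); [now apply gamma_integrand_continuous|].
        apply (continuous_scal_r (K := R_AbsRing) (V := R_NormedModule)). now apply gamma_integrand_continuous.
    (* at 0 from the right, t ^ x tends to 0 because x > 0 *)
    - replace 0 with (- (0 * exp (- 0))) at 2 by ring.
      apply (filterlim_comp _ _ _ (fun t => Rpower t x * exp (- t)) Ropp (at_right 0) (locally (0 * exp (- 0)))); [|apply (filterlim_opp (K := R_AbsRing) (V := R_NormedModule))].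
      apply (filterlim_comp_2 (G := locally 0) (H := locally (exp (- 0))) (fun t => Rpower t x) (fun t => exp (- t)) Rmult); [| |apply (filterlim_mult (K := R_AbsRing))].
      + unfold Rpower. eapply filterlim_comp; [|exact is_lim_exp_m].
        apply filterlim_comp with (G := Rbar_locally m_infty); [exact is_lim_ln_0|].
        intros P [M hM]. exists (M / x). intros y hy. apply hM.
        apply Rcomplements.Rlt_div_r in hy; lra.
      + eapply filterlim_filter_le_1; [|apply (continuous_comp Ropp exp 0)].
        * apply filter_le_within.
        * apply (filterlim_opp (K := R_AbsRing) (V := R_NormedModule)).
        * apply continuous_exp.
    (* at infinity, t ^ x * exp (- t) <= M / (1 + t) *)
    - set (M := exp ((x + 1) * ln (x + 1) - x)).
      apply (is_lim_le_le_loc (fun t => - (M * / (1 + t))) (fun _ => 0) g p_infty 0).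
      + exists 0. intros t ht. unfold g.
        pose proof (Rpower_exp_bound x t hx ht) as hb. fold M in hb.
        pose proof (Rpower_pos t x) as h0.
        pose proof (exp_pos (- t)). split; [|nra].
        apply Ropp_le_contravar.
        apply Rle_trans with (Rpower (1 + t) x * exp (- t)).
        * apply Rmult_le_compat_r; [lra|]. apply Rle_Rpower_l; lra.
        * rewrite Rpower_plus, Rpower_1 in hb by lra.
          apply Rmult_le_reg_r with (1 + t); [lra|]. replace (M * / (1 + t) * (1 + t)) with M by (field; lra). lra.
      + replace (Finite 0) with (Rbar_opp (Finite 0)) by (simpl; f_equal; ring).
        apply is_lim_opp. replace (Finite 0) with (Rbar_mult M 0) by (simpl; f_equal; ring).
        apply is_lim_scal_l. apply (is_lim_inv (fun t => 1 + t) p_infty p_infty); [|discriminate].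
        apply (is_lim_plus (fun _ => 1) (fun t => t) p_infty 1 p_infty p_infty);
          [apply is_lim_const|apply is_lim_id|reflexivity].
      + apply is_lim_const. }
  assert (h2 : is_RInt_gen (Derive g) (at_right 0) (Rbar_locally p_infty) (Gamma (x + 1) - x * Gamma x)).
  { apply (is_RInt_gen_ext (V := R_NormedModule) (fun t => minus (gamma_integrand (x + 1) t) (scal x (gamma_integrand x t)))).
    2:{ apply (is_RInt_gen_minus (V := R_NormedModule) (gamma_integrand (x + 1)) (fun t => scal x (gamma_integrand x t)) (Gamma (x + 1)) (scal x (Gamma x))).
        - apply Gamma_correct; lra.
        - apply (is_RInt_gen_scal (V := R_NormedModule) (gamma_integrand x) x (Gamma x)), Gamma_correct; lra. }
    revert hpos. apply filter_imp. intros ab h t ht. symmetry.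
    apply is_derive_unique. apply hd. apply h. lra. }
  pose proof (is_RInt_gen_unique (V := R_CompleteNormedModule) _ _ h1) as e1.
  pose proof (is_RInt_gen_unique (V := R_CompleteNormedModule) _ _ h2) as e2.
  rewrite e1 in e2. lra.
Qed.

(** * Formal cross-product of the Bessel series *)

(** The Euler operator [x d/dx] on coefficients, a derivation for the Cauchy
    product. *)
Definition theta (a : nat -> R) (n : nat) : R := INR n * a n.

Definition alternate (a : nat -> R) (n : nat) : R := (-1) ^ n * a n.

Lemma PS_mult_ext a a' b b' : (forall n, a n = a' n) -> (forall n, b n = b' n) ->
  forall n, PS_mult a b n = PS_mult a' b' n.
Proof. intros h1 h2 n. unfold PS_mult. apply sum_eq. intros. now rewrite h1, h2. Qed.

Lemma PS_mult_comm a b n : PS_mult a b n = PS_mult b a n.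
Proof.
  unfold PS_mult. rewrite <- (sum_f_R0_skip (fun k => b k * a (n - k)%nat)).
  apply sum_eq. intros k hk. replace (n - (n - k))%nat with k by lia. ring.
Qed.

Lemma PS_mult_lin a b c k1 k2 n :
  PS_mult a (fun n => k1 * b n + k2 * c n) n = k1 * PS_mult a b n + k2 * PS_mult a c n.
Proof.
  unfold PS_mult. rewrite !scal_sum, <- plus_sum. apply sum_eq. intros; ring.
Qed.

Lemma theta_PS_mult a b n :
  INR n * PS_mult a b n = PS_mult (theta a) b n + PS_mult a (theta b) n.
Proof.
  unfold PS_mult, theta. rewrite scal_sum, <- plus_sum. apply sum_eq. intros k hk.
  rewrite minus_INR by exact hk. ring.
Qed.

Lemma PS_mult_incr a b n : PS_mult a (PS_incr_1 b) n = PS_incr_1 (PS_mult a b) n.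
Proof.
  destruct n as [|n].
  - unfold PS_mult; simpl. unfold zero; simpl. ring.
  - change (PS_incr_1 (PS_mult a b) (S n)) with (sum_f_R0 (fun k => a k * b (n - k)%nat) n).
    unfold PS_mult. rewrite tech5, Nat.sub_diag. change (PS_incr_1 b 0) with 0.
    rewrite Rmult_0_r, Rplus_0_r. apply sum_eq. intros k hk.
    replace (S n - k)%nat with (S (n - k)) by lia. reflexivity.
Qed.

Lemma sign_sq n : (-1) ^ n * (-1) ^ n = 1.
Proof. rewrite <- Rpow_mult_distr. replace (-1 * -1) with 1 by ring. apply pow1. Qed.

Lemma alternate_PS_mult a b n : (-1) ^ n * PS_mult (alternate a) b n = PS_mult a (alternate b) n.
Proof.
  unfold PS_mult, alternate. rewrite scal_sum. apply sum_eq. intros k hk.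
  replace n with (k + (n - k))%nat at 2 by lia. rewrite pow_add.
  transitivity (((-1) ^ k * (-1) ^ k) * (a k * ((-1) ^ (n - k) * b (n - k)%nat))); [ring|].
  rewrite sign_sq. ring.
Qed.

Section CrossProduct.
Variable nu : R.
Hypothesis hnu : -1 < nu.

(** [J_nu z] is a constant times [z ^ nu] times this series at [z ^ 2].  With [A]
    for it and [B] for the series of [I_nu], [P] is the series of the product, and
    [Y = B theta A - A theta B] is up to a factor that of the cross-product. *)
Fixpoint bessel_coef (n : nat) : R :=
  match n with
  | O => 1
  | S k => - bessel_coef k / (4 * INR (S k) * (INR (S k) + nu))
  end.

Let A := bessel_coef.
Let B := alternate bessel_coef.
Let P := PS_mult A B.
Let Y n := PS_mult B (theta A) n - PS_mult A (theta B) n.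

Lemma INR_S_nu n : 0 < INR (S n) + nu.
Proof. rewrite S_INR. pose proof (pos_INR n). lra. Qed.

Lemma theta2_A n : theta (theta A) n = - nu * theta A n + (- (1 / 4)) * PS_incr_1 A n.
Proof.
  unfold theta, A. destruct n as [|n].
  - simpl. unfold zero; simpl. ring.
  - simpl PS_incr_1. cbn [bessel_coef].
    pose proof (INR_S_nu n). pose proof (INR_S_pos n). field. lra.
Qed.

Lemma theta2_B n : theta (theta B) n = - nu * theta B n + (1 / 4) * PS_incr_1 B n.
Proof.
  pose proof (theta2_A n) as h. unfold B, theta, alternate in *. destruct n as [|n].
  - simpl. unfold zero; simpl. ring.
  - simpl PS_incr_1 in *. unfold A in h.
    transitivity ((-1) ^ S n * (INR (S n) * (INR (S n) * bessel_coef (S n)))); [ring|].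
    rewrite h. simpl pow. ring.
Qed.

(** The equations for [A] and [B] give [(theta + nu) Y = - x P / 2]. *)
Lemma cross_recurrence n : (INR n + nu) * Y n = - (1 / 2) * PS_incr_1 P n.
Proof.
  unfold Y. rewrite Rmult_plus_distr_r, Rmult_minus_distr_l, !theta_PS_mult.
  rewrite (PS_mult_ext B B _ _ (fun _ => eq_refl) theta2_A).
  rewrite (PS_mult_ext A A _ _ (fun _ => eq_refl) theta2_B).
  rewrite !PS_mult_lin, !PS_mult_incr.
  rewrite (PS_mult_comm (theta B) (theta A)).
  replace (PS_incr_1 (PS_mult B A) n) with (PS_incr_1 P n).
  - unfold P. field.
  - destruct n; [reflexivity|]. simpl. apply PS_mult_comm.
Qed.

(** With [U = theta A * theta B] one has [(theta^2 + nu theta) P = 2 U] and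
    [(theta + 2 nu) U = x Y / 4]. *)
Lemma product_recurrence n : INR n * (INR n + nu) * (INR n + 2 * nu) * P n = 1 / 2 * PS_incr_1 Y n.
Proof.
  set (U := PS_mult (theta A) (theta B) n).
  assert (h1 : INR n * P n = PS_mult B (theta A) n + PS_mult A (theta B) n).
  { unfold P. rewrite theta_PS_mult, (PS_mult_comm (theta A) B). reflexivity. }
  assert (h2 : INR n * (INR n * P n) = - nu * (INR n * P n) + 2 * U).
  { rewrite h1, Rmult_plus_distr_l, !theta_PS_mult.
    rewrite (PS_mult_ext B B _ _ (fun _ => eq_refl) theta2_A).
    rewrite (PS_mult_ext A A _ _ (fun _ => eq_refl) theta2_B).
    rewrite !PS_mult_lin, !PS_mult_incr.
    rewrite (PS_mult_comm (theta B) (theta A)). fold U.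
    replace (PS_incr_1 (PS_mult B A) n) with (PS_incr_1 (PS_mult A B) n); [ring|].
    destruct n; [reflexivity|]. simpl. apply PS_mult_comm. }
  assert (h3 : INR n * U = - 2 * nu * U + 1 / 4 * PS_incr_1 Y n).
  { unfold U at 1. rewrite theta_PS_mult.
    rewrite (PS_mult_ext (theta A) (theta A) _ _ (fun _ => eq_refl) theta2_B).
    rewrite (PS_mult_comm (theta (theta A))).
    rewrite (PS_mult_ext (theta B) (theta B) _ _ (fun _ => eq_refl) theta2_A).
    rewrite !PS_mult_lin, !PS_mult_incr, (PS_mult_comm (theta B) (theta A)). fold U.
    replace (PS_incr_1 Y n) with (PS_incr_1 (PS_mult (theta A) B) n - PS_incr_1 (PS_mult (theta B) A) n); [field|].
    destruct n; simpl; [unfold zero; simpl; ring|].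
    unfold Y. now rewrite (PS_mult_comm B), (PS_mult_comm A). }
  replace (INR n * (INR n + nu) * (INR n + 2 * nu) * P n) with
    ((INR n + 2 * nu) * (INR n * (INR n * P n) + nu * (INR n * P n))) by ring.
  rewrite h2.
  replace ((INR n + 2 * nu) * (- nu * (INR n * P n) + 2 * U + nu * (INR n * P n)))
    with (2 * (INR n * U) + 4 * nu * U) by ring.
  rewrite h3. field.
Qed.

(** Replacing [x] by [- x] exchanges [A] and [B]. *)
Lemma cross_parity n : (-1) ^ n * Y n = - Y n.
Proof.
  unfold Y.
  assert (h1 : (-1) ^ n * PS_mult B (theta A) n = PS_mult A (theta B) n).
  { unfold B. rewrite alternate_PS_mult. apply PS_mult_ext; [reflexivity|]. intro k. unfold theta, B, A, alternate. ring. }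
  assert (h2 : (-1) ^ n * PS_mult A (theta B) n = PS_mult B (theta A) n).
  { rewrite <- h1, <- Rmult_assoc, sign_sq. ring. }
  rewrite Rmult_minus_distr_l, h1, h2. ring.
Qed.

Lemma cross_even n : Y (2 * n) = 0.
Proof. pose proof (cross_parity (2 * n)) as h. rewrite pow_1_even in h. lra. Qed.

Definition cross_coef : nat -> R := hyp_coef (nu + 1) (nu / 2 + 1) ((nu + 3) / 2).

(** The factor [2 n + 2 + 2 nu] divided by here is positive; at odd indices the
    corresponding factor of [product_recurrence] can vanish (for [nu = - 1 / 2]),
    and there parity takes over. *)
Lemma cross_odd n : Y (2 * n + 1) = - / (2 * (nu + 1)) * cross_coef n.
Proof.
  induction n as [|n IH].
  - pose proof (cross_recurrence 1) as h. simpl in h. 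
    assert (hP : P 0%nat = 1) by (unfold P, PS_mult, A, B, alternate; simpl; ring).
    rewrite hP in h. simpl. unfold cross_coef; simpl.
    apply (Rmult_eq_reg_l (1 + nu)); [|lra]. rewrite h. field. lra.
  - pose proof (cross_recurrence (2 * S n + 1)) as h1.
    pose proof (product_recurrence (2 * S n)) as h2.
    replace (PS_incr_1 P (2 * S n + 1)) with (P (2 * S n)%nat) in h1.
    2:{ replace (2 * S n + 1)%nat with (S (2 * S n)) by lia. reflexivity. }
    replace (PS_incr_1 Y (2 * S n)) with (Y (2 * n + 1)%nat) in h2.
    2:{ replace (2 * S n)%nat with (S (2 * n + 1)) by lia. reflexivity. }
    rewrite IH in h2. clear IH.
    assert (hn : INR (2 * S n) = 2 * (INR n + 1)) by (rewrite mult_INR, (S_INR n); simpl; ring).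
    rewrite plus_INR, hn in h1. rewrite hn in h2. change (INR 1) with 1 in h1.
    pose proof (pos_INR n) as hn0.
    change (cross_coef (S n)) with (- cross_coef n * hyp_ratio (nu + 1) (nu / 2 + 1) ((nu + 3) / 2) n).
    unfold hyp_ratio. rewrite S_INR.
    set (c := cross_coef n) in *. set (m := INR n) in *.
    assert (eP : P (2 * S n)%nat = 1 / 2 * (- / (2 * (nu + 1)) * c) / (2 * (m + 1) * (2 * (m + 1) + nu) * (2 * (m + 1) + 2 * nu))).
    { rewrite <- h2. field. repeat split; lra. }
    rewrite eP in h1.
    apply (Rmult_eq_reg_l (2 * (m + 1) + 1 + nu)); [|lra]. rewrite h1.
    field. repeat split; lra.
Qed.

End CrossProduct.

(** * The cross-product of Bessel functions *)

Definition entire (a : nat -> R) : Prop := forall r, 0 <= r -> abs_conv a r.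

Lemma entire_radius a : CV_radius a = p_infty -> entire a.
Proof. intros h r hr. apply abs_conv_radius; [exact hr|]. rewrite h. exact I. Qed.

(** As [n <= 2 ^ n], the series at radius [2 r] dominates. *)
Lemma entire_theta a : entire a -> entire (theta a).
Proof.
  intros h r hr. 
  apply (ex_series_dominated _ (fun n => Rabs (a n) * (2 * r) ^ n)).
  - intro n. assert (h0 : 0 <= r ^ n) by now apply pow_le.
    unfold theta. rewrite Rabs_mult, Rabs_Rabsolu, Rabs_mult, (Rabs_pos_eq (r ^ n)), (Rabs_pos_eq (INR n)) by (assumption || apply pos_INR).
    rewrite Rpow_mult_distr.
    replace (INR n * Rabs (a n) * r ^ n) with (Rabs (a n) * (INR n * r ^ n)) by ring.
    apply Rmult_le_compat_l; [apply Rabs_pos|]. apply Rmult_le_compat_r; [exact h0|].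
    clear. induction n as [|n IH]; [simpl; lra|]. rewrite S_INR. simpl.
    assert (1 <= 2 ^ n) by (apply pow_R1_Rle; lra). lra.
  - apply h. lra.
Qed.

Lemma entire_alternate a : entire a -> entire (alternate a).
Proof.
  intros h r hr. specialize (h r hr). revert h. apply ex_series_ext. intro n.
  unfold alternate. now rewrite Rabs_mult, pow_1_abs, Rmult_1_l.
Qed.

Lemma CPS_theta a w : entire a -> CPS (theta a) w = (w * CPS (PS_derive a) w)%C.
Proof.
  intro h. pose proof (Cmod_ge_0 w).
  assert (hd : abs_conv (PS_derive a) (Cmod w)) by (apply abs_conv_derive with (Cmod w + 1); [lra|apply h; lra]).
  rewrite <- (CPS_incr_1 _ w _ hd (Rle_refl _)). apply CPS_ext. intros [|n]; unfold theta, PS_derive; simpl; unfold zero; simpl; ring.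
Qed.

Lemma entire_derive a w : entire a -> Cis_derive (CPS a) w (CPS (PS_derive a) w).
Proof.
  intro h. pose proof (Cmod_ge_0 w). apply Cis_derive_CPS with (Cmod w + 1); [apply h|]; lra.
Qed.

Lemma hderiv_CPS_sq a (z : C) : entire a -> z <> 0%C ->
  hderiv (fun w => CPS a (w * w)%C) z (2 * CPS (theta a) (z * z) / z)%C.
Proof.
  intros h hz. apply hderiv_of_Cis_derive.
  eapply Cis_derive_eq.
  - apply (Cis_derive_comp (CPS a) (fun w => w * w)%C).
    + now apply entire_derive.
    + apply Cis_derive_mult; apply Cis_derive_id.
  - rewrite CPS_theta by exact h. field. exact hz.
Qed.

Section Bessel.
Variable nu : R.
Hypothesis hnu : -1 < nu.

Lemma bessel_coef_neq0 n : bessel_coef nu n <> 0.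
Proof.
  induction n as [|n IH]; [simpl; lra|]. cbn [bessel_coef].
  pose proof (INR_S_nu nu hnu n). pose proof (INR_S_pos n).
  unfold Rdiv. apply Rmult_integral_contrapositive_currified; [lra|].
  apply Rinv_neq_0_compat. apply Rgt_not_eq. repeat apply Rmult_lt_0_compat; lra.
Qed.

Lemma bessel_entire : entire (bessel_coef nu).
Proof.
  apply entire_radius, CV_radius_infinite_DAlembert; [apply bessel_coef_neq0|].
  apply is_lim_seq_le_le with (fun _ => 0) (fun n => / (4 * (1 + nu)) * / INR (S n)).
  - intro n. pose proof (INR_S_nu nu hnu n). pose proof (INR_S_pos n).
    pose proof (bessel_coef_neq0 n). split; [apply Rabs_pos|].
    cbn [bessel_coef].
    replace (- bessel_coef nu n / (4 * INR (S n) * (INR (S n) + nu)) / bessel_coef nu n)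
      with (- / (4 * INR (S n) * (INR (S n) + nu))) by (field; repeat split; lra).
    rewrite Rabs_Ropp, Rabs_pos_eq.
    + rewrite <- Rinv_mult. apply Rinv_le_contravar; [apply Rmult_lt_0_compat; lra|].
      rewrite S_INR in *. pose proof (pos_INR n). nra.
    + left. apply Rinv_0_lt_compat. repeat apply Rmult_lt_0_compat; lra.
  - apply is_lim_seq_const.
  - apply is_lim_seq_scal_0, is_lim_seq_inv_S.
Qed.

Lemma Gamma_shift n : Gamma (nu + INR n + 1) > 0.
Proof. apply Gamma_pos. pose proof (pos_INR n). lra. Qed.

Lemma bessel_coef_Gamma n :
  (-1) ^ n / (INR (fact n) * Gamma (nu + INR n + 1)) = / Gamma (nu + 1) * 4 ^ n * bessel_coef nu n.
Proof.
  assert (hG : 0 < Gamma (nu + 1)) by (apply Gamma_pos; lra).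
  induction n as [|n IH].
  - simpl. rewrite Rplus_0_r. field. lra.
  - cbn [bessel_coef]. pose proof (INR_S_nu nu hnu n). pose proof (INR_S_pos n).
    pose proof (INR_fact_lt_0 n). pose proof (Gamma_shift n).
    replace (nu + INR (S n) + 1) with ((nu + INR n + 1) + 1) by (rewrite S_INR; ring).
    rewrite Gamma_succ by (rewrite S_INR in *; lra).
    rewrite fact_simpl, mult_INR.
    replace (nu + INR n + 1) with (INR (S n) + nu) in * by (rewrite S_INR; ring).
    transitivity (- / (INR (S n) * (INR (S n) + nu)) * ((-1) ^ n / (INR (fact n) * Gamma (INR (S n) + nu)))).
    + simpl pow. field. repeat split; lra.
    + rewrite IH. simpl pow. field. repeat split; lra.
Qed.

Definition bessel_factor : R := Rpower 2 (- nu) / Gamma (nu + 1).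

Lemma Cpower_bessel (z : C) n : z <> 0%C ->
  (RtoC (4 ^ n) * Cpower (z / 2) (2 * INR n + nu))%C =
  (RtoC (Rpower 2 (- nu)) * Cpower z nu * (z * z) ^ n)%C.
Proof.
  intro hz. rewrite Cpower_half by exact hz.
  replace (2 * INR n) with (INR (2 * n)) by (rewrite mult_INR; reflexivity).
  rewrite Cpower_plus, Cpower_INR by exact hz.
  rewrite Ropp_plus_distr, Rpower_plus, Rpower_Ropp, Rpower_pow by lra.
  rewrite Cpow_mult_r, pow_mult. replace (2 ^ 2) with 4 by ring.
  replace (z ^ 2)%C with (z * z)%C by (simpl; ring).
  assert (4 ^ n <> 0) by (apply pow_nonzero; lra).
  rewrite RtoC_mult, RtoC_inv by assumption. field. now apply RtoC_neq0.
Qed.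

Lemma bessel_series_eq (a b : nat -> R) (z : C) : z <> 0%C -> entire b ->
  (forall n, a n = / Gamma (nu + 1) * 4 ^ n * b n) ->
  CSeries (fun n => RtoC (a n) * Cpower (z / 2) (2 * INR n + nu))%C =
  (RtoC bessel_factor * Cpower z nu * CPS b (z * z))%C.
Proof.
  intros hz hb hab. apply is_Cseries_unique. pose proof (Cmod_ge_0 (z * z)%C).
  eapply is_Cseries_ext; [|apply (is_Cseries_scal (RtoC bessel_factor * Cpower z nu)),
    (CPS_correct _ _ (Cmod (z * z)%C)); [now apply hb|lra]].
  intro n. cbv beta. rewrite hab, !RtoC_mult. unfold bessel_factor, Rdiv. rewrite RtoC_mult.
  transitivity (RtoC (/ Gamma (nu + 1)) * RtoC (b n) * (RtoC (4 ^ n) * Cpower (z / 2) (2 * INR n + nu)))%C; [|ring].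
  rewrite Cpower_bessel by exact hz. ring.
Qed.

Lemma BesselJ_eq (z : C) : z <> 0%C ->
  BesselJ nu z = (RtoC bessel_factor * Cpower z nu * CPS (bessel_coef nu) (z * z))%C.
Proof.
  intro hz. exact (bessel_series_eq _ _ z hz bessel_entire bessel_coef_Gamma).
Qed.

Lemma BesselI_eq (z : C) : z <> 0%C ->
  BesselI nu z = (RtoC bessel_factor * Cpower z nu * CPS (alternate (bessel_coef nu)) (z * z))%C.
Proof.
  intro hz. apply (bessel_series_eq (fun n => 1 / (INR (fact n) * Gamma (nu + INR n + 1))));
  [exact hz|exact (entire_alternate _ bessel_entire)|]. intro n.
  rewrite <- (sign_sq n) at 1. unfold alternate.
  transitivity ((-1) ^ n * ((-1) ^ n / (INR (fact n) * Gamma (nu + INR n + 1)))); [unfold Rdiv; ring|].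
  rewrite bessel_coef_Gamma. ring.
Qed.

Lemma hderiv_power_CPS_sq a (z : C) : entire a -> z <> 0%C ->
  hderiv (fun w => RtoC bessel_factor * Cpower w nu * CPS a (w * w))%C z
   (RtoC bessel_factor * Cpower z nu / z * (RtoC nu * CPS a (z * z) + 2 * CPS (theta a) (z * z)))%C.
Proof.
  intros ha hz.
  eapply hderiv_eq.
  - exact (hderiv_mult _ _ _ _ _ (hderiv_scal (RtoC bessel_factor) _ _ _ (hderiv_Cpower z nu hz)) (hderiv_CPS_sq a z ha hz)).
  - cbv beta. field. exact hz.
Qed.

Definition W (w : C) : C := CPS (cross_coef nu) w.

Lemma cross_entire : entire (cross_coef nu).
Proof. apply entire_radius, hyp_coef_radius; lra. Qed.

Lemma is_series_odd (u : nat -> R) l : is_series u l -> (forall n, u (2 * n)%nat = 0) ->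
  is_series (fun n => u (2 * n + 1)%nat) l.
Proof.
  intros h h0.
  assert (hs : forall n, sum_n u (2 * n + 1) = sum_n (fun n => u (2 * n + 1)%nat) n).
  { induction n as [|n IH].
    - simpl. rewrite sum_Sn, !sum_O. pose proof (h0 0%nat) as e. simpl in e. rewrite e. unfold plus; simpl. ring.
    - replace (2 * S n + 1)%nat with (S (S (2 * n + 1))) by lia.
      rewrite !sum_Sn, IH. replace (S (2 * n + 1)) with (2 * S n)%nat by lia. rewrite h0.
      replace (S (2 * S n)) with (2 * S n + 1)%nat by lia.
      unfold plus; simpl. ring. }
  apply (is_lim_seq_ext (fun n => sum_n u (2 * n + 1)) _ l hs).
  apply (is_lim_seq_subseq (sum_n u) l (fun n => (2 * n + 1)%nat)); [|exact h].
  apply eventually_subseq. intro n. lia.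
Qed.

(** Only odd powers occur in [Y], so its sum is [x] times a series in [x ^ 2]. *)
Lemma cross_product (x : C) :
  let A := bessel_coef nu in let B := alternate A in
  (CPS A x * CPS (theta B) x - CPS (theta A) x * CPS B x)%C =
  (RtoC (/ (2 * (nu + 1))) * x * W (x * x))%C.
Proof.
  intros A B.
  assert (hA : entire A) by exact bessel_entire.
  assert (hB : entire B) by now apply entire_alternate.
  pose proof (Cmod_ge_0 x) as hx.
  pose proof (CPS_mult_correct B (theta A) x (Cmod x) (hB _ hx) (entire_theta _ hA _ hx) (Rle_refl _)) as h1.
  pose proof (CPS_mult_correct A (theta B) x (Cmod x) (hA _ hx) (entire_theta _ hB _ hx) (Rle_refl _)) as h2.
  pose proof (is_Cseries_plus _ _ _ _ h1 (is_Cseries_scal (RtoC (-1)) _ _ h2)) as h3.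
  set (Y := fun n => PS_mult B (theta A) n - PS_mult A (theta B) n).
  assert (h4 : is_Cseries (fun n => RtoC (Y n) * x ^ n)%C (CPS B x * CPS (theta A) x + RtoC (-1) * (CPS A x * CPS (theta B) x))%C).
  { eapply is_Cseries_ext; [|exact h3]. intro n. unfold Y. simpl. rewrite RtoC_minus. ring. }
  assert (h5 : is_Cseries (fun n => RtoC (Y (2 * n + 1)%nat) * x ^ (2 * n + 1))%C (CPS B x * CPS (theta A) x + RtoC (-1) * (CPS A x * CPS (theta B) x))%C).
  { destruct h4 as [ha hb]. split.
    - apply (is_series_odd (fun n => Re (RtoC (Y n) * x ^ n)%C) _ ha).
      intro n. rewrite Re_term. unfold Y, B, A. rewrite cross_even. ring.
    - apply (is_series_odd (fun n => Im (RtoC (Y n) * x ^ n)%C) _ hb).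
      intro n. rewrite Im_term. unfold Y, B, A. rewrite cross_even. ring. }
  assert (h6 : is_Cseries (fun n => RtoC (Y (2 * n + 1)%nat) * x ^ (2 * n + 1))%C (RtoC (- / (2 * (nu + 1))) * x * W (x * x))%C).
  { pose proof (Cmod_ge_0 (x * x)%C).
    eapply is_Cseries_ext; [|apply is_Cseries_scal, (CPS_correct _ _ (Cmod (x * x)%C)); [now apply cross_entire|lra]].
    intro n. unfold Y, B, A. rewrite cross_odd by exact hnu.
    rewrite Cpow_add_r, Cpow_mult_r. replace (x ^ 2)%C with (x * x)%C by (simpl; ring).
    rewrite RtoC_mult. simpl. ring. }
  apply is_Cseries_unique in h5. apply is_Cseries_unique in h6. rewrite h5 in h6.
  replace (RtoC (/ (2 * (nu + 1))) * x * W (x * x))%C with (- (RtoC (- / (2 * (nu + 1))) * x * W (x * x)))%C.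
  - rewrite <- h6. ring.
  - rewrite RtoC_opp. ring.
Qed.

Lemma normalizing_const_pos : 0 < normalizing_const nu.
Proof.
  unfold normalizing_const. repeat apply Rmult_lt_0_compat; try (apply Gamma_pos; lra).
  apply Rpower_pos.
Qed.

Lemma Phi_eq (z : C) : z <> 0%C ->
  Phi nu z = (RtoC (/ normalizing_const nu) * (Cpower z (2 * nu) * (z * W (z ^ 4))))%C.
Proof.
  intro hz.
  set (A := bessel_coef nu). set (B := alternate A).
  assert (hA : entire A) by exact bessel_entire.
  assert (hB : entire B) by now apply entire_alternate.
  assert (eJ : C_derive (BesselJ nu) z = (RtoC bessel_factor * Cpower z nu / z * (RtoC nu * CPS A (z * z) + 2 * CPS (theta A) (z * z)))%C).
  { apply hderiv_unique. apply hderiv_ext_nz with (2 := fun w hw => eq_sym (BesselJ_eq w hw)); [exact hz|].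
    now apply hderiv_power_CPS_sq. }
  assert (eI : C_derive (BesselI nu) z = (RtoC bessel_factor * Cpower z nu / z * (RtoC nu * CPS B (z * z) + 2 * CPS (theta B) (z * z)))%C).
  { apply hderiv_unique. apply hderiv_ext_nz with (2 := fun w hw => eq_sym (BesselI_eq w hw)); [exact hz|].
    now apply hderiv_power_CPS_sq. }
  unfold Phi. rewrite eJ, eI, BesselJ_eq, BesselI_eq by exact hz. fold A. fold B.
  pose proof (cross_product (z * z)%C) as hc. cbv zeta in hc. fold A in hc. fold B in hc.
  replace (2 * nu) with (nu + nu) by ring. rewrite Cpower_plus by exact hz.
  replace (z ^ 4)%C with (z * z * (z * z))%C by (simpl; ring).
  transitivity (RtoC bessel_factor * RtoC bessel_factor * (Cpower z nu * Cpower z nu) / z * 2 *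
    (CPS A (z * z) * CPS (theta B) (z * z) - CPS (theta A) (z * z) * CPS B (z * z)))%C.
  { field. exact hz. }
  rewrite hc.
  assert (e : / normalizing_const nu = bessel_factor * bessel_factor * 2 * / (2 * (nu + 1))).
  { unfold normalizing_const, bessel_factor.
    replace (Gamma (nu + 2)) with ((nu + 1) * Gamma (nu + 1)).
    2:{ replace (nu + 2) with ((nu + 1) + 1) by ring. symmetry. apply Gamma_succ. lra. }
    assert (0 < Gamma (nu + 1)) by (apply Gamma_pos; lra).
    replace (2 * nu) with (nu + nu) by ring.
    rewrite Rpower_plus, Rpower_Ropp.
    pose proof (Rpower_pos 2 nu).
    field. repeat split; lra. }
  rewrite e, !RtoC_mult. field. exact hz.
Qed.

Lemma hderiv_Phi (z : C) : z <> 0%C ->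
  hderiv (Phi nu) z (RtoC (/ normalizing_const nu) * Cpower z (2 * nu) *
    (RtoC (2 * nu + 1) * W (z ^ 4) + 4 * CPS (theta (cross_coef nu)) (z ^ 4)))%C.
Proof.
  intro hz. apply hderiv_ext_nz with (2 := fun w hw => eq_sym (Phi_eq w hw)); [exact hz|].
  assert (hW : hderiv (fun w => W (w ^ 4)%C) z (RtoC (INR 4) * z ^ 3 * CPS (PS_derive (cross_coef nu)) (z ^ 4))%C).
  { apply hderiv_of_Cis_derive. apply (Cis_derive_comp W (fun w => w ^ 4)%C).
    - apply entire_derive, cross_entire.
    - apply (Cis_derive_pow 3). }
  eapply hderiv_eq.
  - exact (hderiv_scal (RtoC (/ normalizing_const nu)) _ _ _
      (hderiv_mult _ _ _ _ _ (hderiv_Cpower z (2 * nu) hz) (hderiv_mult _ _ _ _ _ (hderiv_id z) hW))).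
  - cbv beta. rewrite CPS_theta by exact cross_entire. rewrite RtoC_plus.
    replace (INR 4) with 4 by (simpl; ring). field. exact hz.
Qed.

Lemma C_derive_Phi (z : C) : z <> 0%C ->
  (z * C_derive (Phi nu) z)%C = (RtoC (/ normalizing_const nu) * Cpower z (2 * nu) * z *
    (RtoC (2 * nu + 1) * W (z ^ 4) + 4 * CPS (theta (cross_coef nu)) (z ^ 4)))%C.
Proof. intro hz. rewrite (hderiv_unique _ _ _ (hderiv_Phi z hz)). ring. Qed.

End Bessel.

(** * First zeros and a single pole *)

Lemma continuity_pt_pos_near (g : R -> R) x : continuity_pt g x -> 0 < g x ->
  exists d, 0 < d /\ forall y, Rabs (y - x) < d -> 0 < g y.
Proof.
  intros hc hx. destruct (hc (g x) hx) as [d [hd hd']]. exists d. split; [exact hd|].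
  intros y hy. destruct (Req_dec y x) as [->|hne]; [exact hx|].
  assert (h : Rabs (g y - g x) < g x).
  { apply hd'. split; [split; [exact I|auto]|exact hy]. }
  apply Rabs_lt_between in h. lra.
Qed.

Lemma first_zero (g : R -> R) (x1 : R) : (forall x, continuity_pt g x) ->
  0 < g 0 -> 0 < x1 -> g x1 <= 0 ->
  exists x0, 0 < x0 <= x1 /\ g x0 = 0 /\ forall x, 0 <= x < x0 -> 0 < g x.
Proof.
  intros hc h0 hx1 h1.
  set (E := fun x => 0 <= x <= x1 /\ forall y, 0 <= y <= x -> 0 < g y).
  destruct (completeness E) as [s [hu hl]].
  { exists x1. intros x [hx _]. lra. }
  { exists 0. split; [lra|]. intros y hy. now replace y with 0 by lra. }
  assert (hpos : forall x, 0 <= x < s -> 0 < g x).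
  { intros x hx. assert (hn : ~ is_upper_bound E x) by (intro hb; specialize (hl x hb); lra).
    apply Classical_Prop.NNPP. intro hng. apply hn. intros y [hy1 hy2].
    apply Rnot_lt_le. intro hlt. apply hng, hy2. lra. }
  assert (hs1 : s <= x1) by (apply hl; intros x [hx _]; lra).
  (* positivity at a point of [0, x1) extends to the right of it *)
  assert (hext : forall x, 0 <= x < x1 -> (forall y, 0 <= y <= x -> 0 < g y) -> x < s).
  { intros x hx hy. destruct (continuity_pt_pos_near g x (hc x) (hy x ltac:(lra))) as [d [hd hd']].
    set (e := Rmin (d / 2) (x1 - x)).
    assert (0 < e) by (apply Rmin_pos; lra).
    assert (e <= d / 2) by apply Rmin_l. assert (e <= x1 - x) by apply Rmin_r.
    apply Rlt_le_trans with (x + e); [lra|]. apply hu. split; [lra|]. intros y hy'.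
    destruct (Rle_lt_dec y x) as [h|h]; [apply hy; lra|]. apply hd'. rewrite Rabs_pos_eq; lra. }
  assert (hs0 : 0 < s) by (apply hext; [lra|]; intros y hy; now replace y with 0 by lra).
  assert (hle : g s <= 0).
  { apply Rnot_lt_le. intro hgs. destruct (Req_dec s x1) as [e|hne]; [rewrite e in hgs; lra|].
    assert (s < s); [|lra]. apply hext; [lra|]. intros y hy.
    destruct (Req_dec y s) as [->|]; [exact hgs|apply hpos; lra]. }
  assert (hge : 0 <= g s).
  { apply Rnot_lt_le. intro hgs.
    destruct (continuity_pt_pos_near (fun x => - g x) s) as [d [hd hd']].
    { apply continuity_pt_opp, hc. }
    { lra. }
    assert (0 < Rmin (d / 2) s) by (apply Rmin_pos; lra).
    pose proof (Rmin_l (d / 2) s). pose proof (Rmin_r (d / 2) s).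
    pose proof (hpos (s - Rmin (d / 2) s) ltac:(lra)).
    pose proof (hd' (s - Rmin (d / 2) s)) as h2. cbv beta in h2.
    replace (s - Rmin (d / 2) s - s) with (- Rmin (d / 2) s) in h2 by ring.
    rewrite Rabs_Ropp, Rabs_pos_eq in h2 by lra. specialize (h2 ltac:(lra)). lra. }
  exists s. repeat split; try lra. exact hpos.
Qed.

Lemma Series_ge_term (u : nat -> R) k : (forall n, 0 <= u n) -> ex_series u -> u k <= Series u.
Proof.
  intros h hu. rewrite (Series_incr_n u (S k)) by (try lia; exact hu). simpl pred.
  assert (0 <= Series (fun n => u (S k + n)%nat)).
  { apply Series_nonneg; [intro; apply h|]. now apply (ex_series_incr_n u (S k)). }
  assert (u k <= sum_f_R0 u k).
  { destruct k as [|k]; simpl; [lra|]. pose proof (cond_pos_sum u k h). lra. }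
  lra.
Qed.

(** On the circle [|u| = s < 1] the real part of [u / (1 - u)] is smallest at
    [u = - s]: the difference is [(Re u + s) (1 - s) / (|1 - u|^2 (1 + s))]. *)
Lemma half_plane_kernel (u : C) : Cmod u < 1 ->
  - (Cmod u / (1 + Cmod u)) <= Re (u / (1 - u))%C.
Proof.
  intro h. pose proof (Cmod_ge_0 u) as h0. pose proof (Cmod_sq u) as h2.
  pose proof (re_le_Cmod u) as hre. apply Rabs_le_between in hre.
  assert (hD : 0 < 1 - 2 * Re u + Cmod u ^ 2) by nra.
  assert (e : Re (u / (1 - u))%C = (Re u - Cmod u ^ 2) / (1 - 2 * Re u + Cmod u ^ 2)).
  { rewrite h2 in *. destruct u as [x y]. unfold Re, Im in *; simpl fst in *; simpl snd in *.
    assert (e : (1 + - x) * (1 + - x) + (0 + - y) * (0 + - y) = 1 - 2 * x + (x ^ 2 + y ^ 2)) by ring.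
    simpl. field. simpl in hD. nra. }
  rewrite e. set (s := Cmod u) in *. set (x := Re u) in *.
  assert (0 <= (x - s ^ 2) / (1 - 2 * x + s ^ 2) + s / (1 + s)); [|lra].
  replace ((x - s ^ 2) / (1 - 2 * x + s ^ 2) + s / (1 + s)) with
   ((x + s) * (1 - s) / ((1 - 2 * x + s ^ 2) * (1 + s))) by (field; split; lra).
  apply Rcomplements.Rdiv_le_0_compat; [apply Rmult_le_pos; lra|apply Rmult_lt_0_compat; lra].
Qed.

Lemma Cone_minus_neq0 (u : C) : u <> 1%C -> (1 - u)%C <> 0%C.
Proof. intros hu e. apply hu. replace u with (1 - (1 - u))%C by ring. rewrite e. ring. Qed.

Lemma sum_geom_re (u : C) N : u <> 1%C ->
  sum_f_R0 (fun k => Re (u ^ S k)%C) N = Re ((u - u ^ (S (S N))) / (1 - u))%C.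
Proof.
  intro hu.
  pose proof (Cone_minus_neq0 u hu) as h.
  induction N as [|N IH].
  - change (Re (u ^ 1)%C = Re ((u - u ^ 2) / (1 - u))%C). f_equal.
    rewrite Cpow_1_r, Cpow_S, Cpow_1_r. field. exact h.
  - rewrite tech5, IH. change (Re ((u - u ^ S (S N)) / (1 - u) + u ^ (S (S N)))%C = Re ((u - u ^ S (S (S N))) / (1 - u))%C).
    f_equal. rewrite (Cpow_S u (S (S N))). field. exact h.
Qed.

(** [half_plane_kernel] for [u = t w], cut off after [N] terms.  Partial sums
    involve finitely many power sums, which is what survives the limit in
    [limit_of_roots]. *)
Lemma pole_partial_sum (t sigma rate : R) (w : C) N : 0 < t -> Cmod w = sigma -> 0 <= rate < 1 -> t * sigma <= rate ->
  - (2 * t * sigma * rate ^ S N / (1 - rate)) <=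
  sum_f_R0 (fun k => t ^ S k * (Re (w ^ S k)%C - (- sigma) ^ S k)) N.
Proof.
  intros ht hw hth hts.
  pose proof (Cmod_ge_0 w) as hs0. rewrite hw in hs0.
  set (u := (RtoC t * w)%C). set (v := RtoC (- (t * sigma))).
  assert (hu : Cmod u = t * sigma) by (unfold u; rewrite Cmod_mult, Cmod_R, Rabs_pos_eq, hw; lra).
  assert (hv : Cmod v = t * sigma) by (unfold v; rewrite Cmod_R, Rabs_Ropp, Rabs_pos_eq; [lra|apply Rmult_le_pos; lra]).
  set (s := t * sigma) in *.
  assert (hs : 0 <= s) by (unfold s; apply Rmult_le_pos; lra).
  assert (hne : forall x : C, Cmod x = s -> x <> 1%C).
  { intros x hx e. rewrite e, Cmod_1 in hx. lra. }
  rewrite (sum_eq _ (fun k => Re (u ^ S k)%C - Re (v ^ S k)%C)).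
  2:{ intros k _. unfold u, v. rewrite Cpow_mult_l, <- !RtoC_pow.
      replace (- s) with (t * - sigma) by (unfold s; ring).
      rewrite Rpow_mult_distr. generalize (w ^ S k)%C. intro x. unfold Re, Im; simpl fst. simpl. ring. }
  rewrite minus_sum, !sum_geom_re by (apply hne; assumption).
  assert (tail : forall x : C, Cmod x = s -> Cmod (x ^ S (S N) / (1 - x))%C <= s * rate ^ S N / (1 - rate)).
  { intros x hx.
    pose proof (Cone_minus_neq0 x (hne x hx)) as hx1.
    rewrite Cmod_div, Cmod_pow, hx by exact hx1.
    assert (h1 : 1 - rate <= Cmod (1 - x)%C).
    { assert (Cmod 1 <= Cmod (1 - x)%C + Cmod x).
      { replace (RtoC 1) with ((1 - x) + x)%C at 1 by ring. apply Cmod_triangle. }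
      rewrite Cmod_1 in H. lra. }
    apply Rmult_le_compat.
    - apply pow_le; lra.
    - left. apply Rinv_0_lt_compat. lra.
    - change (s ^ S (S N)) with (s * s ^ S N). apply Rmult_le_compat_l; [exact hs|]. apply pow_incr; lra.
    - apply Rinv_le_contravar; lra. }
  assert (split : forall x : C, Cmod x = s -> Re ((x - x ^ S (S N)) / (1 - x))%C = Re (x / (1 - x))%C - Re (x ^ S (S N) / (1 - x))%C).
  { intros x hx. change (Re ((x - x ^ S (S N)) / (1 - x))%C = Re (x / (1 - x) - x ^ S (S N) / (1 - x))%C).
    f_equal. unfold Cdiv. ring. }
  rewrite (split u hu), (split v hv).
  pose proof (half_plane_kernel u ltac:(lra)) as hk. rewrite hu in hk.
  assert (ev : Re (v / (1 - v))%C = - (s / (1 + s))).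
  { unfold v. rewrite <- RtoC_minus. unfold Cdiv. rewrite <- RtoC_inv by lra. rewrite <- RtoC_mult. simpl. field. lra. }
  rewrite ev.
  pose proof (tail u hu) as t1. pose proof (tail v hv) as t2.
  pose proof (re_le_Cmod (u ^ S (S N) / (1 - u))%C) as r1.
  pose proof (re_le_Cmod (v ^ S (S N) / (1 - v))%C) as r2.
  assert (b1 := Rle_trans _ _ _ r1 t1). assert (b2 := Rle_trans _ _ _ r2 t2).
  apply Rabs_le_between in b1. apply Rabs_le_between in b2.
  replace (2 * t * sigma * rate ^ S N / (1 - rate)) with (2 * (s * rate ^ S N / (1 - rate))) by (unfold s; field; lra).
  lra.
Qed.

Lemma power_sum_partial ts sigma rate (w : C) N : positive_list ts -> Cmod w = sigma -> 0 <= rate < 1 ->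
  List.Forall (fun t => t * sigma <= rate) ts ->
  - (2 * power_sum ts 0 * sigma * rate ^ S N / (1 - rate)) <=
  sum_f_R0 (fun k => power_sum ts k * (Re (w ^ S k)%C - (- sigma) ^ S k)) N.
Proof.
  intros hp hw hth. induction hp as [|t ts ht _ IH]; intro hf.
  - cbn [power_sum]. rewrite (sum_eq _ (fun _ => 0)) by (intros; ring). rewrite sum_cte.
    replace (2 * 0 * sigma * rate ^ S N / (1 - rate)) with 0 by (field; lra). lra.
  - inversion hf as [|? ? h1 h2]; subst. specialize (IH h2).
    pose proof (pole_partial_sum t (Cmod w) rate w N ht eq_refl hth h1) as h3.
    cbn [power_sum].
    rewrite (sum_eq _ (fun k => t ^ S k * (Re (w ^ S k)%C - (- Cmod w) ^ S k) + power_sum ts k * (Re (w ^ S k)%C - (- Cmod w) ^ S k))) by (intros; ring).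
    rewrite plus_sum.
    replace (2 * (t ^ 1 + power_sum ts 0) * Cmod w * rate ^ S N / (1 - rate)) with
      (2 * t * Cmod w * rate ^ S N / (1 - rate) + 2 * power_sum ts 0 * Cmod w * rate ^ S N / (1 - rate)) by (field; lra).
    lra.
Qed.

(** * The logarithmic derivative and its extremal values on circles *)

Lemma PSeries_theta a x : entire a -> PSeries (theta a) x = x * PSeries (PS_derive a) x.
Proof.
  intro h. pose proof (CPS_theta a (RtoC x) h) as e. rewrite !CPS_RtoC, <- RtoC_mult in e.
  now injection e.
Qed.

Lemma entire_CV a : entire a -> forall x, Rbar_lt (Rabs x) (CV_radius a).
Proof.
  intros h x. pose proof (Rabs_pos x).
  apply Rbar_lt_le_trans with (Rabs x + 1); [simpl; lra|].
  apply radius_abs_conv; [lra|]. apply h. lra.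
Qed.

Lemma entire_continuity a : entire a -> forall x, continuity_pt (PSeries a) x.
Proof. intros h x. apply PSeries_continuity. now apply entire_CV. Qed.

Lemma entire_ex_series a x : entire a -> ex_series (fun n => a n * x ^ n).
Proof.
  intro h. apply ex_series_Rabs. pose proof (h (Rabs x) (Rabs_pos x)) as hx.
  revert hx. apply ex_series_ext. intro n. now rewrite Rabs_mult, RPow_abs.
Qed.

Lemma PSeries_alternate a x : PSeries a (- x) = PSeries (alternate a) x.
Proof.
  apply Series_ext. intro n. unfold alternate.
  replace (- x) with (-1 * x) by ring. rewrite Rpow_mult_distr. ring.
Qed.

Definition log_ratio (c : nat -> R) (w : C) : C := (CPS (theta c) w / CPS c w)%C.

Section LogDerivative.
Variables c q : nat -> R.
Hypothesis c0 : c 0%nat = 1.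
Hypothesis centire : entire c.
Hypothesis hq : limit_of_roots c q.

Lemma PSeries_c0 : PSeries c 0 = 1.
Proof. rewrite PSeries_0. exact c0. Qed.

Lemma rayleigh_nonneg k : 0 <= q k.
Proof.
  apply le_epsilon. intros eps he.
  destruct (proj2 hq 0 (Rle_refl 0)) with (N := k) (eps := eps) as (ts & h1 & _ & h2); [|exact he|].
  - intros x hx. replace x with 0 by lra. rewrite PSeries_c0. lra.
  - specialize (h2 k (Nat.le_refl k)). apply Rabs_lt_between in h2.
    pose proof (power_sum_pos ts k h1). lra.
Qed.

(** The limit of [power_sum_bound]. *)
Lemma rayleigh_bound rho k : 0 <= rho -> positive_upto c rho -> q k * rho ^ k <= q 0%nat.
Proof.
  intros hr hp. assert (hrk : 0 <= rho ^ k) by now apply pow_le.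
  apply le_epsilon. intros eps he.
  destruct (proj2 hq rho hr hp k (eps / (1 + rho ^ k))) as (ts & h1 & h2 & h3).
  { apply Rdiv_lt_0_compat; lra. }
  set (e := eps / (1 + rho ^ k)) in *.
  assert (he' : e * (1 + rho ^ k) = eps) by (unfold e; field; lra).
  pose proof (power_sum_bound ts rho k h1 hr h2) as h4.
  pose proof (h3 k (Nat.le_refl k)) as h5. pose proof (h3 0%nat (Nat.le_0_l k)) as h6.
  apply Rabs_lt_between in h5. apply Rabs_lt_between in h6. nra.
Qed.

Lemma rayleigh_abs_conv rho r : 0 <= r < rho -> positive_upto c rho -> abs_conv q r.
Proof.
  intros hr hp.
  apply (ex_series_dominated _ (fun n => q 0%nat * (r / rho) ^ n)).
  - intro n. pose proof (rayleigh_nonneg n) as h0. pose proof (rayleigh_bound rho n ltac:(lra) hp) as h1.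
    assert (0 <= r ^ n) by (apply pow_le; lra). assert (0 < rho ^ n) by (apply pow_lt; lra).
    rewrite Rabs_pos_eq by (apply Rmult_le_pos; [apply Rabs_pos|assumption]).
    rewrite (Rabs_pos_eq (q n)) by exact h0.
    unfold Rdiv. rewrite Rpow_mult_distr, pow_inv.
    replace (q n * r ^ n) with ((q n * rho ^ n) * (r ^ n * / rho ^ n)) by (field; lra).
    apply Rmult_le_compat_r; [|exact h1].
    apply Rmult_le_pos; [assumption|]. left. now apply Rinv_0_lt_compat.
  - apply (ex_series_scal_l (q 0%nat) (fun n => (r / rho) ^ n)).
    exists (/ (1 - r / rho)). apply is_series_geom.
    rewrite Rabs_pos_eq by (apply Rcomplements.Rdiv_le_0_compat; lra).
    apply Rcomplements.Rlt_div_l; lra.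
Qed.

Lemma CPS_log_derivative rho (w : C) : Cmod w < rho -> positive_upto c rho ->
  CPS (PS_derive c) w = (- (CPS c w * CPS q w))%C.
Proof.
  intros hw hp. pose proof (Cmod_ge_0 w) as h0.
  assert (hqc : abs_conv q (Cmod w)) by (apply rayleigh_abs_conv with rho; [lra|exact hp]).
  assert (hcc : abs_conv c (Cmod w)) by now apply centire.
  assert (hd : abs_conv (PS_derive c) (Cmod w)) by (apply abs_conv_derive with (Cmod w + 1); [lra|apply centire; lra]).
  rewrite <- (CPS_mult c q w (Cmod w) hcc hqc (Rle_refl _)).
  replace (- CPS (PS_mult c q) w)%C with (- CPS (fun n => (-1 * PS_derive c n)%R) w)%C.
  - rewrite (CPS_scal _ (-1) w (Cmod w) hd (Rle_refl _)). ring.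
  - f_equal. apply CPS_ext. intro k. rewrite (proj1 hq). unfold PS_derive. ring.
Qed.

Definition log_coef (n : nat) : R := match n with O => 0 | S k => - q k / INR (S k) end.

Lemma log_coef_derive n : PS_derive log_coef n = -1 * q n.
Proof. unfold PS_derive, log_coef. field. apply not_0_INR. lia. Qed.

Lemma log_abs_conv rho r : 0 <= r < rho -> positive_upto c rho -> abs_conv log_coef r.
Proof.
  intros hr hp. apply abs_conv_radius; [lra|]. rewrite <- CV_radius_derive.
  rewrite (CV_radius_ext _ (fun n => -1 * q n)) by apply log_coef_derive.
  assert (h : abs_conv (fun n => -1 * q n) ((r + rho) / 2)).
  { generalize (rayleigh_abs_conv rho ((r + rho) / 2) ltac:(lra) hp).
    apply ex_series_ext. intro n. change (Rabs (q n) * ((r + rho) / 2) ^ n = Rabs (-1 * q n) * ((r + rho) / 2) ^ n). rewrite Rabs_mult, (Rabs_left (-1)) by lra. ring. }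
  apply Rbar_lt_le_trans with ((r + rho) / 2); [simpl; lra|].
  apply radius_abs_conv; [lra|exact h].
Qed.

Lemma Cis_derive_log rho (w : C) : Cmod w < rho -> positive_upto c rho ->
  Cis_derive (CPS log_coef) w (- CPS q w)%C.
Proof.
  intros hw hp. pose proof (Cmod_ge_0 w) as h0.
  eapply Cis_derive_eq.
  - apply Cis_derive_CPS with (r := (Cmod w + rho) / 2); [|lra].
    apply log_abs_conv with rho; [lra|exact hp].
  - rewrite (CPS_ext _ (fun n => -1 * q n)) by apply log_coef_derive.
    rewrite (CPS_scal q (-1) w (Cmod w)); [ring| |lra].
    apply rayleigh_abs_conv with rho; [lra|exact hp].
Qed.

Lemma CPS_at_0 a : CPS a 0%C = RtoC (a 0%nat).
Proof. rewrite CPS_RtoC. now rewrite PSeries_0. Qed.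

(** The derivative of [c * exp (- L)] vanishes along the segment from 0 to [w]. *)
Lemma CPS_exp_log rho (w : C) : Cmod w < rho -> positive_upto c rho ->
  CPS c w = Cexp (CPS log_coef w).
Proof.
  intros hw hp.
  set (F := fun s : C => (CPS c (s * w) * Cexp (- 1 * CPS log_coef (s * w)))%C).
  assert (hF : forall s : R, 0 <= s <= 1 -> Cis_derive F (RtoC s) (RtoC 0)).
  { intros s hs.
    assert (hsw : Cmod (RtoC s * w)%C < rho).
    { rewrite Cmod_mult, Cmod_R, Rabs_pos_eq by lra. pose proof (Cmod_ge_0 w). nra. }
    assert (hlin : Cis_derive (fun s => s * w)%C (RtoC s) w).
    { eapply Cis_derive_eq; [exact (Cis_derive_mult _ _ _ _ _ (Cis_derive_id (RtoC s)) (Cis_derive_const w (RtoC s)))|]. cbv beta. ring. }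
    eapply Cis_derive_eq.
    - apply Cis_derive_mult.
      + apply (Cis_derive_comp (CPS c) (fun s => s * w)%C); [now apply entire_derive|exact hlin].
      + apply (Cis_derive_comp Cexp (fun s => - 1 * CPS log_coef (s * w))%C); [apply Cis_derive_Cexp|].
        apply Cis_derive_scal.
        apply (Cis_derive_comp (CPS log_coef) (fun s => s * w)%C); [|exact hlin].
        apply Cis_derive_log with rho; assumption.
    - cbv beta. rewrite (CPS_log_derivative rho) by assumption. ring. }
  assert (h01 : F (RtoC 0) = F (RtoC 1)).
  { apply injective_projections.
    - apply (eq_is_derive (fun s : R => Re (F (RtoC s))) 0 1); [|lra].
      intros s hs. exact (proj1 (hderiv_of_Cis_derive _ _ _ (hF s hs))).
    - apply (eq_is_derive (fun s : R => Im (F (RtoC s))) 0 1); [|lra].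
      intros s hs. exact (proj2 (hderiv_of_Cis_derive _ _ _ (hF s hs))). }
  unfold F in h01.
  replace (RtoC 0 * w)%C with (RtoC 0) in h01 by ring. replace (RtoC 1 * w)%C with w in h01 by ring.
  rewrite !CPS_at_0, c0 in h01. unfold log_coef at 1 in h01.
  replace (- 1 * RtoC 0)%C with (RtoC 0) in h01 by ring. rewrite Cexp_0 in h01.
  replace (CPS c w) with (CPS c w * (Cexp (- 1 * CPS log_coef w) * Cexp (CPS log_coef w)))%C.
  - rewrite Cmult_assoc, <- h01. ring.
  - rewrite <- Cexp_plus. replace (- 1 * CPS log_coef w + CPS log_coef w)%C with (RtoC 0) by ring.
    rewrite Cexp_0. ring.
Qed.

Lemma CPS_nonzero rho (w : C) : Cmod w < rho -> positive_upto c rho -> CPS c w <> 0%C.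
Proof. intros h1 h2. rewrite (CPS_exp_log rho w h1 h2). apply Cexp_nz. Qed.

Lemma CPS_theta_log rho (w : C) : Cmod w < rho -> positive_upto c rho ->
  CPS (theta c) w = (- (w * CPS q w) * CPS c w)%C.
Proof.
  intros h1 h2. rewrite CPS_theta by exact centire. rewrite (CPS_log_derivative rho) by assumption. ring.
Qed.

Lemma log_ratio_eq rho (w : C) : Cmod w < rho -> positive_upto c rho ->
  log_ratio c w = (- (w * CPS q w))%C.
Proof.
  intros h1 h2. unfold log_ratio. rewrite (CPS_theta_log rho) by assumption.
  field. exact (CPS_nonzero rho w h1 h2).
Qed.

Lemma PSeries_theta_log rho x : Rabs x < rho -> positive_upto c rho ->
  PSeries (theta c) x = - (x * PSeries q x) * PSeries c x.
Proof.
  intros h1 h2. pose proof (CPS_theta_log rho (RtoC x)) as h.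
  rewrite Cmod_R in h. specialize (h h1 h2). rewrite !CPS_RtoC in h.
  rewrite <- !RtoC_mult, <- RtoC_opp, <- RtoC_mult in h. now injection h.
Qed.

(** The coefficients of [Q] are nonnegative. *)
Lemma Re_log_derivative_upper rho (w : C) : Cmod w < rho -> positive_upto c rho ->
  Re (w * CPS q w)%C <= Cmod w * PSeries q (Cmod w).
Proof.
  intros hw hp. pose proof (Cmod_ge_0 w) as h0.
  assert (hqc : abs_conv q (Cmod w)) by (apply rayleigh_abs_conv with rho; [lra|exact hp]).
  destruct (is_Cseries_scal w _ _ (CPS_correct q w (Cmod w) hqc (Rle_refl _))) as [h1 _].
  apply is_series_unique in h1. rewrite <- h1.
  unfold PSeries. rewrite <- Series_scal_l.
  assert (hex : ex_series (fun n => Cmod w * (q n * Cmod w ^ n))).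
  { apply (ex_series_scal_l (Cmod w) (fun n => q n * Cmod w ^ n)).
    revert hqc. apply ex_series_ext. intro n. now rewrite Rabs_pos_eq by apply rayleigh_nonneg. }
  eapply Rle_trans; [apply Rle_abs|]. apply Series_dominated; [|exact hex].
  intro n. eapply Rle_trans; [apply re_le_Cmod|].
  rewrite !Cmod_mult, Cmod_R, Cmod_pow, Rabs_pos_eq by apply rayleigh_nonneg. lra.
Qed.

Lemma Re_log_derivative_lower rho (w : C) : Cmod w < rho -> positive_upto c rho ->
  - Cmod w * PSeries q (- Cmod w) <= Re (w * CPS q w)%C.
Proof.
  intros hw hp. pose proof (Cmod_ge_0 w) as h0. set (sigma := Cmod w) in *.
  assert (hqc : abs_conv q sigma) by (apply rayleigh_abs_conv with rho; [lra|exact hp]).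
  set (th := sigma / rho).
  assert (hth : 0 <= th < 1).
  { split; [apply Rcomplements.Rdiv_le_0_compat; lra|apply Rcomplements.Rlt_div_l; lra]. }
  set (D := fun k => Re (w ^ S k)%C - (- sigma) ^ S k).
  assert (hpart : forall N, - (2 * q 0%nat * sigma * th ^ S N / (1 - th)) <= sum_f_R0 (fun k => q k * D k) N).
  { intro N. apply le_epsilon. intros eps he.
    set (K := 2 * sigma * th ^ S N / (1 - th)).
    assert (hK : 0 <= K).
    { apply Rcomplements.Rdiv_le_0_compat; [|lra]. apply Rmult_le_pos; [lra|]. apply pow_le; lra. }
    set (T := sum_f_R0 (fun k => Rabs (D k)) N).
    assert (hT : 0 <= T) by (apply cond_pos_sum; intro; apply Rabs_pos).
    destruct (proj2 hq rho ltac:(lra) hp N (eps / (1 + K + T))) as (ts & h1 & h2 & h3).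
    { apply Rdiv_lt_0_compat; lra. }
    set (e := eps / (1 + K + T)) in *.
    assert (he' : e * (1 + K + T) = eps) by (unfold e; field; lra).
    assert (hf : List.Forall (fun t => t * sigma <= th) ts).
    { revert h2. apply List.Forall_impl. intros t ht. unfold th.
      assert (hr : 0 < rho) by lra. apply (proj1 (Rcomplements.Rle_div_r (t * sigma) sigma rho hr)).
      replace (t * sigma * rho) with (t * rho * sigma) by ring. nra. }
    pose proof (power_sum_partial ts sigma th w N h1 eq_refl hth hf) as h4.
    change (- (2 * power_sum ts 0 * sigma * th ^ S N / (1 - th)) <= sum_f_R0 (fun k => power_sum ts k * D k) N) in h4.
    assert (h5 : sum_f_R0 (fun k => power_sum ts k * D k) N <= sum_f_R0 (fun k => q k * D k) N + e * T).
    { unfold T. rewrite scal_sum, <- plus_sum. apply sum_Rle. intros k hk.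
      specialize (h3 k hk). apply Rabs_lt_between in h3.
      destruct (Rle_lt_dec 0 (D k)).
      - rewrite Rabs_pos_eq by assumption. nra.
      - rewrite Rabs_left by assumption. nra. }
    pose proof (h3 0%nat (Nat.le_0_l N)) as h6. apply Rabs_lt_between in h6.
    replace (2 * power_sum ts 0 * sigma * th ^ S N / (1 - th)) with (K * power_sum ts 0) in h4 by (unfold K; field; lra).
    replace (2 * q 0%nat * sigma * th ^ S N / (1 - th)) with (K * q 0%nat) by (unfold K; field; lra).
    assert (0 < e) by (unfold e; apply Rdiv_lt_0_compat; lra).
    nra. }
  assert (hser : is_series (fun k => q k * D k) (Re (w * CPS q w)%C + sigma * PSeries q (- sigma))).
  { destruct (is_Cseries_scal w _ _ (CPS_correct q w sigma hqc (Rle_refl _))) as [h1 _].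
    assert (h2 : is_series (fun k => sigma * (q k * (- sigma) ^ k)) (sigma * PSeries q (- sigma))).
    { apply (is_series_scal_l sigma (fun k => q k * (- sigma) ^ k)). apply Series_correct.
      apply ex_series_Rabs. revert hqc. apply ex_series_ext. intro n.
      now rewrite Rabs_mult, <- RPow_abs, Rabs_Ropp, (Rabs_pos_eq sigma). }
    eapply is_series_ext; [|exact (is_series_plus _ _ _ _ h1 h2)].
    intro n. change (Re (w * (RtoC (q n) * w ^ n))%C + sigma * (q n * (- sigma) ^ n) = q n * D n).
    unfold D. rewrite Cpow_S. generalize (w ^ n)%C. intro x. unfold Re; simpl. ring. }
  assert (hlim : is_lim_seq (fun N => - (2 * q 0%nat * sigma * th ^ S N / (1 - th))) 0).
  { apply is_lim_seq_ext with (fun N => (- (2 * q 0%nat * sigma * th / (1 - th))) * th ^ N).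
    - intro N. simpl. field. lra.
    - apply is_lim_seq_scal_0, is_lim_seq_geom. rewrite Rabs_pos_eq; lra. }
  assert (hle : Rbar_le 0 (Re (w * CPS q w)%C + sigma * PSeries q (- sigma))).
  { apply (is_lim_seq_le _ (sum_n (fun k => q k * D k)) _ _) with (2 := hlim) (3 := hser).
    intro N. rewrite sum_n_Reals. apply hpart. }
  change (0 <= Re (w * CPS q w)%C + sigma * PSeries q (- sigma)) in hle. lra.
Qed.

Hypothesis q0 : 0 < q 0%nat.

Lemma positive_extend rho : 0 <= rho -> positive_upto c rho ->
  exists rho', rho < rho' /\ positive_upto c rho'.
Proof.
  intros hr hp. pose proof (hp rho ltac:(lra)) as h.
  destruct (continuity_pt_pos_near _ rho (entire_continuity c centire rho) h) as [d [hd hd']].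
  exists (rho + d / 2). split; [lra|]. intros x hx.
  destruct (Rle_lt_dec x rho) as [h1|h1]; [apply hp; lra|]. apply hd'. rewrite Rabs_pos_eq; lra.
Qed.

Lemma positive_of_nonzero rho : 0 <= rho ->
  (forall x, 0 <= x <= rho -> PSeries c x <> 0) -> positive_upto c rho.
Proof.
  intros hr h x hx. apply Rnot_le_lt. intro hle.
  assert (h0 : PSeries c 0 = 1) by exact PSeries_c0.
  destruct (first_zero (PSeries c) x) as (y & hy1 & hy2 & _); try assumption.
  - now apply entire_continuity.
  - lra.
  - destruct (Req_dec x 0) as [->|]; lra.
  - apply (h y); [lra|exact hy2].
Qed.

(** It has the sign of [beta + x c' / c] as long as [c] is positive. *)
Definition euler_poly (beta x : R) : R := beta * PSeries c x + PSeries (theta c) x.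

Lemma euler_poly_continuity beta x : continuity_pt (euler_poly beta) x.
Proof.
  apply continuity_pt_plus.
  - apply continuity_pt_scal. now apply entire_continuity.
  - apply entire_continuity. now apply entire_theta.
Qed.

Lemma PSeries_theta_0 : PSeries (theta c) 0 = 0.
Proof. rewrite PSeries_0. unfold theta. simpl. ring. Qed.

(** [x ^ beta * c] has derivative [x ^ (beta - 1) * (beta c + x c')], so it
    increases from 0 on. *)
Lemma positive_of_euler_poly beta x0 : 0 < x0 ->
  (forall x, 0 < x < x0 -> 0 < euler_poly beta x) -> positive_upto c x0.
Proof.
  intros hx0 h x hx.
  assert (h0 : PSeries c 0 = 1) by exact PSeries_c0.
  destruct (Req_dec x 0) as [->|hne]; [lra|].
  destruct (positive_extend 0 (Rle_refl 0)) as [d [hd hp]].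
  { intros y hy. replace y with 0 by lra. lra. }
  (* the power x ^ beta is not differentiable at 0, so the mean value theorem starts from d > 0 *)
  destruct (Rle_lt_dec x d) as [hxd|hxd]; [apply hp; lra|].
  set (g := fun y => Rpower y beta * PSeries c y).
  destruct (MVT_cor2 g (fun y => Rpower y (beta - 1) * euler_poly beta y) d x hxd) as [y [hy hdy]].
  { intros y hy. apply is_derive_Reals. 
    assert (hD : is_derive (PSeries c) y (PSeries (PS_derive c) y)) by (apply is_derive_PSeries; now apply entire_CV).
    assert (hP : is_derive (fun y => Rpower y beta) y (beta * Rpower y (beta - 1))).
    { apply is_derive_Reals. apply derivable_pt_lim_power. lra. }
    evar_last; [exact (is_derive_mult _ _ _ _ _ hP hD Rmult_comm)|].
    unfold plus, mult; simpl. unfold euler_poly. rewrite PSeries_theta by exact centire.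
    replace (Rpower y beta) with (Rpower y (beta - 1) * y); [ring|].
    rewrite <- (Rpower_1 y) at 2 by lra. rewrite <- Rpower_plus. f_equal. ring. }
  assert (hg : g d < g x).
  { assert (0 < Rpower y (beta - 1) * euler_poly beta y * (x - d)); [|lra].
    apply Rmult_lt_0_compat; [|lra]. apply Rmult_lt_0_compat; [apply Rpower_pos|apply h; lra]. }
  assert (0 < g d) by (apply Rmult_lt_0_compat; [apply Rpower_pos|apply hp; lra]).
  assert (hgx : 0 < g x) by lra. unfold g in hgx.
  apply (Rmult_lt_reg_l (Rpower x beta)); [apply Rpower_pos|]. lra.
Qed.

(** Without a root, [c] would stay positive and [- x c' / c = x Q x >= q_0 x]
    would exceed [beta]. *)
Lemma first_euler_root beta : 0 < beta -> exists x0, 0 < x0 /\ euler_poly beta x0 = 0 /\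
  (forall x, 0 <= x < x0 -> 0 < euler_poly beta x) /\ positive_upto c x0.
Proof.
  intro hb.
  assert (h0 : PSeries c 0 = 1) by exact PSeries_c0.
  assert (hE0 : 0 < euler_poly beta 0).
  { unfold euler_poly. rewrite h0, PSeries_theta_0. lra. }
  (* X is the point where q_0 x reaches beta *)
  set (X := beta / q 0%nat).
  assert (hX : 0 < X) by now apply Rdiv_lt_0_compat.
  assert (hex : exists x, 0 < x /\ euler_poly beta x <= 0).
  { apply Classical_Prop.NNPP. intro hn.
    assert (hpos : forall x, 0 < x -> 0 < euler_poly beta x).
    { intros x hx. apply Rnot_le_lt. intro. apply hn. now exists x. }
    assert (hp : positive_upto c (X + 1)) by (apply (positive_of_euler_poly beta); [lra|intros; apply hpos; lra]).
    specialize (hpos X hX). unfold euler_poly in hpos.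
    rewrite (PSeries_theta_log (X + 1)) in hpos by (try assumption; rewrite Rabs_pos_eq; lra).
    assert (hw : 0 < PSeries c X) by (apply hp; lra).
    assert (hQ : q 0%nat <= PSeries q X).
    { unfold PSeries. replace (q 0%nat) with ((fun n => q n * X ^ n) 0%nat) by (simpl; ring).
      apply (Series_ge_term (fun n => q n * X ^ n) 0).
      - intro n. apply Rmult_le_pos; [now apply rayleigh_nonneg|apply pow_le; lra].
      - pose proof (rayleigh_abs_conv (X + 1) X ltac:(lra) hp) as hh.
        revert hh. apply ex_series_ext. intro n. rewrite Rabs_pos_eq; [reflexivity|now apply rayleigh_nonneg]. }
    assert (hXq : X * q 0%nat = beta) by (unfold X; field; lra).
    assert (beta <= X * PSeries q X) by (rewrite <- hXq; apply Rmult_le_compat_l; lra).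
    nra. }
  destruct hex as [x1 [hx1 hle]].
  destruct (first_zero (euler_poly beta) x1) as (x0 & h1 & h2 & h3); try assumption.
  { apply euler_poly_continuity. }
  exists x0. split; [lra|]. split; [exact h2|]. split; [exact h3|].
  apply (positive_of_euler_poly beta); [lra|]. intros x hx. apply h3. lra.
Qed.

Lemma euler_root_bound beta x0 (w : C) : 0 < x0 ->
  (forall x, 0 <= x < x0 -> 0 < euler_poly beta x) -> positive_upto c x0 -> Cmod w < x0 ->
  - beta < Re (log_ratio c w).
Proof.
  intros hx0 h hp hw.
  pose proof (Cmod_ge_0 w) as hw0. rewrite (log_ratio_eq x0 w hw hp).
  change (- beta < - Re (w * CPS q w)%C).
  pose proof (Re_log_derivative_upper x0 w hw hp) as hu.
  specialize (h (Cmod w) ltac:(lra)). unfold euler_poly in h.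
  rewrite (PSeries_theta_log x0) in h by (try assumption; rewrite Rabs_pos_eq; lra).
  assert (hc : 0 < PSeries c (Cmod w)) by (apply hp; lra).
  assert (Cmod w * PSeries q (Cmod w) < beta) by nra. lra.
Qed.

Section Negative.
Hypothesis alternate_pos : forall n, 0 < alternate c n.
Hypothesis alternate_geom : forall n, alternate c n <= alternate c 1 ^ n.

(** The terms after the first sum up to at most [t / (1 - t) < 1 / 2] in absolute
    value, where [t = |c_1| x]. *)
Lemma positive_of_small x : 0 <= x -> alternate c 1 * x < 1 / 3 -> positive_upto c x.
Proof.
  intros hx hs y hy.
  pose proof (alternate_pos 1) as ha. set (t := alternate c 1 * y).
  assert (ht : 0 <= t < 1 / 3).
  { unfold t. split; [apply Rmult_le_pos; lra|]. apply Rle_lt_trans with (alternate c 1 * x); [|exact hs].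
    apply Rmult_le_compat_l; lra. }
  assert (hgeo : is_series (fun n => t ^ n) (/ (1 - t))) by (apply is_series_geom; rewrite Rabs_pos_eq; lra).
  assert (hb : forall n, Rabs (c n * y ^ n) <= t ^ n).
  { intro n. rewrite Rabs_mult, (Rabs_pos_eq (y ^ n)) by (apply pow_le; lra).
    assert (e : Rabs (c n) = alternate c n).
    { rewrite <- (Rabs_pos_eq (alternate c n)) by (left; apply alternate_pos). unfold alternate.
      now rewrite Rabs_mult, pow_1_abs, Rmult_1_l. }
    rewrite e. unfold t. rewrite Rpow_mult_distr. apply Rmult_le_compat_r; [apply pow_le; lra|apply alternate_geom]. }
  assert (hex : ex_series (fun n => c n * y ^ n)) by (apply (ex_series_dominated _ (fun n => t ^ n) hb); eexists; exact hgeo).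
  unfold PSeries. rewrite (Series_incr_1 _ hex). rewrite c0. simpl pow at 1.
  assert (h1 : Rabs (Series (fun n => c (S n) * y ^ S n)) <= Series (fun n => t * t ^ n)).
  { apply Series_dominated; [intro n; apply (hb (S n))|].
    apply (ex_series_scal_l t (fun n => t ^ n)). eexists; exact hgeo. }
  assert (e : Series (fun n => t * t ^ n) = t * / (1 - t)).
  { rewrite (Series_scal_l t (fun n => t ^ n)). f_equal. apply is_series_unique. exact hgeo. }
  rewrite e in h1.
  assert (t * / (1 - t) < 1).
  { apply (Rmult_lt_reg_r (1 - t)); [lra|]. rewrite Rmult_assoc, Rinv_l; lra. }
  apply Rabs_le_between in h1. lra.
Qed.

(** At [- x] the function [euler_poly (- beta)] is the sum of
    [(n - beta) |c_n| x ^ n], where only the constant term is negative; it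
    increases strictly, and its root satisfies [(1 - beta) |c_1| x <= beta], so
    that [|c_1| x < 1 / 3]. *)
Lemma negative_euler_root beta : 0 < beta < 1 / 4 -> exists x0, 0 < x0 /\
  euler_poly (- beta) (- x0) = 0 /\ (forall x, 0 < x -> euler_poly (- beta) (- x) = 0 -> x = x0) /\
  positive_upto c x0 /\
  forall w : C, Cmod w < x0 -> Re (log_ratio c w) < beta.
Proof.
  intros hb.
  set (m := fun n => (INR n - beta) * alternate c n).
  assert (halt : entire (alternate c)) by now apply entire_alternate.
  assert (hmE : forall x, euler_poly (- beta) (- x) = PSeries m x).
  { intro x. unfold euler_poly. rewrite !PSeries_alternate. unfold PSeries.
    rewrite <- Series_scal_l, <- Series_plus.
    - apply Series_ext. intro n. unfold m, theta, alternate. ring.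
    - apply (ex_series_scal_l (- beta) (fun n => alternate c n * x ^ n)). now apply entire_ex_series.
    - apply entire_ex_series. apply entire_alternate. now apply entire_theta. }
  assert (hmex : forall x, ex_series (fun n => m n * x ^ n)).
  { intro x. apply (ex_series_ext (fun n => theta (alternate c) n * x ^ n + - beta * (alternate c n * x ^ n))).
    - intro n. change (theta (alternate c) n * x ^ n + - beta * (alternate c n * x ^ n) = m n * x ^ n). unfold m, theta. ring.
    - apply (ex_series_plus (fun n => theta (alternate c) n * x ^ n) (fun n => - beta * (alternate c n * x ^ n))).
      + apply entire_ex_series. now apply entire_theta.
      + apply (ex_series_scal_l (- beta) (fun n => alternate c n * x ^ n)). now apply entire_ex_series. }
  assert (m0 : m 0%nat = - beta) by (unfold m, alternate; simpl; rewrite c0; ring).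
  pose proof (alternate_pos 1) as ha1.
  assert (hmpos : forall n, 0 < m (S n)).
  { intro n. unfold m. apply Rmult_lt_0_compat; [|apply alternate_pos]. rewrite S_INR. pose proof (pos_INR n). lra. }
  assert (hmono : forall x y, 0 <= x < y -> PSeries m x + m 1%nat * (y - x) <= PSeries m y).
  { intros x y hxy. 
    assert (h : m 1%nat * (y - x) <= PSeries m y - PSeries m x); [|lra].
    unfold PSeries. rewrite <- Series_minus by apply hmex.
    replace (m 1%nat * (y - x)) with ((fun n => m n * y ^ n - m n * x ^ n) 1%nat) by (simpl; ring).
    apply (Series_ge_term (fun n => m n * y ^ n - m n * x ^ n) 1).
    - intros [|n]; [simpl; lra|]. rewrite <- Rmult_minus_distr_l. apply Rmult_le_pos; [left; apply hmpos|].
      assert (x ^ S n <= y ^ S n) by (apply pow_incr; lra). lra.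
    - apply (ex_series_minus (fun n => m n * y ^ n) (fun n => m n * x ^ n)); apply hmex. }
  assert (hM0 : PSeries m 0 = - beta) by (rewrite PSeries_0; exact m0).
  (* the linear part - beta + m_1 x of the series is a lower bound, with root X *)
  set (X := beta / m 1%nat).
  assert (hX : 0 < X) by (apply Rdiv_lt_0_compat; [lra|apply hmpos]).
  assert (hMX : 0 <= PSeries m X).
  { pose proof (hmono 0 X ltac:(lra)) as h. rewrite hM0, Rminus_0_r in h.
    replace (m 1%nat * X) with beta in h by (unfold X; field; pose proof (hmpos 0%nat); lra). lra. }
  destruct (first_zero (fun x => - euler_poly (- beta) (- x)) X) as (x0 & h1 & h2 & h3).
  - intro x. apply continuity_pt_opp. apply (continuity_pt_comp Ropp (euler_poly (- beta))).
    + apply continuity_pt_opp, continuity_pt_id.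
    + apply euler_poly_continuity.
  - rewrite hmE, hM0. lra.
  - exact hX.
  - rewrite hmE. lra.
  - assert (hz : PSeries m x0 = 0) by (rewrite hmE in h2; lra).
    assert (hp : positive_upto c x0).
    { apply positive_of_small; [lra|].
      pose proof (hmono 0 x0 ltac:(lra)) as h. rewrite hM0, hz, Rminus_0_r in h.
      unfold m in h. change (INR 1) with 1 in h. 
      assert ((1 - beta) * (alternate c 1 * x0) <= beta) by lra.
      apply (Rmult_lt_reg_l (1 - beta)); [lra|]. lra. }
    exists x0. split; [lra|]. split; [rewrite hmE; exact hz|]. split; [|split; [exact hp|]].
    + intros x hx he. rewrite hmE in he. pose proof (hmpos 0%nat).
      destruct (Rtotal_order x x0) as [h|[h|h]]; [|exact h|].
      * pose proof (hmono x x0 ltac:(lra)). nra.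
      * pose proof (hmono x0 x ltac:(lra)). nra.
    + intros w hw. pose proof (Cmod_ge_0 w) as hw0.
      rewrite (log_ratio_eq x0 w hw hp).
      change (- Re (w * CPS q w)%C < beta).
      pose proof (Re_log_derivative_lower x0 w hw hp) as hl.
      specialize (h3 (Cmod w) ltac:(lra)). cbv beta in h3. unfold euler_poly in h3.
      rewrite (PSeries_theta_log x0) in h3 by (try assumption; rewrite Rabs_Ropp, Rabs_pos_eq; lra).
      assert (hc : 0 < PSeries c (- Cmod w)).
      { rewrite PSeries_alternate. apply Rlt_le_trans with (alternate c 0 * Cmod w ^ 0); [simpl; rewrite Rmult_1_r; apply alternate_pos|].
        apply (Series_ge_term (fun n => alternate c n * Cmod w ^ n) 0).
        - intro n. apply Rmult_le_pos; [left; apply alternate_pos|now apply pow_le].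
        - now apply entire_ex_series. }
      assert (Cmod w * PSeries q (- Cmod w) < beta) by nra. lra.
Qed.
End Negative.

End LogDerivative.

(** * The normalized functions g and h *)

Lemma hyp_ratio_le a b c n : 0 < a -> 0 < b -> 0 < c -> hyp_ratio a b c n <= hyp_ratio a b c 0.
Proof.
  intros ha hb hc. unfold hyp_ratio. pose proof (pos_INR n) as hn. rewrite S_INR. simpl INR.
  assert (h1 : 0 < 64 * 1 <= 64 * (INR n + 1)) by lra.
  assert (step : forall u v x y, 0 < u <= v -> 0 < x <= y -> 0 < u * x <= v * y).
  { intros u v x y hu hx. split; [apply Rmult_lt_0_compat; lra|apply Rmult_le_compat; lra]. }
  assert (h2 := step _ _ (a + 0) (a + INR n) h1 ltac:(lra)).
  assert (h3 := step _ _ (b + 0) (b + INR n) h2 ltac:(lra)).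
  assert (h4 := step _ _ (c + 0) (c + INR n) h3 ltac:(lra)).
  apply Rinv_le_contravar; apply h4.
Qed.

Section Coefficients.
Variable nu : R.
Hypothesis hnu : -1 < nu.

Lemma cross_coef_alt_S n : alternate (cross_coef nu) (S n) =
  alternate (cross_coef nu) n * hyp_ratio (nu + 1) (nu / 2 + 1) ((nu + 3) / 2) n.
Proof. unfold alternate, cross_coef. cbn [hyp_coef]. simpl pow. ring. Qed.

Lemma cross_coef_alt_pos n : 0 < alternate (cross_coef nu) n.
Proof.
  induction n as [|n IH]; [unfold alternate, cross_coef; simpl; lra|].
  rewrite cross_coef_alt_S. apply Rmult_lt_0_compat; [exact IH|]. apply hyp_ratio_pos; lra.
Qed.

Lemma cross_coef_alt_geom n : alternate (cross_coef nu) n <= alternate (cross_coef nu) 1 ^ n.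
Proof.
  induction n as [|n IH]; [unfold alternate, cross_coef; simpl; lra|].
  rewrite cross_coef_alt_S. simpl pow. rewrite (Rmult_comm _ (_ ^ n)).
  pose proof (cross_coef_alt_pos n).
  apply Rmult_le_compat; [lra|left; apply hyp_ratio_pos; lra|exact IH|].
  rewrite cross_coef_alt_S. replace (alternate (cross_coef nu) 0) with 1 by (unfold alternate, cross_coef; simpl; ring).
  rewrite Rmult_1_l. apply hyp_ratio_le; lra.
Qed.

Lemma cross_coef_limit_of_roots : exists q, limit_of_roots (cross_coef nu) q /\ 0 < q 0%nat.
Proof.
  destruct (rayleigh_sums (nu + 1) (nu / 2 + 1) ((nu + 3) / 2)) as [q hq]; try lra.
  exists q. split; [exact hq|].
  pose proof (proj1 hq 0%nat) as h1. unfold PS_mult in h1. cbn [sum_f_R0 hyp_coef] in h1. simpl in h1.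
  pose proof (hyp_ratio_pos (nu + 1) (nu / 2 + 1) ((nu + 3) / 2) ltac:(lra) ltac:(lra) ltac:(lra) 0). lra.
Qed.

End Coefficients.

(** At [z = 0] the constant term comes from the convention [0 ^ 0 = 1]; for order
    0 the closed form holds at the origin too. *)
Lemma Bessel_zero_order (z : C) :
  BesselJ 0 z = (RtoC (bessel_factor 0) * CPS (bessel_coef 0) (z * z))%C /\
  BesselI 0 z = (RtoC (bessel_factor 0) * CPS (alternate (bessel_coef 0)) (z * z))%C.
Proof.
  destruct (Ceq_dec z 0) as [->|hz].
  - replace (0 * 0)%C with (RtoC 0) by ring.
    assert (hz : forall n, Cpower (0 / 2) (2 * INR n + 0) = RtoC (0 ^ n)).
    { intro n. replace (0 / 2)%C with (RtoC 0) by (unfold Cdiv; ring).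
      unfold Cpower. destruct (Ceq_dec 0 0) as [_|h]; [|now contradiction h].
      destruct n as [|n].
      - simpl. destruct (Req_dec_T (2 * 0 + 0) 0) as [_|h]; [reflexivity|]. exfalso; apply h; ring.
      - pose proof (INR_S_pos n).
        destruct (Req_dec_T (2 * INR (S n) + 0) 0) as [h|_]; [lra|]. simpl. f_equal. ring. }
    assert (hs : forall (a b : nat -> R) k, a 0%nat = k * b 0%nat ->
       CSeries (fun n => RtoC (a n) * Cpower (0 / 2) (2 * INR n + 0))%C = (RtoC k * CPS b (RtoC 0))%C).
    { intros a b k h. rewrite CPS_at_0, <- RtoC_mult, <- h, <- (CPS_at_0 a).
      unfold CPS, CSeries. f_equal; apply Series_ext; intro n; now rewrite hz, RtoC_pow. }
    assert (hG : 0 < Gamma (0 + 1)) by (apply Gamma_pos; lra).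
    assert (hG' : 0 < Gamma (0 + 0 + 1)) by (apply Gamma_pos; lra).
    split; apply hs; unfold alternate, bessel_factor; simpl; rewrite Ropp_0, Rpower_O by lra;
    replace (0 + 0 + 1) with (0 + 1) in * by ring; field; lra.
  - pose proof (BesselJ_eq 0 ltac:(lra) z hz) as h1. pose proof (BesselI_eq 0 ltac:(lra) z hz) as h2.
    rewrite h1, h2, Cpower_nz by exact hz.
    replace (RtoC 0 * Clog z)%C with (RtoC 0) by ring. rewrite Cexp_0. split; ring.
Qed.

(** In order 0 the prefactor of [g_] equals 1 at the origin, so that [Phi] itself has
    to vanish there. *)
Lemma Phi_0_0 : Phi 0 0 = 0%C.
Proof.
  assert (hd : forall a, entire a -> C_derive (fun z => RtoC (bessel_factor 0) * CPS a (z * z))%C 0 = 0%C).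
  { intros a ha. apply is_C_derive_unique.
    eapply Cis_derive_eq.
    - apply Cis_derive_scal. apply (Cis_derive_comp (CPS a) (fun w => w * w)%C).
      + now apply entire_derive.
      + apply Cis_derive_mult; apply Cis_derive_id.
    - cbv beta. ring. }
  assert (hA : entire (bessel_coef 0)) by (apply bessel_entire; lra).
  unfold Phi.
  rewrite (functional_extensionality _ _ (fun z => proj1 (Bessel_zero_order z))).
  rewrite (functional_extensionality _ _ (fun z => proj2 (Bessel_zero_order z))).
  rewrite !hd by (try apply entire_alternate; exact hA). ring.
Qed.

Lemma Cpower_0 a : a <> 0 -> Cpower 0 a = 0%C.
Proof.
  intro h. unfold Cpower. destruct (Ceq_dec 0 0) as [_|n]; [|now contradiction n].
  now destruct (Req_dec_T a 0).
Qed.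

Lemma CSeries_0 (u : nat -> C) : (forall n, u n = 0%C) -> CSeries u = 0%C.
Proof.
  intro h. unfold CSeries. apply injective_projections; simpl.
  - rewrite (Series_ext _ (fun n => 0 * Re (u n))) by (intro n; rewrite h; simpl; ring).
    rewrite Series_scal_l. ring.
  - rewrite (Series_ext _ (fun n => 0 * Im (u n))) by (intro n; rewrite h; simpl; ring).
    rewrite Series_scal_l. ring.
Qed.

(** This serves the order [3 / 2], where the prefactor of [h_] equals 1 at the
    origin. *)
Lemma Phi_pos_0 nu : 0 < nu -> Phi nu 0 = 0%C.
Proof.
  intro h.
  assert (hz : forall n, Cpower (0 / 2) (2 * INR n + nu) = 0%C).
  { intro n. replace (0 / 2)%C with (RtoC 0) by (unfold Cdiv; ring).
    apply Cpower_0. pose proof (pos_INR n). lra. }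
  assert (hJ : BesselJ nu 0 = 0%C) by (apply CSeries_0; intro n; rewrite hz; ring).
  assert (hI : BesselI nu 0 = 0%C) by (apply CSeries_0; intro n; rewrite hz; ring).
  unfold Phi. rewrite hJ, hI. ring.
Qed.

Section Normalized.
Variable nu : R.
Hypothesis hnu : -1 < nu.
Let c := cross_coef nu.

Lemma norm_cancel (u : C) : (RtoC (normalizing_const nu) * (RtoC (/ normalizing_const nu) * u))%C = u.
Proof.
  pose proof (normalizing_const_pos nu hnu).
  rewrite RtoC_inv by lra. field. apply RtoC_neq0. lra.
Qed.

Lemma norm_Phi (z : C) : z <> 0%C ->
  (RtoC (normalizing_const nu) * Phi nu z)%C = (Cpower z (2 * nu) * (z * CPS c (z ^ 4)))%C.
Proof. intro hz. rewrite Phi_eq by assumption. apply norm_cancel. Qed.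

Lemma Phi_neq0 (z : C) : z <> 0%C -> CPS c (z ^ 4) <> 0%C <-> Phi nu z <> 0%C.
Proof.
  intro hz. pose proof (normalizing_const_pos nu hnu) as hN.
  rewrite Phi_eq by assumption. fold c.
  pose proof (Cpower_neq0 z (2 * nu) hz) as hp. unfold W. fold c.
  assert (hN' : RtoC (/ normalizing_const nu) <> 0%C) by (apply RtoC_neq0, Rinv_neq_0_compat; lra).
  split; intro h.
  - repeat apply Cmult_neq_0; assumption.
  - intro e. apply h. rewrite e. ring.
Qed.

Lemma g_eq : g_ nu = (fun z => z * CPS c (z ^ 4))%C.
Proof.
  apply functional_extensionality. intro z. unfold g_.
  destruct (Ceq_dec z 0) as [->|hz].
  - replace (0 * CPS c (0 ^ 4))%C with (RtoC 0) by ring.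
    destruct (Req_dec nu 0) as [->|hn].
    + rewrite Phi_0_0. ring.
    + rewrite Cpower_0 by lra. ring.
  - transitivity (Cpower z (- 2 * nu) * (RtoC (normalizing_const nu) * Phi nu z))%C.
    { unfold normalizing_const. rewrite !RtoC_mult. ring. }
    rewrite norm_Phi, Cmult_assoc, <- Cpower_plus by exact hz.
    replace (-2 * nu + 2 * nu) with 0 by ring.
    rewrite Cpower_nz by exact hz. replace (RtoC 0 * Clog z)%C with (RtoC 0) by ring.
    rewrite Cexp_0. ring.
Qed.

Lemma quarter_pow (z : C) : z <> 0%C -> (Cpower z (1 / 4) ^ 4)%C = z.
Proof.
  intro hz. rewrite Cpower_nz by exact hz. rewrite <- Cexp_INR, Cmult_assoc, <- RtoC_mult.
  replace (INR 4 * (1 / 4)) with 1 by (simpl; field).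
  replace (RtoC 1 * Clog z)%C with (Clog z) by ring. now apply Cexp_Clog.
Qed.

Lemma Cpower_quarter (z : C) a : z <> 0%C -> Cpower (Cpower z (1 / 4)) a = Cpower z (a / 4).
Proof.
  intro hz. rewrite Cpower_nz by now apply Cpower_neq0.
  rewrite Clog_quarter, (Cpower_nz z (a / 4)) by exact hz. f_equal.
  rewrite Cmult_assoc, <- RtoC_mult. replace (a * (1 / 4)) with (a / 4) by field. reflexivity.
Qed.

Lemma Cpower_1 (z : C) : z <> 0%C -> Cpower z 1 = z.
Proof. intro hz. change 1 with (INR 1). rewrite Cpower_INR by exact hz. apply Cpow_1_r. Qed.

Lemma h_eq : h_ nu = (fun z => z * CPS c (z ^ 1))%C.
Proof.
  apply functional_extensionality. intro z. unfold h_.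
  destruct (Ceq_dec z 0) as [->|hz].
  - replace (0 * CPS c (0 ^ 1))%C with (RtoC 0) by ring.
    rewrite (Cpower_0 (1 / 4)) by lra.
    destruct (Req_dec nu (3 / 2)) as [->|hn].
    + rewrite Phi_pos_0 by lra. ring.
    + rewrite Cpower_0 by lra. ring.
  - pose proof (Cpower_neq0 z (1 / 4) hz) as hu.
    transitivity (Cpower z (- nu / 2 + 3 / 4) * (RtoC (normalizing_const nu) * Phi nu (Cpower z (1 / 4))))%C.
    { unfold normalizing_const. rewrite !RtoC_mult. ring. }
    rewrite norm_Phi, quarter_pow, Cpower_quarter, !Cmult_assoc, <- !Cpower_plus by assumption.
    replace (- nu / 2 + 3 / 4 + 2 * nu / 4 + 1 / 4) with 1 by field.
    rewrite Cpower_1, Cpow_1_r by exact hz. reflexivity.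
Qed.

(** All the equations of the theorem are [euler_poly] up to a nonvanishing factor.
    The point [y] is [r ^ 4] on the positive axis and [- r ^ 4] on the ray through
    [sqrt_i]. *)
Lemma root_equation (lambda y : R) (z : C) : z <> 0%C -> (z ^ 4)%C = RtoC y ->
  (z * C_derive (Phi nu) z - RtoC lambda * Phi nu z)%C = 0%C <->
  euler_poly c ((2 * nu + 1 - lambda) / 4) y = 0.
Proof.
  intros hz hy. pose proof (normalizing_const_pos nu hnu) as hN.
  rewrite C_derive_Phi, Phi_eq by assumption. unfold W. fold c. rewrite hy, !CPS_RtoC.
  set (e := euler_poly c ((2 * nu + 1 - lambda) / 4) y).
  assert (he : (RtoC (/ normalizing_const nu) * Cpower z (2 * nu) * z *
    (RtoC (2 * nu + 1) * RtoC (PSeries c y) + 4 * RtoC (PSeries (theta c) y)) -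
    RtoC lambda * (RtoC (/ normalizing_const nu) * (Cpower z (2 * nu) * (z * RtoC (PSeries c y)))))%C =
    (RtoC (/ normalizing_const nu) * Cpower z (2 * nu) * z * RtoC (4 * e))%C).
  { assert (h4 : 4 * e = (2 * nu + 1 - lambda) * PSeries c y + 4 * PSeries (theta c) y) by (unfold e, euler_poly; field).
    rewrite h4, !RtoC_plus, !RtoC_mult, RtoC_minus, !RtoC_plus, !RtoC_mult. ring. }
  rewrite he. split; intro h.
  - apply Rmult_eq_reg_l with 4; [|lra]. rewrite Rmult_0_r.
    destruct (Req_dec (4 * e) 0) as [h0|h0]; [exact h0|exfalso].
    revert h. repeat apply Cmult_neq_0.
    + apply RtoC_neq0, Rinv_neq_0_compat; lra.
    + now apply Cpower_neq0.
    + exact hz.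
    + now apply RtoC_neq0.
  - rewrite h. rewrite Rmult_0_r. ring.
Qed.

End Normalized.

Lemma radius_starlikeness_eq alpha f x : 0 < x -> starlike_on_disc alpha f x ->
  (exists z : C, Cmod z = x /\ (Cex_derive f z -> f z <> 0%C ->
     Re (z * C_derive f z / f z)%C = alpha)) ->
  radius_starlikeness alpha f = Finite x.
Proof.
  intros hx hs (z & hz & hf). apply is_lub_Rbar_unique. split.
  - intros r [hr hsr]. simpl. apply Rnot_lt_le. intro hlt.
    destruct (hsr z ltac:(lra)) as [h1 h2].
    assert (hz0 : z <> 0%C) by (apply Cmod_gt_0; lra).
    destruct (h2 hz0) as [h3 h4]. rewrite (hf h1 h3) in h4. lra.
  - intros b hb. apply hb. split; assumption.
Qed.

Lemma root_exists y k : 0 < y -> (0 < k)%nat -> exists x, 0 < x /\ x ^ k = y.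
Proof.
  intros hy hk. exists (Rpower y (/ INR k)). split; [apply Rpower_pos|].
  rewrite <- Rpower_pow by apply Rpower_pos.
  rewrite Rpower_mult, Rinv_l, Rpower_1; auto. apply not_0_INR. lia.
Qed.

(** * Radii of starlikeness and the branch f *)

Lemma pow_lt_reg x y k : 0 <= x -> 0 <= y -> (0 < k)%nat -> x ^ k < y ^ k -> x < y.
Proof.
  intros hx hy hk h. apply Rnot_le_lt. intro hle.
  pose proof (pow_incr y x k ltac:(lra)). lra.
Qed.

Lemma pow_lt_mono x y k : 0 <= x < y -> (0 < k)%nat -> x ^ k < y ^ k.
Proof.
  intros h hk. destruct k as [|k]; [lia|]. clear hk.
  induction k as [|k IH]; [simpl; lra|].
  change (x * x ^ S k < y * y ^ S k).
  assert (0 <= x ^ S k) by (apply pow_le; lra). nra.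
Qed.

Section Radius.
Variables c q : nat -> R.
Hypothesis c0 : c 0%nat = 1.
Hypothesis centire : entire c.
Hypothesis hq : limit_of_roots c q.
Hypothesis q0 : 0 < q 0%nat.

(** What [f], [g] and [h] have in common: for them [k] is [4 / (2 nu + 1)], 4, 1
    and the exponent [S j] is 4, 4, 1. *)
Definition log_derivative_form (f : C -> C) (k : R) (j : nat) : Prop :=
  Cex_derive f (RtoC 0) /\
  forall rho (z : C), z <> 0%C -> Cmod z ^ S j < rho -> positive_upto c rho ->
    Cex_derive f z /\ f z <> 0%C /\
    Re (z * C_derive f z / f z)%C = 1 + k * Re (log_ratio c (z ^ S j)%C).

Lemma log_derivative_form_entire j :
  log_derivative_form (fun z => z * CPS c (z ^ S j))%C (INR (S j)) j.
Proof.
  assert (hD : forall z : C, Cis_derive (fun z => z * CPS c (z ^ S j))%C z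
    (CPS c (z ^ S j) + RtoC (INR (S j)) * CPS (theta c) (z ^ S j))%C).
  { intro z. eapply Cis_derive_eq.
    - apply (Cis_derive_mult (fun z => z) (fun z => CPS c (z ^ S j))%C); [apply Cis_derive_id|].
      apply (Cis_derive_comp (CPS c) (fun z => z ^ S j)%C); [now apply entire_derive|apply Cis_derive_pow].
    - cbv beta. rewrite CPS_theta by exact centire. rewrite Cpow_S. ring. }
  split; [eexists; apply hD|]. intros rho z hz hzr hp.
  assert (hnz : CPS c (z ^ S j) <> 0%C).
  { apply (CPS_nonzero c q c0 centire hq rho); [now rewrite Cmod_pow|exact hp]. }
  split; [eexists; apply hD|]. split; [now apply Cmult_neq_0|].
  rewrite (is_C_derive_unique (fun z : C => z * CPS c (z ^ S j))%C z _ (hD z)).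
  replace (z * (CPS c (z ^ S j) + RtoC (INR (S j)) * CPS (theta c) (z ^ S j)) / (z * CPS c (z ^ S j)))%C
    with (RtoC 1 + RtoC (INR (S j)) * log_ratio c (z ^ S j))%C by (unfold log_ratio; field; split; assumption).
  generalize (log_ratio c (z ^ S j)%C). intro u. unfold Re; simpl. ring.
Qed.

(** The inequality holds on the disc of radius [Cmod z0] and becomes an equality
    at [z0]. *)
Lemma radius_at (f : C -> C) k j alpha x0 (z0 : C) : log_derivative_form f k j ->
  0 < x0 -> positive_upto c x0 ->
  (forall w : C, Cmod w < x0 -> alpha < 1 + k * Re (log_ratio c w)) ->
  z0 <> 0%C -> Cmod z0 ^ S j = x0 ->
  1 + k * Re (log_ratio c (z0 ^ S j)%C) = alpha ->
  radius_starlikeness alpha f = Finite (Cmod z0).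
Proof.
  intros [hf0 hf] hx0 hp hlt hz0 hz0x he.
  apply radius_starlikeness_eq; [now apply Cmod_gt_0| |].
  - intros z hz. destruct (Ceq_dec z 0) as [->|hzn].
    + split; [exact hf0|intro h; now contradiction h].
    + assert (hzj : Cmod z ^ S j < x0).
      { rewrite <- hz0x. apply pow_lt_mono; [split; [apply Cmod_ge_0|exact hz]|lia]. }
      destruct (hf x0 z hzn hzj hp) as (h1 & h2 & h3).
      split; [exact h1|]. intros _. split; [exact h2|]. rewrite h3. apply hlt. now rewrite Cmod_pow.
  - exists z0. split; [reflexivity|]. intros _ _.
    destruct (positive_extend _ centire x0 ltac:(lra) hp) as [rho [hr hp']].
    destruct (hf rho z0 hz0 ltac:(lra) hp') as (_ & _ & h3). rewrite h3. exact he.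
Qed.

Lemma log_derivative_at_root beta (x : R) : PSeries c x <> 0 -> euler_poly c beta x = 0 ->
  Re (log_ratio c (RtoC x)) = - beta.
Proof.
  intros hx he. unfold log_ratio. rewrite !CPS_RtoC. unfold Cdiv. rewrite <- RtoC_inv, <- RtoC_mult by exact hx. simpl Re.
  unfold euler_poly in he. replace (PSeries (theta c) x) with (- beta * PSeries c x) by lra. field. exact hx.
Qed.

Lemma radius_positive (f : C -> C) k j alpha : log_derivative_form f k j -> 0 < k -> alpha < 1 ->
  exists x, 0 < x /\ euler_poly c ((1 - alpha) / k) (x ^ S j) = 0 /\
    (forall y, 0 <= y < x ^ S j -> 0 < euler_poly c ((1 - alpha) / k) y) /\
    radius_starlikeness alpha f = Finite x.
Proof.
  intros hf hk ha. set (beta := (1 - alpha) / k).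
  assert (hb : 0 < beta) by (apply Rdiv_lt_0_compat; lra).
  assert (hkb : k * beta = 1 - alpha) by (unfold beta; field; lra).
  destruct (first_euler_root c q c0 centire hq q0 beta hb) as (x0 & hx0 & he & hlt & hp).
  destruct (root_exists x0 (S j) hx0 ltac:(lia)) as (x & hx & hxj).
  exists x. rewrite hxj. split; [exact hx|]. split; [exact he|]. split; [exact hlt|].
  assert (hm : Cmod (RtoC x) = x) by (rewrite Cmod_R; apply Rabs_pos_eq; lra).
  rewrite <- hm. apply (radius_at f k j alpha x0); try assumption.
  - intros w hw. pose proof (euler_root_bound c q c0 centire hq beta x0 w hx0 hlt hp hw). nra.
  - apply RtoC_neq0. lra.
  - now rewrite hm.
  - rewrite <- RtoC_pow, hxj, (log_derivative_at_root beta); [lra| |exact he].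
    apply Rgt_not_eq, hp. lra.
Qed.

End Radius.

Lemma modulus_hderiv (f g : C -> C) (z lf lg : C) d : 0 < d ->
  (forall w : C, Cmod (w - z)%C < d -> Cmod (f w) = Cmod (g w)) ->
  hderiv f z lf -> hderiv g z lg ->
  Re (Cconj (f z) * lf)%C = Re (Cconj (g z) * lg)%C.
Proof.
  intros hd hm hf hg.
  assert (key : forall (f : C -> C) (lf : C), hderiv f z lf ->
    is_derive (fun x : R => Cmod (f (x, Im z)) ^ 2) (Re z) (2 * Re (Cconj (f z) * lf)%C)).
  { clear. intros f lf [h1 h2]. assert (hz : (Re z, Im z) = z) by (now destruct z).
    apply (is_derive_ext (fun x : R => Re (f (x, Im z)) * Re (f (x, Im z)) + Im (f (x, Im z)) * Im (f (x, Im z)))).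
    { intro t. rewrite Cmod_sq. match goal with |- ?x = ?y => change (@eq R x y) end. ring. }
    evar_last.
    - exact (is_derive_plus _ _ _ _ _ (is_derive_mult _ _ _ _ _ h1 h1 Rmult_comm) (is_derive_mult _ _ _ _ _ h2 h2 Rmult_comm)).
    - cbv beta. rewrite hz. unfold Re, Im, plus, mult; simpl. ring. }
  apply key in hf. apply key in hg.
  assert (hg' : is_derive (fun x : R => Cmod (f (x, Im z)) ^ 2) (Re z) (2 * Re (Cconj (g z) * lg)%C)).
  { eapply is_derive_ext_loc; [|exact hg].
    exists (mkposreal d hd). intros x hx. change (Rabs (x - Re z) < d) in hx.
    change R in (type of x).
    assert (e : Cmod ((x, Im z) - z)%C = Rabs (x - Re z)).
    { rewrite <- Cmod_R. f_equal. destruct z as [a b]. apply injective_projections; simpl; ring. }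
    rewrite (hm (x, Im z)); [reflexivity|]. rewrite e. exact hx. }
  apply is_derive_unique in hf. apply is_derive_unique in hg'. lra.
Qed.

(** The derivative of [|f|^2 / 2] in a direction [v] is [Re (conj f * f' * v)]; the
    directions 1 and [i] determine [conj f * f']. *)
Lemma modulus_derive (f g : C -> C) (z lf lg : C) d : 0 < d ->
  (forall w : C, Cmod (w - z)%C < d -> Cmod (f w) = Cmod (g w)) ->
  Cis_derive f z lf -> Cis_derive g z lg ->
  (Cconj (f z) * lf)%C = (Cconj (g z) * lg)%C.
Proof.
  intros hd hm hf hg.
  (* rot turns the horizontal direction at z into the vertical one *)
  set (rot := fun w : C => (z + Ci * (w - z))%C).
  assert (hrot : Cis_derive rot z Ci).
  { apply Cis_derive_quadratic with (M := 0) (d := 1); [lra|]. intros h _. unfold rot.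
    replace (z + Ci * (z + h - z) - (z + Ci * (z - z)) - h * Ci)%C with (RtoC 0) by ring.
    rewrite Cmod_0. lra. }
  assert (hz : rot z = z) by (unfold rot; ring).
  pose proof (modulus_hderiv f g z lf lg d hd hm (hderiv_of_Cis_derive _ _ _ hf) (hderiv_of_Cis_derive _ _ _ hg)) as h1.
  assert (h2 : Re (Cconj (f (rot z)) * (Ci * lf))%C = Re (Cconj (g (rot z)) * (Ci * lg))%C).
  { apply (modulus_hderiv (fun w => f (rot w)) (fun w => g (rot w)) z _ _ d hd).
    - intros w hw. apply hm. replace (rot w - z)%C with (Ci * (w - z))%C by (unfold rot; ring).
      rewrite Cmod_mult, Cmod_Ci. lra.
    - apply hderiv_of_Cis_derive. apply Cis_derive_comp; [rewrite hz; exact hf|exact hrot].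
    - apply hderiv_of_Cis_derive. apply Cis_derive_comp; [rewrite hz; exact hg|exact hrot]. }
  rewrite hz in h2.
  apply injective_projections; [exact h1|].
  revert h2. generalize (Cconj (f z)) (Cconj (g z)). intros [a1 a2] [b1 b2]. unfold Re; simpl. lra.
Qed.

Lemma power_value_Cmod u a w : is_power_value u a w -> Cmod w = exp (a * ln (Cmod u)).
Proof.
  intros (l & <- & ->). rewrite !Cmod_Cexp, ln_exp. f_equal. unfold Re; simpl. ring.
Qed.

Section Branch.
Variable nu : R.
Hypothesis hnu : -1 < nu.
Let c := cross_coef nu.
Variable q : nat -> R.
Hypothesis hq : limit_of_roots c q.

Let c0 : c 0%nat = 1 := eq_refl.
Let centire : entire c := cross_entire nu hnu.

(** [L = CPS (log_coef q)] is a logarithm of [W] inside its first positive zero. *)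
Definition branch (a : R) (z : C) : C := (z * Cexp (RtoC a * CPS (log_coef q) (z ^ 4)))%C.

Lemma Cis_derive_branch a rho (z : C) : Cmod z ^ 4 < rho -> positive_upto c rho ->
  Cis_derive (branch a) z (Cexp (RtoC a * CPS (log_coef q) (z ^ 4)) *
    (1 - RtoC (4 * a) * (z ^ 4 * CPS q (z ^ 4))))%C.
Proof.
  intros hz hp.
  eapply Cis_derive_eq.
  - apply (Cis_derive_mult (fun z => z) (fun z => Cexp (RtoC a * CPS (log_coef q) (z ^ 4)))%C); [apply Cis_derive_id|].
    apply (Cis_derive_comp Cexp (fun z => RtoC a * CPS (log_coef q) (z ^ 4))%C); [apply Cis_derive_Cexp|].
    apply Cis_derive_scal.
    apply (Cis_derive_comp (CPS (log_coef q)) (fun z => z ^ 4)%C); [|apply (Cis_derive_pow 3)].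
    apply (Cis_derive_log c q c0 hq rho); [now rewrite Cmod_pow|exact hp].
  - cbv beta. rewrite RtoC_mult. replace (INR 4) with 4 by (simpl; ring). ring.
Qed.

Lemma positive_of_Phi r : 0 <= r ->
  (forall w : C, w <> 0%C -> Cmod w <= r -> Phi nu w <> 0%C) -> positive_upto c (r ^ 4).
Proof.
  intros hr h. apply (positive_of_nonzero c c0 centire); [now apply pow_le|].
  intros x hx. destruct (Req_dec x 0) as [->|hx0]; [rewrite PSeries_0; rewrite c0; lra|].
  destruct (root_exists x 4 ltac:(lra) ltac:(lia)) as [y [hy hy4]].
  assert (hyr : y <= r).
  { apply Rnot_lt_le. intro hlt. pose proof (pow_lt_mono r y 4 ltac:(lra) ltac:(lia)). lra. }
  assert (hy0 : RtoC y <> 0%C) by (apply RtoC_neq0; lra).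
  specialize (h (RtoC y) hy0). rewrite Cmod_R, Rabs_pos_eq in h by lra. specialize (h hyr).
  apply (Phi_neq0 nu hnu (RtoC y) hy0) in h.
  rewrite <- RtoC_pow, hy4 in h. fold c in h. rewrite CPS_RtoC in h. intro e. apply h. now rewrite e.
Qed.

Lemma Phi_of_positive rho (z : C) : Cmod z ^ 4 < rho -> positive_upto c rho ->
  forall w : C, w <> 0%C -> Cmod w <= Cmod z -> Phi nu w <> 0%C.
Proof.
  intros hz hp w hw hwz. apply (Phi_neq0 nu hnu w hw).
  apply (CPS_nonzero c q c0 centire hq rho); [|exact hp].
  rewrite Cmod_pow. eapply Rle_lt_trans; [|exact hz]. apply pow_incr. split; [apply Cmod_ge_0|exact hwz].
Qed.

Lemma branch_power_value rho (z : C) : 2 * nu + 1 <> 0 -> z <> 0%C -> Cmod z ^ 4 < rho -> positive_upto c rho ->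
  is_power_value (RtoC (normalizing_const nu) * Phi nu z)%C (1 / (2 * nu + 1)) (branch (1 / (2 * nu + 1)) z).
Proof.
  intros hn hz hzr hp.
  exists (RtoC (2 * nu + 1) * Clog z + CPS (log_coef q) (z ^ 4))%C. split.
  - rewrite Cexp_plus, norm_Phi by assumption. fold c.
    rewrite (CPS_exp_log c q c0 centire hq rho (z ^ 4)%C) by (try exact hp; now rewrite Cmod_pow).
    rewrite <- Cpower_nz by exact hz. rewrite Cpower_plus, Cpower_1 by exact hz. ring.
  - unfold branch. rewrite <- (Cexp_Clog z hz) at 1. rewrite <- Cexp_plus. f_equal.
    replace (RtoC (1 / (2 * nu + 1)) * (RtoC (2 * nu + 1) * Clog z + CPS (log_coef q) (z ^ 4)))%C
      with (RtoC (1 / (2 * nu + 1)) * RtoC (2 * nu + 1) * Clog z + RtoC (1 / (2 * nu + 1)) * CPS (log_coef q) (z ^ 4))%C by ring.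
    rewrite <- RtoC_mult. replace (1 / (2 * nu + 1) * (2 * nu + 1)) with 1 by (field; exact hn). ring.
Qed.

Lemma branch_is_f_branch : 2 * nu + 1 <> 0 -> is_f_branch nu (branch (1 / (2 * nu + 1))).
Proof.
  intro hn. split; [|split].
  - unfold branch. ring.
  - destruct (positive_extend c centire 0 (Rle_refl 0)) as [rho [hr hp]].
    { intros x hx. replace x with 0 by lra. rewrite PSeries_0. rewrite c0. lra. }
    eapply Cis_derive_eq.
    + apply (Cis_derive_branch _ rho); [rewrite Cmod_0; simpl; lra|exact hp].
    + replace (0 ^ 4)%C with (RtoC 0) by ring. rewrite CPS_at_0. simpl log_coef.
      replace (RtoC (1 / (2 * nu + 1)) * RtoC 0)%C with (RtoC 0) by ring. rewrite Cexp_0. ring.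
  - intros z hz h.
    assert (hp : positive_upto c (Cmod z ^ 4)) by (apply positive_of_Phi; [apply Cmod_ge_0|exact h]).
    destruct (positive_extend c centire (Cmod z ^ 4) ltac:(apply pow_le, Cmod_ge_0) hp) as [rho [hr hp']].
    split; [eexists; apply (Cis_derive_branch _ rho); assumption|].
    apply (branch_power_value rho); assumption.
Qed.

Lemma f_is_branch : 2 * nu + 1 <> 0 -> is_f_branch nu (f_ nu).
Proof.
  intro hn. unfold f_. apply epsilon_spec. eexists. now apply branch_is_f_branch.
Qed.

(** [f_ nu] and [branch] are values of the same multivalued real power, so they
    have equal moduli near [z], hence equal logarithmic derivatives. *)
Lemma f_log_derivative : 2 * nu + 1 <> 0 ->
  log_derivative_form c (f_ nu) (4 / (2 * nu + 1)) 3.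
Proof.
  intro hn. destruct (f_is_branch hn) as (_ & hfd & hf).
  split; [eexists; exact hfd|]. intros rho z hz hzr hp.
  set (a := 1 / (2 * nu + 1)) in *.
  assert (hmod : forall w : C, w <> 0%C -> Cmod w ^ 4 < rho -> Cmod (f_ nu w) = Cmod (branch a w)).
  { intros w hw hwr. destruct (hf w hw (Phi_of_positive rho w hwr hp)) as [_ h1].
    rewrite (power_value_Cmod _ _ _ h1).
    symmetry. exact (power_value_Cmod _ _ _ (branch_power_value rho w hn hw hwr hp)). }
  destruct (hf z hz (Phi_of_positive rho z hzr hp)) as [hex hpv].
  assert (hb0 : branch a z <> 0%C) by (apply Cmult_neq_0; [exact hz|apply Cexp_nz]).
  assert (hf0 : f_ nu z <> 0%C).
  { apply Cmod_gt_0. rewrite hmod by assumption. now apply Cmod_gt_0. }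
  split; [exact hex|]. split; [exact hf0|].
  pose proof (C_derive_correct (f_ nu) z 0%C hex) as hdf.
  pose proof (Cis_derive_branch a rho z hzr hp) as hdb.
  assert (hnear : exists d, 0 < d /\ forall w : C, Cmod (w - z)%C < d -> w <> 0%C /\ Cmod w ^ 4 < rho).
  { pose proof (proj1 (Cmod_gt_0 z) hz) as hz'.
    assert (hrho : 0 < rho) by (pose proof (pow_lt _ 4 hz'); lra).
    destruct (root_exists rho 4 hrho ltac:(lia)) as [s [hs hs4]].
    assert (hzs : Cmod z < s) by (apply (pow_lt_reg _ _ 4); [lra|lra|lia|lra]).
    exists (Rmin (Cmod z) (s - Cmod z)). split; [apply Rmin_pos; lra|]. intros w hw.
    pose proof (Rmin_l (Cmod z) (s - Cmod z)). pose proof (Rmin_r (Cmod z) (s - Cmod z)).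
    split.
    - intros ->. replace (0 - z)%C with (- z)%C in hw by ring. rewrite Cmod_opp in hw. lra.
    - rewrite <- hs4. apply pow_lt_mono; [|lia]. split; [apply Cmod_ge_0|].
      replace w with (z + (w - z))%C by ring.
      eapply Rle_lt_trans; [apply Cmod_triangle|]. lra. }
  destruct hnear as [d [hd hnear]].
  assert (hc : (Cconj (f_ nu z) * C_derive (f_ nu) z)%C = (Cconj (branch a z) *
     (Cexp (RtoC a * CPS (log_coef q) (z ^ 4)) * (1 - RtoC (4 * a) * (z ^ 4 * CPS q (z ^ 4)))))%C).
  { apply (modulus_derive (f_ nu) (branch a) z _ _ d hd); [|exact hdf|exact hdb].
    intros w hw. destruct (hnear w hw). now apply hmod. }
  assert (hsq : (f_ nu z * Cconj (f_ nu z))%C = (branch a z * Cconj (branch a z))%C).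
  { rewrite <- !Cmod2_conj, hmod by assumption. reflexivity. }
  assert (hconj : forall u : C, u <> 0%C -> Cconj u <> 0%C).
  { intros u hu. apply Cmod_gt_0. rewrite Cmod_conj. now apply Cmod_gt_0. }
  pose proof (hconj _ hf0) as hcf. pose proof (hconj _ hb0) as hcb.
  rewrite (log_ratio_eq c q c0 centire hq rho (z ^ 4)%C) by (try exact hp; now rewrite Cmod_pow).
  replace (z * C_derive (f_ nu) z / f_ nu z)%C with (1 - RtoC (4 * a) * (z ^ 4 * CPS q (z ^ 4)))%C.
  - replace (4 / (2 * nu + 1)) with (4 * a) by (unfold a; field; exact hn).
    generalize (z ^ 4 * CPS q (z ^ 4))%C. intro u. unfold Re; simpl. ring.
  - transitivity (z * (Cconj (f_ nu z) * C_derive (f_ nu) z) / (f_ nu z * Cconj (f_ nu z)))%C; [|field; split; assumption].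
    rewrite hc, hsq. unfold branch. unfold branch in hcb.
    set (E := Cexp (RtoC a * CPS (log_coef q) (z ^ 4))) in *.
    assert (hE : E <> 0%C) by apply Cexp_nz.
    field. repeat split; assumption.
Qed.

End Branch.

(** * The radii *)

Lemma smallest_root_quartic nu (hnu : -1 < nu) lambda x :
  let E := euler_poly (cross_coef nu) ((2 * nu + 1 - lambda) / 4) in
  0 < x -> E (x ^ 4) = 0 -> (forall y, 0 <= y < x ^ 4 -> 0 < E y) ->
  smallest_positive_root (fun r => (RtoC r * C_derive (Phi nu) (RtoC r) - RtoC lambda * Phi nu (RtoC r))%C) x.
Proof.
  intros E hx he hlt.
  assert (hr : forall r, 0 < r -> (RtoC r * C_derive (Phi nu) (RtoC r) - RtoC lambda * Phi nu (RtoC r))%C = 0%C <-> E (r ^ 4) = 0).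
  { intros r h. apply root_equation; [exact hnu|apply RtoC_neq0; lra|symmetry; apply RtoC_pow]. }
  split; [exact hx|]. split; [now apply hr|].
  intros y hy h. apply hr in h; [|exact hy]. apply Rnot_lt_le. intro hlt'.
  pose proof (hlt (y ^ 4)) as h1. 
  pose proof (pow_lt_mono y x 4 ltac:(lra) ltac:(lia)). pose proof (pow_lt y 4 hy). 
  specialize (h1 ltac:(lra)). lra.
Qed.

Lemma sqrt_i_pow4 : (sqrt_i ^ 4)%C = RtoC (-1).
Proof.
  unfold sqrt_i. rewrite <- Cexp_INR. unfold Cexp. simpl.
  replace ((1 + 1 + 1 + 1) * (0 * (PI / 4) - 1 * 0) - 0 * (0 * 0 + 1 * (PI / 4))) with 0 by field.
  replace ((1 + 1 + 1 + 1) * (0 * 0 + 1 * (PI / 4)) + 0 * (0 * (PI / 4) - 1 * 0)) with PI by field.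
  rewrite exp_0, cos_PI, sin_PI. apply injective_projections; simpl; ring.
Qed.

Lemma Cmod_sqrt_i : Cmod sqrt_i = 1.
Proof.
  unfold sqrt_i. rewrite Cmod_Cexp. simpl.
  replace (0 * (PI / 4) - 1 * 0) with 0 by ring. apply exp_0.
Qed.

Theorem theorem4 (alpha : R) (halpha0 : 0 <= alpha) (halpha1 : alpha < 1) :
  (* (a) *)
  (forall nu : R, - (1 / 2) < nu ->
     exists x : R,
       smallest_positive_root
         (fun r : R =>
            (RtoC r * C_derive (Phi nu) (RtoC r)
             - RtoC (alpha * (2 * nu + 1)) * Phi nu (RtoC r))%C) x /\
       radius_starlikeness alpha (f_ nu) = Finite x) /\
  (forall nu : R, - 1 < nu -> nu < - (1 / 2) ->
     exists x : R,
       unique_positive_root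
         (fun r : R =>
            (sqrt_i * RtoC r * C_derive (Phi nu) (sqrt_i * RtoC r)
             - RtoC (alpha * (2 * nu + 1)) * Phi nu (sqrt_i * RtoC r))%C) x /\
       radius_starlikeness alpha (f_ nu) = Finite x) /\
  (* (b) *)
  (forall nu : R, - 1 < nu ->
     exists y : R,
       smallest_positive_root
         (fun r : R =>
            (RtoC r * C_derive (Phi nu) (RtoC r)
             - RtoC (alpha + 2 * nu) * Phi nu (RtoC r))%C) y /\
       radius_starlikeness alpha (g_ nu) = Finite y) /\
  (* (c) *)
  (forall nu : R, - 1 < nu ->
     exists z : R,
       smallest_positive_root
         (fun r : R =>
            (RtoC (Rpower r (1 / 4)) * C_derive (Phi nu) (RtoC (Rpower r (1 / 4)))
             - RtoC (4 * alpha + 2 * nu - 3) * Phi nu (RtoC (Rpower r (1 / 4))))%C) z /\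
       radius_starlikeness alpha (h_ nu) = Finite z).
Proof.
  split; [|split; [|split]].
  - intros nu h. assert (hnu : -1 < nu) by lra.
    destruct (cross_coef_limit_of_roots nu hnu) as (q & hq & q0).
    destruct (radius_positive _ q eq_refl (cross_entire nu hnu) hq q0 (f_ nu) (4 / (2 * nu + 1)) 3 alpha)
      as (x & hx & he & hlt & hr); try assumption.
    { apply (f_log_derivative nu hnu q hq). lra. }
    { apply Rdiv_lt_0_compat; lra. }
    replace ((1 - alpha) / (4 / (2 * nu + 1))) with ((2 * nu + 1 - alpha * (2 * nu + 1)) / 4) in * by (field; lra).
    exists x. split; [now apply smallest_root_quartic|exact hr].
  - intros nu hnu h.
    destruct (cross_coef_limit_of_roots nu hnu) as (q & hq & q0).
    pose proof (cross_entire nu hnu) as ce.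
    set (beta := - ((2 * nu + 1 - alpha * (2 * nu + 1)) / 4)).
    assert (hb : 0 < beta < 1 / 4) by (unfold beta; nra).
    destruct (negative_euler_root _ q eq_refl ce hq (cross_coef_alt_pos nu hnu) (cross_coef_alt_geom nu hnu) beta hb)
      as (x0 & hx0 & he & huniq & hp & hlt).
    destruct (root_exists x0 4 hx0 ltac:(lia)) as (x & hx & hx4).
    assert (hpow : forall r, ((sqrt_i * RtoC r) ^ 4)%C = RtoC (- r ^ 4)).
    { intro r. rewrite Cpow_mult_l, sqrt_i_pow4, <- RtoC_pow, <- RtoC_mult. f_equal. ring. }
    assert (hnz : forall r, 0 < r -> (sqrt_i * RtoC r)%C <> 0%C).
    { intros r hr. apply Cmult_neq_0; [apply Cexp_nz|apply RtoC_neq0; lra]. }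
    assert (hroot : forall r, 0 < r -> (sqrt_i * RtoC r * C_derive (Phi nu) (sqrt_i * RtoC r)
             - RtoC (alpha * (2 * nu + 1)) * Phi nu (sqrt_i * RtoC r))%C = 0%C <-> euler_poly (cross_coef nu) (- beta) (- r ^ 4) = 0).
    { intros r hr. rewrite (root_equation nu hnu (alpha * (2 * nu + 1)) (- r ^ 4) _ (hnz r hr) (hpow r)).
      unfold beta. now rewrite Ropp_involutive. }
    exists x. split.
    + split; [exact hx|]. split; [apply hroot; [exact hx|]; now rewrite hx4|].
      intros y hy h1. apply hroot in h1; [|exact hy]. apply huniq in h1; [|now apply pow_lt].
      rewrite <- hx4 in h1.
      destruct (Rtotal_order y x) as [hl|[e|hl]]; [|exact e|].
      * pose proof (pow_lt_mono y x 4 ltac:(lra) ltac:(lia)). lra.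
      * pose proof (pow_lt_mono x y 4 ltac:(lra) ltac:(lia)). lra.
    + assert (hm : Cmod (sqrt_i * RtoC x)%C = x) by (rewrite Cmod_mult, Cmod_sqrt_i, Cmod_R, Rabs_pos_eq; lra).
      rewrite <- hm.
      apply (radius_at _ ce (f_ nu) (4 / (2 * nu + 1)) 3 alpha x0); try assumption.
      * apply (f_log_derivative nu hnu q hq). lra.
      * intros w hw. specialize (hlt w hw).
        apply (Rmult_lt_compat_l (4 / - (2 * nu + 1))) in hlt; [|apply Rdiv_lt_0_compat; lra].
        replace (4 / - (2 * nu + 1) * beta) with (1 - alpha) in hlt by (unfold beta; field; lra).
        replace (4 / (2 * nu + 1)) with (- (4 / - (2 * nu + 1))) by (field; lra). lra.
      * now apply hnz.
      * rewrite hm. exact hx4.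
      * rewrite hpow, hx4, (log_derivative_at_root _ (- beta)).
        -- unfold beta. field. lra.
        -- apply Rgt_not_eq. rewrite PSeries_alternate. apply Rlt_le_trans with (alternate (cross_coef nu) 0 * x0 ^ 0).
           ++ simpl pow. rewrite Rmult_1_r. now apply cross_coef_alt_pos.
           ++ apply (Series_ge_term (fun n => alternate (cross_coef nu) n * x0 ^ n) 0).
              ** intro n. apply Rmult_le_pos; [left; now apply cross_coef_alt_pos|apply pow_le; lra].
              ** now apply entire_ex_series, entire_alternate.
        -- exact he.
  - intros nu hnu.
    destruct (cross_coef_limit_of_roots nu hnu) as (q & hq & q0).
    pose proof (cross_entire nu hnu) as ce. rewrite (g_eq nu hnu).
    destruct (radius_positive _ q eq_refl ce hq q0 _ _ 3 alpha (log_derivative_form_entire _ q eq_refl ce hq 3))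
      as (x & hx & he & hlt & hr); [apply INR_S_pos|exact halpha1|].
    replace ((1 - alpha) / INR 4) with ((2 * nu + 1 - (alpha + 2 * nu)) / 4) in * by (simpl; field).
    exists x. split; [now apply smallest_root_quartic|exact hr].
  - intros nu hnu.
    destruct (cross_coef_limit_of_roots nu hnu) as (q & hq & q0).
    pose proof (cross_entire nu hnu) as ce. rewrite (h_eq nu hnu).
    destruct (radius_positive _ q eq_refl ce hq q0 _ _ 0 alpha (log_derivative_form_entire _ q eq_refl ce hq 0))
      as (x & hx & he & hlt & hr); [apply INR_S_pos|exact halpha1|].
    rewrite pow_1 in he, hlt.
    replace ((1 - alpha) / INR 1) with ((2 * nu + 1 - (4 * alpha + 2 * nu - 3)) / 4) in * by (simpl; field).
    assert (hroot : forall r, 0 < r -> (RtoC (Rpower r (1 / 4)) * C_derive (Phi nu) (RtoC (Rpower r (1 / 4)))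
        - RtoC (4 * alpha + 2 * nu - 3) * Phi nu (RtoC (Rpower r (1 / 4))))%C = 0%C <->
        euler_poly (cross_coef nu) ((2 * nu + 1 - (4 * alpha + 2 * nu - 3)) / 4) r = 0).
    { intros r hr0. pose proof (Rpower_pos r (1 / 4)) as hpos.
      apply root_equation; [exact hnu|apply RtoC_neq0; lra|].
      rewrite <- RtoC_pow. f_equal. rewrite <- Rpower_pow, Rpower_mult by exact hpos.
      replace (1 / 4 * INR 4) with 1 by (simpl; field). now apply Rpower_1. }
    exists x. split; [|exact hr].
    split; [exact hx|]. split; [now apply hroot|].
    intros y hy h1. apply hroot in h1; [|exact hy]. apply Rnot_lt_le. intro hlt'.
    specialize (hlt y ltac:(lra)). lra.
Qed.
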